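(* For every $\theta>0$ there exists $n_0$ such that for every $n\ge n_0$ and every $(n+1)$-regular graph $G$ on $2n$ vertices, if $S$ is a uniformly random subset of $V(G)$, then $$\mathbb{P}(G[S] \text{ is Hamiltonian}) > \tfrac12 - \theta.$$
   Context: All graphs are finite and simple. $G[S]$ denotes the subgraph of $G$ induced by $S$. A graph is Hamiltonian if it has a cycle (with at least 3 vertices) through all its vertices. *)

(* Defs.v *)
From HB Require Import structures.
From mathcomp Require Import all_boot all_order all_algebra.
From mathcomp Require Import boolp reals.

Set Implicit Arguments.
Unset Strict Implicit.
Unset Printing Implicit Defensive.

Import Order.TTheory GRing.Theory Num.Theory.

Record sgraph := SGraph {
  vertex :> finType;
  adj : rel vertex;
  adj_sym : symmetric adj;
  adj_irr : irreflexive adj }.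

Definition neighbours (G : sgraph) (x : G) : {set G} := [set y | adj x y].

Definition regular (d : nat) (G : sgraph) : Prop :=
  forall x : G, #|neighbours x| = d.

Section Induced.
Variables (G : sgraph) (S : {set G}).

Definition induced_adj : rel {x : G | x \in S} :=
  fun x y => adj (val x) (val y).

Lemma induced_sym : symmetric induced_adj.
Proof. by move=> x y; apply: adj_sym. Qed.

Lemma induced_irr : irreflexive induced_adj.
Proof. by move=> x; apply: adj_irr. Qed.

Definition induced : sgraph := SGraph induced_sym induced_irr.

End Induced.

(* [ucycle] requires distinct vertices but allows length at most 2 (for
   instance the empty sequence, or the two ends of an edge), hence the explicit
   bound on the length. *)
Definition hamiltonian (G : sgraph) : Prop :=
  exists c : seq G, [/\ 2 < size c, ucycle (@adj G) c & forall x : G, x \in c].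

Local Open Scope ring_scope.

(* Probability of the event [P] under the uniform distribution on [T]. *)
Definition uniform_pr (R : realType) (T : finType) (P : T -> Prop) : R :=
  #|[set x : T | `[< P x >]]|%:R / #|T|%:R.

(* Main.v *)
Require Import Defs.
From HB Require Import structures.
From mathcomp Require Import all_boot all_order all_algebra.
From mathcomp Require Import boolp reals.
From mathcomp Require Import perm zify ring lra.

Set Implicit Arguments.
Unset Strict Implicit.
Unset Printing Implicit Defensive.

Import Order.TTheory GRing.Theory Num.Theory.

(* Let S be the random set. If an edge-maximal non-Hamiltonian graph misses an edge uv,
   then along a Hamiltonian path from u to v the neighbourhoods of u and v cannot cross;
   this limits their degrees (Bondy-Chvatal closure), also when only edges inside a
   prescribed class may be added.

   Let H be the set of vertices v with deg_S(v) >= |S|/2. Regularity gives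
   |H(S)| + |H(S^c)| >= 2n, so for S or for its complement the set H is large, and then the
   closure of G[S] is complete unless G is close to two disjoint cliques or to K_(n,n).
   This is where 1/2 comes from in the generic case.

   Near two cliques, counting degrees shows that the edges across contain a large matching,
   so that S contains two disjoint edges across, which suffices.

   Near K_(n,n), with sides A and B, |A| = n - k, the set S is Hamiltonian as soon as
   the larger of A, B inside S contains a linear forest whose size is the difference
   k + s of the two sizes, where s is a centred binomial variable with variance n/2.
   The linear forests surviving in S are, asymptotically, as large as a fractional vertex
   cover of G[A], respectively G[B], and summing the degrees relates the two cover numbers:
   the surplus s is allowed to lie in [-I, J] with (I+1)(J+1) >= (1 - o(1)) n. Chebyshev's
   inequality for the longer side and unimodality for the shorter one give probability at
   least 1/2 - o(1). *)

(** * Hamiltonian cycles *)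

(** Near K_(n,n) the constant 1/2 leaves nothing to waste: a constant factor lost in the forests
    would spoil the product inequality. Hence degrees in the flows are capped at [D], a small
    multiple of sqrt n: large enough to concentrate in a random subset, small enough for the arcs
    missed by the minimal cut to number at most a small multiple of n. Arcs chosen with in- and
    out-degree at most one could still close up into cycles; random levels exclude these at an
    arbitrarily small relative loss. In the generic case the obstacle is that H(S) depends on S, so
    that its intersection with S is not binomial; flipping one vertex changes membership in H(S)
    only at marginal degrees, and this makes a second moment argument work. The other quantities
    needed are intersections of S with O(n^2) sets fixed in advance, because closeness to an
    extremal graph is read off from the neighbourhood of a single vertex. *)

Definition nbh (T : finType) (e : rel T) (x : T) : {set T} := [set y | e x y].

(** Stated on the ambient type instead of [induced S], so that the set and the edge relation can
    vary without changing types. *)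
Definition ham (T : finType) (e : rel T) (S : {set T}) : Prop :=
  exists c : seq T, [/\ 2 < size c, cycle e c, uniq c & c =i S].

Lemma hamiltonian_induced (G : sgraph) (S : {set G}) :
  ham (@adj G) S -> hamiltonian (induced S).
Proof.
case=> c [sz_c cyc_c uniq_c cS].
pose c' : seq {x : G | x \in S} := pmap insub c.
have valc' : map val c' = c.
  rewrite (pmap_filter (insubK _)); apply/all_filterP/allP => x.
  by rewrite cS => xS; rewrite isSome_insub.
exists c'; split.
- by rewrite -(size_map val) valc'.
- rewrite /ucycle -(map_inj_uniq val_inj) valc' uniq_c andbT.
  by move: cyc_c; rewrite -{1}valc' cycle_map.
- by move=> x; rewrite -(mem_map val_inj) valc' cS (valP x).
Qed.

Section Ham.
Variable T : finType.
Implicit Types (e K : rel T) (S P Q : {set T}) (u v x y : T) (c p : seq T).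

Definition addp e u v : rel T :=
  fun x y => e x y || ((x == u) && (y == v)) || ((x == v) && (y == u)).

Lemma addp_sym e u v : symmetric e -> symmetric (addp e u v).
Proof.
move=> es x y; rewrite /addp es -!orbA; congr orb.
by rewrite orbC andbC [X in _ || X]andbC.
Qed.

Lemma ham_sub e e' S : (forall x y, x \in S -> y \in S -> e x y -> e' x y) ->
  ham e S -> ham e' S.
Proof.
move=> see' [c [sz cyc un cS]]; exists c; split => //.
apply: (@sub_in_cycle _ (mem S) e e') cyc.
- by move=> x y xS yS; apply: see'.
- by apply/allP => x; rewrite cS.
Qed.

(** Pairs of [K] are added while no Hamiltonian cycle appears, by induction on the number of missing
    ones. Restricting to [K] keeps control of all other pairs. *)
Lemma maximal_nonham e K S : symmetric e -> ~ ham e S ->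
  exists e' : rel T, [/\ symmetric e', subrel e e',
    (forall x y, e' x y -> e x y || K x y || K y x), ~ ham e' S &
    forall u v, K u v -> ~~ e' u v -> ham (addp e' u v) S].
Proof.
have [m] := ubnP #|[set p : T * T | K p.1 p.2 && ~~ e p.1 p.2]|.
elim: m e => // m IHm e lt_m es nh.
have [all_ham|] := pselect (forall u v, K u v -> ~~ e u v -> ham (addp e u v) S).
  by exists e; split => // x y ->.
move=> /existsNP[u /existsNP[v /not_implyP[Kuv /not_implyP[neuv nham]]]].
have [|e' [e's see' e'K nh' e'max]] := IHm (addp e u v) _ (addp_sym u v es) nham.
  apply: leq_trans (_ : _ < _) _; last exact: lt_m.
  apply/proper_card/properP; split.
    by apply/subsetP => -[x y]; rewrite !inE /addp /= => /andP[-> /norP[/norP[->]]].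
  by exists (u, v); rewrite !inE /addp /= ?Kuv ?eqxx ?neuv ?orbT.
exists e'; split => //.
- by move=> x y exy; apply: see'; rewrite /addp exy.
- move=> x y /e'K; rewrite /addp -!orbA => /or4P[->//|/andP[/eqP-> /eqP->]|/andP[/eqP-> /eqP->]|].
  + by rewrite Kuv orbT.
  + by rewrite Kuv !orbT.
  + by move->; rewrite orbT.
Qed.

(** Every Hamiltonian cycle of the enlarged graph uses the new edge; cutting the cycle there leaves
    a path between its ends. *)
Lemma ham_path e S u v : symmetric e -> u != v ->
  ~ ham e S -> ham (addp e u v) S ->
  exists p, [/\ 1 < size p, path e u p, uniq (u :: p), last u p = v & u :: p =i S].
Proof.
move=> es neuv nh [c [sz cyc un cS]].
have [uc|uNc] := boolP (u \in c); last first.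
  case: nh; exists c; split => //.
  apply: (@sub_in_cycle _ (mem c) (addp e u v) e) cyc; last by apply/allP.
  move=> x y xc yc; rewrite /addp -orbA => /or3P[//|/andP[/eqP xu _]|/andP[_ /eqP yu]].
    by move: uNc; rewrite -xu xc.
  by move: uNc; rewrite -yu yc.
(* If the successor of [u] is not [v], the new edge can only be the closing one. The other case
   reduces to this one by reversing the cycle. *)
have key q : cycle (addp e u v) (u :: q) -> uniq (u :: q) -> 1 < size q ->
    u :: q =i S -> head u q != v -> last u q = v /\ path e u q.
  move=> cyc' un' sz' qS hd.
  move: (un') => /= /andP[uq unq].
  have pq : path e u q.
    move: cyc'; rewrite /= rcons_path => /andP[pth _].
    case: q pth uq unq hd sz' {qS un'} => [|h q] //= /andP[uh pth] uq unq hd sz'.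
    apply/andP; split.
      move: uh; rewrite /addp eqxx (negPf hd) (negPf neuv) /=.
      by rewrite !orbF.
    apply: (@sub_in_path _ (predC (pred1 u)) (addp e u v) e) pth.
      move=> x y; rewrite !inE /addp => xu yu.
      by rewrite (negPf xu) (negPf yu) andbF /= !orbF.
    by apply/allP => z zq; rewrite inE; apply: contraNneq uq => <-.
  split => //; apply/eqP; apply: contra_notT nh => lastv.
  exists (u :: q); split => //=.
  rewrite rcons_path pq /=.
  move: cyc'; rewrite /= rcons_path => /andP[_].
  by rewrite /addp (negPf lastv) (negPf neuv) andbF !orbF.
case/rot_to: uc => i q rot_c.
have cyc' : cycle (addp e u v) (u :: q) by rewrite -rot_c rot_cycle.
have un' : uniq (u :: q) by rewrite -rot_c rot_uniq.
have qS : u :: q =i S by move=> x; rewrite -rot_c mem_rot cS.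
have sz' : 1 < size q by rewrite -ltnS -[(size q).+1]/(size (u :: q)) -rot_c size_rot.
have [hdv|hdv] := eqVneq (head u q) v; last first.
  by have [? ?] := key q cyc' un' sz' qS hdv; exists q; split.
pose q' := rev q.
have un2 : uniq (u :: q').
  by rewrite /= mem_rev rev_uniq.
have qS2 : u :: q' =i S by move=> x; rewrite -qS !inE mem_rev.
have cyc2 : cycle (addp e u v) (u :: q').
  have: cycle (addp e u v) (rev (u :: q)).
    rewrite rev_cycle; move: cyc'; rewrite (eq_cycle (e' := fun x y => addp e u v y x)) //.
    by move=> x y; apply: addp_sym.
  by rewrite rev_cons -rot1_cons rot_cycle.
have hd2 : head u q' != v.
  have -> : head u q' = last u q.
    by rewrite /q'; elim/last_ind: (q) => // s y _; rewrite rev_rcons last_rcons.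
  case: (q) un' sz' hdv => [|h [|h' r]] //= /and3P[_ hr _] _ <-.
  by apply: contraNneq hr => <-; rewrite mem_last.
by have [? ?] := key q' cyc2 un2 (etrans (congr1 (ltn 1) (size_rev q)) sz') qS2 hd2; exists q'; split => //; rewrite size_rev.
Qed.
End Ham.

(** * Rotations of a Hamiltonian path *)

Section Crossing.
Variable T : finType.
Implicit Types (e K : rel T) (S P Q : {set T}) (u v x y : T) (c p : seq T).

(** The cycle follows the path from [u] to [last u a], jumps to the end of the path, returns along
    it to [y] and closes at [u]. *)
Lemma crossing e S u a y s : symmetric e -> 1 < size (a ++ y :: s) ->
  path e u (a ++ y :: s) -> uniq (u :: a ++ y :: s) -> u :: a ++ y :: s =i S ->
  e u y -> e (last u a) (last y s) -> ham e S.
Proof.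
move=> es sz pth un inS uy xv; exists (u :: a ++ rev (y :: s)); split.
- by move: sz; rewrite /= !size_cat size_rev.
- move: pth; rewrite cat_path /= => /and3P[pa _ pys].
  rewrite rcons_cat cat_path pa /= lastI rev_rcons /= xv /= rcons_path.
  rewrite rev_path (eq_path (e' := e)) ?pys; last by move=> ? ?; apply: es.
  rewrite -[last (last y s) _]/(last u (last y s :: rev (belast y s))).
  by rewrite -rev_rcons -lastI rev_cons last_rcons es.
- by have := un; rewrite -!cat_cons !cat_uniq has_rev rev_uniq.
- by move=> w; rewrite -inS -!cat_cons !mem_cat mem_rev.
Qed.

Lemma mem_zip_belast u p x y : (x, y) \in zip (belast u p) p ->
  exists a s, p = a ++ y :: s /\ last u a = x.
Proof.
elim: p u => //= z p IH u; rewrite inE => /orP[/eqP[-> ->]|/IH[a [s [-> <-]]]].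
  by exists [::], p.
by exists (z :: a), s.
Qed.

Lemma count_uniq_card (a : pred T) (s : seq T) :
  uniq s -> count a s = #|[set x in s | a x]|.
Proof.
move=> us; rewrite -size_filter -(card_uniqP (filter_uniq a us)).
by apply: eq_card => x; rewrite mem_filter !inE andbC.
Qed.

(* Along a Hamiltonian path from [u] to [v], no edge [xy] may have [x ~ v] and
   [u ~ y]: each edge is thus charged at most once by the two neighbourhoods. *)
Lemma cross_count e S u v P Q : symmetric e -> irreflexive e -> u != v ->
  ~ ham e S -> ham (addp e u v) S -> P \subset S -> Q \subset S ->
  #|nbh e v :&: P| + #|nbh e u :&: Q| <=
    #|P :\ v| + #|[set y in Q | [exists x in S :\: P, e x y]]|.
Proof.
move=> es ei uv nh h PS QS.
have [p [sz pth un lastp pS]] := ham_path es uv nh h.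
pose z := zip (belast u p) p.
have z1 : map fst z = belast u p by apply: unzip1_zip; rewrite size_belast.
have z2 : map snd z = p by apply: unzip2_zip; rewrite size_belast.
have zP x y : (x, y) \in z -> e x y /\ ~~ (e v x && e u y).
  move=> /mem_zip_belast[a [s [pE ax]]]; move: pth sz un lastp pS; rewrite pE.
  move=> pth sz un lastp pS; split.
    by move: pth; rewrite cat_path /= ax => /and3P[].
  apply/negP => /andP[vx uy]; apply: nh.
  apply: (crossing es sz pth un pS uy).
  by move: lastp; rewrite last_cat /= ax => ->; rewrite es.
have unb : uniq (rcons (belast u p) v) by rewrite -lastp -lastI.
have ub : uniq (belast u p) by move: unb; rewrite rcons_uniq => /andP[].
have up : uniq p by case/andP: un.
have inb x : (x \in belast u p) = (x \in S) && (x != v).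
  move: unb; rewrite rcons_uniq => /andP[vb _].
  rewrite -pS lastI mem_rcons lastp inE.
  by have [->|] := eqVneq x v; rewrite ?(negPf vb) ?andbT.
have inp x : (x \in p) = (x \in S) && (x != u).
  rewrite -pS inE; have [->|] := eqVneq x u; rewrite ?andbT //.
  by case/andP: un => /negPf->.
pose a1 (q : T * T) := (q.1 \in P) && e v q.1.
pose a2 (q : T * T) := (q.2 \in Q) && e u q.2.
pose b1 (q : T * T) := q.1 \in P.
pose W := [set y in Q | [exists x in S :\: P, e x y]].
pose b2 (q : T * T) := q.2 \in W.
have -> : #|nbh e v :&: P| = count a1 z.
  rewrite -[count a1 z](count_map fst (fun x => (x \in P) && e v x)) z1 count_uniq_card //.
  apply: eq_card => x; rewrite !inE inb; have [->|] := eqVneq x v; rewrite ?ei ?andbF ?andbT //=.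
  by case: (boolP (x \in P)) => [/(subsetP PS)->|]; rewrite ?andbT ?andbF.
have -> : #|nbh e u :&: Q| = count a2 z.
  rewrite -[count a2 z](count_map snd (fun x => (x \in Q) && e u x)) z2 count_uniq_card //.
  apply: eq_card => x; rewrite !inE inp; have [->|] := eqVneq x u; rewrite ?ei ?andbF ?andbT //=.
  by case: (boolP (x \in Q)) => [/(subsetP QS)->|]; rewrite ?andbT ?andbF.
have -> : #|P :\ v| = count b1 z.
  rewrite -[count b1 z](count_map fst (fun x => (x \in P))) z1 count_uniq_card //.
  apply: eq_card => x; rewrite !inE inb.
  by case: (boolP (x \in P)) => [/(subsetP PS)->|]; rewrite ?andbT ?andbF.
apply: leq_trans (_ : count b1 z + count b2 z <= _); last first.
  rewrite leq_add2l -[count b2 z](count_map snd (fun x => (x \in W))) z2 count_uniq_card //.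
  by apply/subset_leq_card/subsetP => x; rewrite inE => /andP[].
rewrite -count_predUI [X in _ + X](_ : _ = 0) ?addn0; last first.
  apply/eqP; rewrite -leqn0 leqNgt -has_count; apply/hasPn => -[x y] /zP[_].
  by rewrite /= /a1 /a2 /=; apply: contra => /andP[/andP[_ ->] /andP[_ ->]].
(* A counted edge [xy] with [x] outside [P] is charged to [y], which lies in [Q] and has the
   neighbour [x] in [S :\: P]. *)
rewrite -[X in X <= _]addn0 -(count_predUI b1 b2) leq_add //.
have -> : count (predU a1 a2) z = count (predI (predU a1 a2) (predU b1 b2)) z.
  apply: eq_in_count => -[x y] xyz /=.
  have [exy _] := zP _ _ xyz.
  rewrite /a1 /a2 /b1 /b2 /W /= !inE.
  have xS : x \in S.
    by have := map_f fst xyz; rewrite z1 inb => /andP[].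
  have [xP|xP] := boolP (x \in P); first by rewrite /= ?andbT.
  rewrite /=; have [yQ|] := boolP (y \in Q) => //=.
  have -> : [exists x0 in S :\: P, e x0 y] by apply/existsP; exists x; rewrite !inE xP xS.
  by rewrite andbT.
by apply: sub_count => q /andP[].
Qed.

End Crossing.

(** * Explicit cycles in the two extremal configurations *)

Section Constructions.
Variable T : finType.
Implicit Types (e K : rel T) (A B S P Q : {set T}) (u v x y : T) (c : seq T).

Lemma path_clique e x (p : seq T) : uniq (x :: p) ->
  {in x :: p &, forall y z, y != z -> e y z} -> path e x p.
Proof.
elim: p x => //= y p IH x /andP[xp up] h; apply/andP; split.
  by apply: h; rewrite ?inE ?eqxx ?orbT //; apply: contraNneq xp => ->; rewrite inE eqxx.
by apply: IH => // z t zp tp; apply: h; rewrite inE ?zp ?tp orbT.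
Qed.

Lemma ham_complete e S : 2 < #|S| ->
  {in S &, forall x y, x != y -> e x y} -> ham e S.
Proof.
rewrite cardE => sz h; exists (enum S); split => //.
- have: {in enum S &, forall y z, y != z -> e y z}.
    by move=> y z; rewrite !mem_enum; apply: h.
  case: (enum S) sz (enum_uniq S) => //= x s sz /andP[xs us] h'.
  rewrite rcons_path path_clique /= ?xs //.
  by apply: h'; rewrite ?mem_last ?mem_head //; case: (s) sz xs => //= y s' _ xs; apply: contraNneq xs => <-; rewrite mem_last.
- exact: enum_uniq.
- by move=> x; rewrite mem_enum.
Qed.

(** Traverse [A] from [a1] to [a2], cross to [b2], traverse [B] to [b1], and cross back. *)
Lemma ham_two_cliques e A B a1 a2 b1 b2 : [disjoint A & B] ->
  a1 \in A -> a2 \in A -> b1 \in B -> b2 \in B -> a1 != a2 -> b1 != b2 ->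
  {in A &, forall x y, x != y -> e x y} -> {in B &, forall x y, x != y -> e x y} ->
  e a2 b2 -> e b1 a1 -> ham e (A :|: B).
Proof.
move=> dAB a1A a2A b1B b2B na nb cA cB e2 e1.
pose pA := rcons (enum (A :\: [set a1; a2])) a2.
pose pB := rcons (enum (B :\: [set b1; b2])) b1.
have seg (X : {set T}) (x y : T) : x \in X -> y \in X -> x != y ->
    {in X &, forall x y, x != y -> e x y} ->
    [/\ path e x (rcons (enum (X :\: [set x; y])) y),
      uniq (x :: rcons (enum (X :\: [set x; y])) y) &
      x :: rcons (enum (X :\: [set x; y])) y =i X].
  move=> xX yX nxy cX.
  have mem : x :: rcons (enum (X :\: [set x; y])) y =i X.
    move=> z; rewrite !inE mem_rcons inE mem_enum !inE.
    have [->|] := eqVneq z x; first by rewrite xX.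
    by have [->|] := eqVneq z y; first by rewrite yX orbT.
  have un : uniq (x :: rcons (enum (X :\: [set x; y])) y).
    rewrite /= mem_rcons rcons_uniq enum_uniq !inE !mem_enum !inE !eqxx /= ?orbT /= ?andbT.
    by rewrite (negPf nxy).
  by split => //; apply: path_clique => // z t; rewrite !mem => zX tX; apply: cX.
have [pthA uA mA] := seg A a1 a2 a1A a2A na cA.
have [pthB uB mB] : [/\ path e b2 pB, uniq (b2 :: pB) & b2 :: pB =i B].
  by rewrite /pB setUC; apply: seg => //; rewrite eq_sym.
exists ((a1 :: pA) ++ b2 :: pB); split.
- by rewrite size_cat /= !size_rcons !addnS !addSn.
- rewrite /= rcons_cat /= cat_path pthA /= rcons_path pthB.
  by rewrite !last_rcons e2 e1.
- rewrite cat_uniq uA uB andbT; apply/hasPn => z; rewrite mB => zB.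
  suff : z \notin a1 :: pA by [].
  by rewrite mA (disjointFl dAB zB).
- by move=> z; rewrite mem_cat mA mB inE.
Qed.

(** A linear forest, oriented: in- and out-degrees are at most one, and the labels [l] increasing
    along arcs exclude directed cycles. *)
Definition forest (M : {set T * T}) : Prop :=
  exists l : T -> nat, [/\ {in M, forall p, l p.1 < l p.2},
    {in M &, injective fst} & {in M &, injective snd}].

Lemma forest_sub (M N : {set T * T}) : N \subset M -> forest M -> forest N.
Proof.
move=> /subsetP NM [l [h1 h2 h3]]; exists l; split.
- by move=> p /NM; apply: h1.
- by move=> p q /NM pM /NM qM; apply: h2.
- by move=> p q /NM pM /NM qM; apply: h3.
Qed.

Definition alternating A B (M : {set T * T}) : rel T :=
  fun x y => [|| (x \in A) && (y \in B), (x \in B) && (y \in A) | (x, y) \in M].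

(** Induction inserting one vertex of each side after a vertex of [A]. The base is a two-vertex
    cycle, which [cycle] accepts; length is dealt with in [ham_bipartite]. *)
Lemma alternating_cycle0 A B : [disjoint A & B] -> 0 < #|A| -> #|B| = #|A| ->
  exists c, [/\ cycle (alternating A B set0) c, uniq c & c =i A :|: B].
Proof.
have [m] := ubnP #|A|; elim: m A B => // m IH A B lt_m dAB A0 AB.
have [a aA] := card_gt0P A0.
have [b bB] : exists b, b \in B by apply/card_gt0P; rewrite AB.
have nab : a != b by apply: contraTneq aA => ->; rewrite (disjointFl dAB bB).
have [A1|A1] := posnP #|A :\ a|.
  have eA : A = [set a].
    by apply/eqP; rewrite eq_sym eqEcard sub1set aA cards1 (cardsD1 a) aA A1.
  have eB : B = [set b].
    apply/eqP; rewrite eq_sym eqEcard sub1set bB cards1.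
    by rewrite AB (cardsD1 a) aA A1.
  exists [:: a; b]; split; rewrite /= ?inE ?nab //.
    by rewrite /alternating aA bB !orbT.
  by move=> x; rewrite !inE eA eB !inE.
have [||||c [cyc un mem]] := IH (A :\ a) (B :\ b).
- by move: lt_m; rewrite (cardsD1 a) aA; lia.
- by apply: disjointWl (disjointWr _ dAB); rewrite ?subD1set.
- by [].
- by move: AB; rewrite (cardsD1 a A) (cardsD1 b B) aA bB; lia.
have [x xA] := card_gt0P A1.
have /rot_to[i c' rc] : x \in c by rewrite mem inE xA.
have cyc' : cycle (alternating (A :\ a) (B :\ b) set0) (x :: c') by rewrite -rc rot_cycle.
have un' : uniq (x :: c') by rewrite -rc rot_uniq.
have mem' : x :: c' =i (A :\ a) :|: (B :\ b) by move=> z; rewrite -rc mem_rot mem.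
have sub : subrel (alternating (A :\ a) (B :\ b) set0) (alternating A B set0).
  move=> y z; rewrite /alternating !inE orbF => /orP[/andP[/andP[_ ->] /andP[_ ->]]//|].
  by move=> /andP[/andP[_ ->] /andP[_ ->]]; rewrite orbT.
have xB : x \in B = false by apply: (disjointFr dAB); case/setD1P: xA.
exists (x :: b :: a :: c'); split.
- have xA' : x \in A by case/setD1P: xA.
  have hd : forall w s, path (alternating (A :\ a) (B :\ b) set0) x (w :: s) ->
     path (alternating A B set0) a (w :: s).
    move=> w s /= /andP[xw pws]; rewrite (sub_path sub) // andbT.
    move: xw; rewrite /alternating !inE xB xA' aA !andbF /= ?orbF => /andP[_].
    by move=> /andP[_ ->].
  rewrite /= {1}/alternating xA' bB /= {1}/alternating bB aA /= orbT /=.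
  by move: cyc' => /=; case: (c') => [|w s]; [apply: (hd x [::])|apply: (hd w (rcons s x))].
- have : (a \notin x :: c') && (b \notin x :: c').
    by rewrite !mem' !inE !eqxx aA bB /= (disjointFr dAB aA) (disjointFl dAB bB) !andbF.
  rewrite !inE !negb_or => /andP[/andP[ax ac] /andP[bx bc]].
  move: un'; rewrite /= !inE !negb_or (eq_sym x) bx (eq_sym x) ax (eq_sym b) nab ac bc.
  by move=> /andP[-> ->].
- move=> z; move: (mem' z); rewrite !inE.
  have [->|] := eqVneq z a; first by rewrite aA ?orbT.
  have [->|] := eqVneq z b; first by rewrite bB ?orbT.
  by [].
Qed.

(** Contract an arc [vw] of the forest: a cycle avoiding [w] is extended by inserting [w] right
    after [v]. *)
Lemma alternating_cycle A B (M : {set T * T}) : [disjoint A & B] -> 0 < #|A| ->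
  forest M -> M \subset setX B B -> #|B| = #|A| + #|M| ->
  exists c, [/\ cycle (alternating A B M) c, uniq c & c =i A :|: B].
Proof.
have [m] := ubnP #|M|; elim: m M B => // m IH M B lt_m dAB A0 fM MB AB.
have [M0|M0] := posnP #|M|.
  move/eqP: (M0); rewrite cards_eq0 => /eqP eM; rewrite eM.
  by apply: alternating_cycle0 => //; rewrite AB M0 addn0.
have [l [lM inj1 inj2]] := fM.
have [p0 p0M] := card_gt0P M0.
(* A maximal label makes [w] the end of its path, so that no other arc of [M] meets [w]. *)
case: (arg_maxnP (fun p : T * T => l p.2) p0M) => -[v w] /= vwM0 wmax.
have {vwM0} vwM : (v, w) \in M := vwM0.
have /setXP[vB wB] := subsetP MB _ vwM.
have nvw : v != w by have := lM _ vwM; rewrite /=; apply: contraTneq => ->; rewrite ltnn.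
have wout y : (w, y) \notin M.
  by apply/negP => wy; have /= h1 := wmax _ wy; have /= h2 := lM _ wy; rewrite leqNgt h2 in h1.
have win x : (x, w) \in M -> x = v by move=> xw; case: (inj2 _ _ xw vwM erefl).
have vout y : (v, y) \in M -> y = w by move=> vy; case: (inj1 _ _ vy vwM erefl).
pose M' := M :\ (v, w).
have M'M : M' \subset M by apply: subD1set.
have cM : #|M| = #|M'|.+1 by rewrite (cardsD1 (v, w)) vwM.
have [||||||c [cyc un mem]] := IH M' (B :\ w).
- by move: lt_m; rewrite cM.
- by apply: disjointWr dAB; rewrite subD1set.
- by [].
- exact: forest_sub M'M fM.
- apply/subsetP => -[x y] /setD1P[ne xyM].
  have /setXP[xB yB] := subsetP MB _ xyM.
  rewrite !inE xB yB !andbT /=; apply/andP; split.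
    by apply: contraTneq xyM => ->.
  by apply: contraNneq ne => yw; move: xyM; rewrite yw => /win->.
- by apply: succn_inj; rewrite -addnS -cM -AB (cardsD1 w B) wB.
have /rot_to[i c' rc] : v \in c by rewrite mem !inE nvw vB orbT.
have cyc' : cycle (alternating A (B :\ w) M') (v :: c') by rewrite -rc rot_cycle.
have un' : uniq (v :: c') by rewrite -rc rot_uniq.
have mem' : v :: c' =i A :|: (B :\ w) by move=> z; rewrite -rc mem_rot mem.
have sub : subrel (alternating A (B :\ w) M') (alternating A B M).
  move=> y z; rewrite /alternating !inE => /or3P[/and3P[-> _ ->]//|/andP[/andP[_ ->] ->]|/andP[_ ->]].
    by rewrite orbT.
  by rewrite !orbT.
have vA : v \in A = false by apply: (disjointFl dAB).
exists (v :: w :: c'); split.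
(* Once [vw] is removed no arc leaves [v]; its successor lies in [A] and may equally well follow
   [w]. *)
- have hd : forall t s, path (alternating A (B :\ w) M') v (t :: s) ->
     path (alternating A B M) w (t :: s).
    move=> t s /= /andP[vt pws]; rewrite (sub_path sub) // andbT.
    move: vt; rewrite /alternating !inE vA wB /= => /orP[/andP[_ ->]|]; first by rewrite orbT.
    by move=> /andP[ne /vout tw]; rewrite tw eqxx in ne.
  rewrite /= {1}/alternating vwM !orbT /=.
  by move: cyc' => /=; case: (c') => [|t s]; [apply: (hd v [::])|apply: (hd t (rcons s v))].
- have : w \notin v :: c' by rewrite mem' !inE eqxx /= (disjointFl dAB wB).
  rewrite /= !inE !negb_or => /andP[_ ->].
  by move: un'; rewrite /= nvw => /andP[-> ->].
- move=> z; move: (mem' z); rewrite !inE.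
  have [->|] := eqVneq z w; first by rewrite wB ?orbT.
  by [].
Qed.

Lemma ham_bipartite e A B (M : {set T * T}) : symmetric e ->
  [disjoint A & B] -> 1 < #|A| ->
  forest M -> M \subset setX B B -> #|B| = #|A| + #|M| ->
  {in A & B, forall x y, e x y} -> {in M, forall p, e p.1 p.2} -> ham e (A :|: B).
Proof.
move=> es dAB A1 fM MB AB eAB eM.
have [c [cyc un mem]] := alternating_cycle dAB (ltnW A1) fM MB AB.
exists c; split => //.
- rewrite -(card_uniqP un) (eq_card mem) cardsU (_ : A :&: B = set0) ?cards0; first lia.
  by apply/eqP; rewrite setI_eq0.
- apply: sub_cycle cyc => x y; rewrite /alternating => /or3P[/andP[]|/andP[xB yA]|/eM//].
    exact: eAB.
  by rewrite es eAB.
Qed.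

End Constructions.

(** * Bipartite flows *)

Section Flow.
Variable T : finType.
Implicit Types (E F : {set T * T}) (P Q : {set T}).

Definition outdeg E (u : T) := #|[set p in E | p.1 == u]|.
Definition indeg E (v : T) := #|[set p in E | p.2 == v]|.
Definition uncovered E P Q := [set p in E | (p.1 \notin P) && (p.2 \notin Q)].

(** Capacity of a cut in the network with edges from the source to [u] (capacity [b u]), arcs of [E]
    (capacity 1), and edges from [v] to the sink (capacity [b' v]). Tails and heads live in separate
    copies of [T]. *)
Definition cut (b b' : T -> nat) E P Q :=
  \sum_(u in P) b u + \sum_(v in Q) b' v + #|uncovered E P Q|.

Lemma uncovered_sum E P Q :
  #|uncovered E P Q| = \sum_(p in E) ((p.1 \notin P) && (p.2 \notin Q)).
Proof.
rewrite -sum1_card (eq_bigl (fun p => (p \in E) && ((p.1 \notin P) && (p.2 \notin Q)))).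
  by rewrite -big_mkcondr; apply: eq_bigr => p; case: (_ && _).
by move=> p; rewrite inE.
Qed.

(** The vertex terms are modular. The arc [a] is missed by the first cut but by neither of the
    uncrossed ones, whence strictness. *)
Lemma cut_submodular b b' E P1 Q1 P2 Q2 (a : T * T) : a \in E ->
  a.1 \notin P1 -> a.2 \notin Q1 -> a.1 \in P2 -> a.2 \in Q2 ->
  cut b b' E (P1 :&: P2) (Q1 :|: Q2) + cut b b' E (P1 :|: P2) (Q1 :&: Q2) <
  cut b b' E P1 Q1 + cut b b' E P2 Q2.
Proof.
move=> aE a1 a2 a3 a4.
have modular (g : T -> nat) (X Y : {set T}) :
    \sum_(i in X :&: Y) g i + \sum_(i in X :|: Y) g i = \sum_(i in X) g i + \sum_(i in Y) g i.
  rewrite !(big_mkcond (fun i => i \in _)) -!big_split /=.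
  by apply: eq_bigr => i _; rewrite !inE; case: (i \in X); case: (i \in Y); rewrite /=; lia.
have unc : #|uncovered E (P1 :&: P2) (Q1 :|: Q2)| + #|uncovered E (P1 :|: P2) (Q1 :&: Q2)|
    < #|uncovered E P1 Q1| + #|uncovered E P2 Q2|.
  rewrite !uncovered_sum -!big_split /= !(big_setD1 a aE) /=.
  rewrite -addSn leq_add //; first by rewrite !inE (negPf a1) (negPf a2) a3 a4.
  apply: leq_sum => p _; rewrite !inE.
  by case: (p.1 \in P1); case: (p.1 \in P2); case: (p.2 \in Q1); case: (p.2 \in Q2).
by have := modular b P1 P2; have := modular b' Q1 Q2; rewrite /cut; lia.
Qed.

(* Max-flow min-cut for bipartite degree-constrained subgraphs, by induction on
   the number of arcs: if an arc can be neither dropped nor used, uncrossing the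
   two tight cuts gives a contradiction. *)
Lemma flow_of_cut (b b' : T -> nat) E t :
  (forall P Q, t <= cut b b' E P Q) ->
  exists F, [/\ F \subset E, forall u, outdeg F u <= b u,
    forall v, indeg F v <= b' v & t <= #|F|].
Proof.
have [m] := ubnP #|E|; elim: m E b b' t => // m IH E b b' t lt_m tcut.
have [E0|/set0Pn[a aE]] := eqVneq E set0.
  exists set0; split; rewrite ?sub0set ?cards0 //.
  - by move=> u; rewrite /outdeg (_ : [set _ in _ | _] = set0) ?cards0 //; apply/setP => p; rewrite !inE.
  - by move=> u; rewrite /indeg (_ : [set _ in _ | _] = set0) ?cards0 //; apply/setP => p; rewrite !inE.
  - have := tcut set0 set0; rewrite /cut !big_set0 /uncovered E0.
    by rewrite (_ : [set _ in _ | _] = set0) ?cards0 //; apply/setP => p; rewrite !inE.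
have cardE' : #|E| = (#|E :\ a|).+1 by rewrite (cardsD1 a) aE.
have lt' : #|E :\ a| < m by lia.
have [all_t|] := pselect (forall P Q, t <= cut b b' (E :\ a) P Q).
  have [F [FE h1 h2 h3]] := IH _ b b' t lt' all_t.
  by exists F; split => //; apply: subset_trans FE (subD1set _ _).
move=> /existsNP[P1 /existsNP[Q1 /negP]]; rewrite -ltnNge => cut1.
have cutE c c' P Q : cut c c' E P Q =
    cut c c' (E :\ a) P Q + ((a.1 \notin P) && (a.2 \notin Q)).
  by rewrite /cut !uncovered_sum (big_setD1 a aE) /=; lia.
have a1 : a.1 \notin P1.
  by have := tcut P1 Q1; rewrite cutE; case: (_ \notin P1) => //=; lia.
have a2 : a.2 \notin Q1.
  by have := tcut P1 Q1; rewrite cutE; case: (_ \notin Q1) => //=; rewrite ?andbF; lia.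
have c1 : cut b b' E P1 Q1 = t.
  by have := tcut P1 Q1; rewrite cutE a1 a2; lia.
(* Without capacity at [a.1], adding it to [P1] would cover [a] for free and give a cut of [E] below
   [t]. *)
have b1 : 0 < b a.1.
  rewrite lt0n; apply/eqP => b0; have := tcut (a.1 |: P1) Q1.
  rewrite cutE setU11 /= addn0 /cut big_setU1 //= b0 add0n.
  move: cut1; rewrite /cut => lt1 ge1.
  have : #|uncovered (E :\ a) (a.1 |: P1) Q1| <= #|uncovered (E :\ a) P1 Q1|.
    apply/subset_leq_card/subsetP => p; rewrite !inE negb_or.
    by move=> /andP[-> /andP[/andP[_ ->] ->]].
  by move=> h; move: (leq_ltn_trans (leq_trans ge1 (leq_add (leqnn _) h)) lt1); rewrite ltnn.
have b2 : 0 < b' a.2.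
  rewrite lt0n; apply/eqP => b0; have := tcut P1 (a.2 |: Q1).
  rewrite cutE setU11 andbF /= addn0 /cut [X in _ + X + _]big_setU1 //= b0 add0n.
  move: cut1; rewrite /cut => lt1 ge1.
  have : #|uncovered (E :\ a) P1 (a.2 |: Q1)| <= #|uncovered (E :\ a) P1 Q1|.
    apply/subset_leq_card/subsetP => p; rewrite !inE negb_or.
    by move=> /andP[-> /andP[-> /andP[_ ->]]].
  by move=> h; move: (leq_ltn_trans (leq_trans ge1 (leq_add (leqnn _) h)) lt1); rewrite ltnn.
(* Residual capacities once [a] is used; the other arcs then only have to carry [t.-1]. *)
pose c u := b u - (u == a.1); pose c' v := b' v - (v == a.2).
have sumc (g : T -> nat) (x : T) (X : {set T}) : 0 < g x ->
    \sum_(i in X) g i = \sum_(i in X) (g i - (i == x)) + (x \in X).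
  move=> g0; have [xX|xX] := boolP (x \in X); last first.
    rewrite addn0; apply: eq_bigr => i iX.
    by have [ix|] := eqVneq i x; rewrite ?subn0 //; rewrite -ix iX in xX.
  rewrite !(big_setD1 x xX) /= eqxx.
  rewrite [in RHS](eq_bigr g); first lia.
  by move=> i /setD1P[/negPf->]; rewrite subn0.
have [all_t|] := pselect (forall P Q, t.-1 <= cut c c' (E :\ a) P Q).
  have [F [FE h1 h2 h3]] := IH _ c c' t.-1 lt' all_t.
  have aF : a \notin F by apply/negP => /(subsetP FE); rewrite !inE eqxx.
  exists (a |: F); split.
  - by rewrite subUset sub1set aE (subset_trans FE) ?subD1set.
  - move=> u; have := h1 u; rewrite /outdeg /c; have [->|ua] := eqVneq u a.1.
      suff -> : [set p in a |: F | p.1 == a.1] = a |: [set p in F | p.1 == a.1].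
        by rewrite cardsU1 !inE (negPf aF) /=; lia.
      by apply/setP => p; rewrite !inE; have [->|] := eqVneq p a; rewrite ?eqxx.
    rewrite subn0; suff -> : [set p in a |: F | p.1 == u] = [set p in F | p.1 == u] by [].
    apply/setP => p; rewrite !inE; have [->|] := eqVneq p a; rewrite ?eqxx //.
    by rewrite eq_sym (negPf ua) !andbF.
  - move=> u; have := h2 u; rewrite /indeg /c'; have [->|ua] := eqVneq u a.2.
      suff -> : [set p in a |: F | p.2 == a.2] = a |: [set p in F | p.2 == a.2].
        by rewrite cardsU1 !inE (negPf aF) /=; lia.
      by apply/setP => p; rewrite !inE; have [->|] := eqVneq p a; rewrite ?eqxx.
    rewrite subn0; suff -> : [set p in a |: F | p.2 == u] = [set p in F | p.2 == u] by [].
    apply/setP => p; rewrite !inE; have [->|] := eqVneq p a; rewrite ?eqxx //.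
    by rewrite eq_sym (negPf ua) !andbF.
  - by rewrite cardsU1 aF; lia.
move=> /existsNP[P2 /existsNP[Q2 /negP]]; rewrite -ltnNge => cut2.
have g2 := tcut P2 Q2.
have e2 : cut b b' E P2 Q2 = cut c c' (E :\ a) P2 Q2 + (a.1 \in P2) + (a.2 \in Q2)
    + ((a.1 \notin P2) && (a.2 \notin Q2)).
  by rewrite cutE /cut (sumc b a.1 P2 b1) (sumc b' a.2 Q2 b2) /c /c'; lia.
(* The residual problem loses at least two on this cut, which is only possible if it contains both
   ends of [a]. *)
have /andP[a3 a4] : (a.1 \in P2) && (a.2 \in Q2).
  by move: g2; rewrite e2; case: (a.1 \in P2); case: (a.2 \in Q2) => //=; lia.
have := cut_submodular b b' aE a1 a2 a3 a4.
have := tcut (P1 :&: P2) (Q1 :|: Q2); have := tcut (P1 :|: P2) (Q1 :&: Q2).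
by move: g2; rewrite c1 e2 a3 a4 /=; lia.
Qed.

(** For [d = 1] this is a form of Koenig's theorem. For symmetric [E] and large [d], the mean of the
    indicators of [P] and [Q] is a fractional vertex cover up to the uncovered arcs. *)
Lemma max_flow_min_cut (d : nat) E : exists F P Q,
  [/\ F \subset E, forall u, outdeg F u <= d, forall v, indeg F v <= d &
    d * (#|P| + #|Q|) + #|uncovered E P Q| <= #|F|].
Proof.
pose f (X : {set T} * {set T}) := cut (fun=> d) (fun=> d) E X.1 X.2.
case: (arg_minnP f (P := predT) (i0 := (set0, set0)) isT) => -[P Q] _ min.
have [|F [FE h1 h2 h3]] := @flow_of_cut (fun=> d) (fun=> d) E (f (P, Q)).
  by move=> P' Q'; apply: (min (P', Q')).
exists F, P, Q; split => //; move: h3; rewrite /f /cut /= !sum_nat_const.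
by rewrite mulnDr ![_ * d]mulnC.
Qed.
End Flow.

(** * Double counting and near-extremal Hamiltonicity *)

Section DoubleCount.
Variable T : finType.
Implicit Types (e : rel T) (A B S X : {set T}).

Lemma nbh_sum e A B x : #|nbh e x :&: B| = \sum_(y in B) e x y.
Proof.
rewrite -sum1_card big_mkcond [RHS]big_mkcond /=; apply: eq_bigr => y _.
by rewrite !inE; case: (e x y); case: (y \in B).
Qed.

Lemma double_count e A B : symmetric e ->
  \sum_(x in A) #|nbh e x :&: B| = \sum_(y in B) #|nbh e y :&: A|.
Proof.
move=> es; under eq_bigr do rewrite (nbh_sum _ A).
under [RHS]eq_bigr do rewrite (nbh_sum _ B).
by rewrite exchange_big /=; apply: eq_bigr => y _; apply: eq_bigr => x _; rewrite es.
Qed.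

(** Closure with all pairs allowed: [P = Q = S] in [cross_count] makes the correction term vanish
    and leaves Ore's condition. *)
Lemma nonham_pair e S : symmetric e -> irreflexive e -> 2 < #|S| -> ~ ham e S ->
  exists e' : rel T, [/\ symmetric e', irreflexive e', subrel e e',
    {in S &, forall u v, u != v -> ~~ e' u v ->
      #|nbh e' v :&: S| + #|nbh e' u :&: S| < #|S|} &
    exists u v, [/\ u \in S, v \in S, u != v & ~~ e' u v]].
Proof.
move=> es ei S2 nh.
have [e' [e's see' e'K nh' mx]] := maximal_nonham (fun x y => x != y) es nh.
have e'i : irreflexive e'.
  by move=> x; apply/negP => /e'K; rewrite ei eqxx.
exists e'; split => //.
  move=> u v uS vS uv nuv.
  have := cross_count e's e'i uv nh' (mx u v uv nuv) (subxx S) (subxx S).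
  rewrite (_ : [set y in S | _] = set0) ?cards0 ?addn0; last first.
    apply/setP => y; rewrite !inE; apply/negP => /andP[_ /existsP[x]].
    by rewrite setDv inE.
  by move/leq_ltn_trans; apply; rewrite [X in _ < X](cardsD1 v) vS.
have [all|] := pselect ({in S &, forall u v, u != v -> e' u v}).
  by case: nh'; apply: ham_complete.
move=> no; apply: contrapT => nex; apply: no => u v uS vS uv; apply: contraT => nuv.
by case: nex; exists u, v.
Qed.

End DoubleCount.

(** * Measure-preserving involutions on subsets *)

Section SymDiff.
Variable T : finType.
Implicit Types (X S A : {set T}) (u v x : T).

Definition symdiff X S := (S :\: X) :|: (X :\: S).

Lemma in_symdiff X S x : (x \in symdiff X S) = (x \in S) (+) (x \in X).
Proof. by rewrite !inE; case: (x \in S); case: (x \in X). Qed.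

Lemma symdiffK X : involutive (symdiff X).
Proof. by move=> S; apply/setP => x; rewrite !in_symdiff -addbA addbb addbF. Qed.

(** Turns the difference between the parts of [S] outside and inside [X] into the size of
    [symdiff X S] up to a constant; the latter set is again uniform when [S] is. *)
Lemma card_symdiff X S : #|symdiff X S| + #|S :&: X| = #|S :\: X| + #|X|.
Proof.
rewrite cardsU (_ : _ :&: _ = set0) ?cards0 ?subn0.
  by rewrite -(cardsID S X) [X :&: S]setIC; lia.
by apply/setP => x; rewrite !inE; case: (x \in S); case: (x \in X).
Qed.

Definition toggle v S := if v \in S then S :\ v else v |: S.

Lemma toggleK v : involutive (toggle v).
Proof.
move=> S; rewrite /toggle; case: (boolP (v \in S)) => vS.
  by rewrite !inE eqxx /= setD1K.
by rewrite !inE eqxx /= setU1K.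
Qed.

Lemma in_toggle v S x : (x \in toggle v S) = (x \in S) (+) (x == v).
Proof.
rewrite /toggle; case: (boolP (v \in S)) => vS; rewrite !inE.
  by have [->|] := eqVneq x v; rewrite ?vS ?addbF.
by have [->|] := eqVneq x v; rewrite ?(negPf vS) ?addbF.
Qed.

Lemma card_toggle A u S :
  #|A :&: toggle u S| + ((u \in S) && (u \in A)) = #|A :&: S| + ((u \notin S) && (u \in A)).
Proof.
rewrite /toggle; case: (boolP (u \in S)) => uS /=; rewrite addn0.
  by rewrite setIDA [in RHS](cardsD1 u) inE uS andbT addnC.
rewrite setIUr (cardsD1 u (_ :|: _)) !inE eqxx (negPf uS) andbF orbF andbT addnC; congr addn.
  apply: eq_card => x; rewrite !inE; have [->|] := eqVneq x u; rewrite ?(negPf uS) ?andbF //=.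
Qed.

End SymDiff.

(** * Hamiltonicity near two cliques *)

Section TwoCliques.
Variable T : finType.
Implicit Types (e : rel T) (A B S P G : {set T}) (x y u v : T).

(** Closure in two rounds: vertices of [G] are joined to all of [P] because the degree bounds add up
    to more than [#|P| + 2]; then every other vertex has at least [#|G|] neighbours, and [2 * #|G|]
    is again too large. *)
Lemma side_clique e e' P G (dg db : nat) : symmetric e' -> irreflexive e' ->
  {in P &, forall x y, e x y -> e' x y} ->
  {in P &, forall u v, u != v -> ~~ e' u v -> #|nbh e' v :&: P| + #|nbh e' u :&: P| <= #|P| + 2} ->
  G \subset P -> {in G, forall g, dg <= #|nbh e g :&: P|} ->
  {in P, forall v, db <= #|nbh e v :&: P|} ->
  #|P| + 2 < dg + db -> #|P| + 2 < 2 * #|G| ->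
  {in P &, forall u v, u != v -> e' u v}.
Proof.
move=> e's e'i see' low GP hg hb hgb hG.
have mono v : v \in P -> #|nbh e v :&: P| <= #|nbh e' v :&: P|.
  move=> vP; apply: subset_leq_card; apply/subsetP => y; rewrite !inE => /andP[vy yP].
  by rewrite yP see'.
have good g v : g \in G -> v \in P -> g != v -> e' g v.
  move=> gG vP gv; apply: contraT => ngv; have gP := subsetP GP g gG.
  have := low g v gP vP gv ngv; have := hg g gG; have := hb v vP.
  have := mono g gP; have := mono v vP; lia.
move=> u v uP vP uv; apply: contraT => nuv.
have uG : u \notin G by apply: contraNN nuv => uG; apply: good.
have vG : v \notin G by apply: contraNN nuv => vG; rewrite e's; apply: good; rewrite // eq_sym.
have big w : w \in P -> w \notin G -> #|G| <= #|nbh e' w :&: P|.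
  move=> wP wG; apply: subset_leq_card; apply/subsetP => g gG.
  rewrite !inE (subsetP GP g gG) andbT e's good //.
  by apply: contraNneq wG => <-.
by have := low u v uP vP uv nuv; have := big u uP uG; have := big v vP vG; lia.
Qed.

(** Only two edges across are kept and only pairs inside a side may be added. At most two vertices
    of a side then have a neighbour across, which is the [+ 2] in the bounds; closure makes both
    sides cliques. *)
Lemma ham_near_cliques e S A (a1 a2 b1 b2 : T) (GA GB : {set T}) (dg db : nat) :
  symmetric e -> irreflexive e ->
  a1 \in S :&: A -> a2 \in S :&: A -> b1 \in S :\: A -> b2 \in S :\: A ->
  a1 != a2 -> b1 != b2 -> e a1 b1 -> e a2 b2 ->
  GA \subset S :&: A -> GB \subset S :\: A ->
  {in GA, forall g, dg <= #|nbh e g :&: (S :&: A)|} ->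
  {in GB, forall g, dg <= #|nbh e g :&: (S :\: A)|} ->
  {in S :&: A, forall v, db <= #|nbh e v :&: (S :&: A)|} ->
  {in S :\: A, forall v, db <= #|nbh e v :&: (S :\: A)|} ->
  #|S :&: A| + 2 < dg + db -> #|S :\: A| + 2 < dg + db ->
  #|S :&: A| + 2 < 2 * #|GA| -> #|S :\: A| + 2 < 2 * #|GB| -> ham e S.
Proof.
set P := S :&: A; set Q := S :\: A.
move=> es ei a1P a2P b1Q b2Q a12 b12 e1 e2 GAP GBQ dgA dgB dbA dbB hA hB hGA hGB.
have PS : P \subset S by apply: subsetIl.
have QS : Q \subset S by apply: subsetDl.
have SPQ : S :\: P = Q by rewrite /P /Q setDIr setDv set0U.
have SQP : S :\: Q = P by rewrite /P /Q setDDr setDv set0U.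
have PQ x : x \in P -> x \in A by rewrite inE => /andP[].
have QA x : x \in Q -> x \notin A by rewrite inE => /andP[].
pose c x y := [|| (x == a1) && (y == b1), (x == b1) && (y == a1),
                  (x == a2) && (y == b2) | (x == b2) && (y == a2)].
pose e0 : rel T := fun x y => e x y && (((x \in A) == (y \in A)) || c x y).
pose K : rel T := fun x y => (x != y) && ((x \in A) == (y \in A)).
have cs x y : c x y = c y x.
  rewrite /c; case: (x == a1); case: (x == b1); case: (x == a2); case: (x == b2);
  case: (y == a1); case: (y == b1); case: (y == a2); case: (y == b2) => //.
have e0s : symmetric e0 by move=> x y; rewrite /e0 es cs eq_sym.
apply: contrapT => nh.
have nh0 : ~ ham e0 S.
  by move=> h; apply: nh; apply: ham_sub h => x y _ _ /andP[].
have [e' [e's see' e'K nh' mx]] := maximal_nonham K e0s nh0.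
have e'i : irreflexive e'.
  by move=> x; apply/negP => /e'K; rewrite /e0 /K ei !eqxx.
have cross x y : e' x y -> (x \in A) != (y \in A) -> c x y.
  move=> /e'K; rewrite /e0 /K [(y \in A) == (x \in A)]eq_sym => h /negPf nA.
  by move: h; rewrite nA !andbF !orbF => /andP[].
have low (X : {set T}) : X \subset S -> (forall x y, x \in X -> y \in S -> ((x \in A) == (y \in A)) = (y \in X)) ->
    (exists z1 z2, forall x y, x \in X -> y \in S :\: X -> c x y -> x = z1 \/ x = z2) ->
    {in X &, forall u v, u != v -> ~~ e' u v ->
      #|nbh e' v :&: X| + #|nbh e' u :&: X| <= #|X| + 2}.
  move=> XS XA [z1 [z2 hz]] u v uX vX uv nuv.
  have Kuv : K u v by rewrite /K uv XA // (subsetP XS).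
  have := cross_count e's e'i uv nh' (mx u v Kuv nuv) XS XS.
  move/leq_trans; apply; apply: leq_add; first by apply/subset_leq_card/subD1set.
  apply: leq_trans (_ : #|[set z1; z2]| <= _); last by rewrite cards2; case: (z1 != z2).
  apply: subset_leq_card; apply/subsetP => y; rewrite !inE => /andP[yX /existsP[x]].
  rewrite !inE => /andP[/andP[nxX xS] exy].
  have : c y x.
    by rewrite cs; apply: cross exy _; rewrite eq_sym XA // (negPf nxX).
  by move=> /(hz y x yX); rewrite inE nxX xS => /(_ isT)[]->; rewrite eqxx ?orbT.
have clA : {in P &, forall u v, u != v -> e' u v}.
  apply: (side_clique e's e'i _ _ GAP dgA dbA hA hGA).
    by move=> x y /PQ xA /PQ yA exy; apply: see'; rewrite /e0 exy xA yA.
  apply: low => //; first by move=> x y /PQ-> yS; rewrite /P inE yS; case: (y \in A).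
  exists a1, a2 => x y xP; rewrite SPQ => yQ /or4P[]/andP[/eqP xE /eqP yE]; try by [left|right].
    by move: xP b1Q; rewrite xE => /PQ + /QA => ->.
  by move: xP b2Q; rewrite xE => /PQ + /QA => ->.
have clB : {in Q &, forall u v, u != v -> e' u v}.
  apply: (side_clique e's e'i _ _ GBQ dgB dbB hB hGB).
    by move=> x y /QA/negPf xA /QA/negPf yA exy; apply: see'; rewrite /e0 exy xA yA.
  apply: low => //; first by move=> x y /QA/negPf-> yS; rewrite /Q inE yS; case: (y \in A).
  exists b1, b2 => x y xQ; rewrite SQP => yP /or4P[]/andP[/eqP xE /eqP yE]; try by [left|right].
    by move: xQ a1P; rewrite xE => /QA + /PQ => /negPf->.
  by move: xQ a2P; rewrite xE => /QA + /PQ => /negPf->.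
case: nh'; have -> : S = P :|: Q by rewrite setID.
have dPQ : [disjoint P & Q].
  by apply/pred0P => x /=; apply/negP => /andP[/PQ xA /QA]; rewrite xA.
apply: (ham_two_cliques dPQ a1P a2P b1Q b2Q a12 b12 clA clB).
  by apply: see'; rewrite /e0 e2 /c !eqxx !orbT.
by apply: see'; rewrite /e0 es e1 /c !eqxx !orbT.
Qed.

(* Otherwise the min-cut is a set X of fewer than K vertices meeting all but K edges
   across, and counting the degrees outside X gives 4 n = O(K^2). *)
Lemma cross_matching e A (n K : nat) : symmetric e -> irreflexive e -> #|T| = 2 * n ->
  (forall x, #|nbh e x| = n.+1) -> 2 * K < #|A| -> 2 * K < #|~: A| ->
  K ^ 2 + 3 * K < n ->
  exists M : {set T * T}, [/\ K <= #|M|, {in M, forall p, [/\ p.1 \in A, p.2 \notin A & e p.1 p.2]},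
    {in M &, injective fst} & {in M &, injective snd}].
Proof.
move=> es ei cT reg KA KB nK.
pose E := [set p : T * T | [&& p.1 \in A, p.2 \notin A & e p.1 p.2]].
have [M [P [Q [ME Mo Mi PQ]]]] := max_flow_min_cut 1 E.
have inj1 : {in M &, injective fst}.
  move=> p p' pM p'M pp'; apply/eqP; apply: contraT => ne; have := Mo p.1; rewrite leqNgt => /negP[].
  apply: (@leq_trans #|[set p; p']|); first by rewrite cards2 ne.
  by apply/subset_leq_card/subsetP => x; rewrite !inE => /orP[]/eqP->; rewrite ?pM ?p'M /= ?eqxx // -pp' eqxx.
have inj2 : {in M &, injective snd}.
  move=> p p' pM p'M pp'; apply/eqP; apply: contraT => ne; have := Mi p.2; rewrite leqNgt => /negP[].
  apply: (@leq_trans #|[set p; p']|); first by rewrite cards2 ne.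
  by apply/subset_leq_card/subsetP => x; rewrite !inE => /orP[]/eqP->; rewrite ?pM ?p'M /= ?eqxx // -pp' eqxx.
exists M; split => //; last by move=> p /(subsetP ME); rewrite inE => /and3P.
rewrite leqNgt; apply/negP => MK.
pose A0 := A :\: P; pose B0 := ~: A :\: Q; pose X := ~: (A0 :|: B0).
have A0A : A0 \subset A by apply: subsetDl.
have B0A : B0 \subset ~: A by apply: subsetDl.
have dAB : [disjoint A0 & B0].
  by apply/pred0P => x /=; rewrite !inE; case: (x \in A); rewrite ?andbF.
have cX : #|A0| + #|B0| + #|X| = 2 * n.
  by rewrite -cT -(cardsC (A0 :|: B0)) cardsU (disjoint_setI0 dAB) cards0 subn0.
have XK : #|X| <= #|P| + #|Q|.
  apply: leq_trans (leq_card_setU _ _); apply: subset_leq_card; apply/subsetP => x.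
  by rewrite !inE; case: (x \in A); case: (x \in P); case: (x \in Q).
have cross : \sum_(v in A0) #|nbh e v :&: B0| = #|uncovered E P Q|.
  rewrite (eq_bigr (fun v => \sum_(y in B0) e v y)); last by move=> v _; apply: nbh_sum.
  rewrite pair_big_dep -sum1_card big_mkcond [RHS]big_mkcond /=; apply: eq_bigr => -[x y] _ /=.
  rewrite !inE /=; case: (x \in P); case: (y \in Q); case: (x \in A); case: (y \in A); by case: (e x y).
have crossB : \sum_(v in B0) #|nbh e v :&: A0| = #|uncovered E P Q|.
  by rewrite -cross double_count.
have split_deg v : n.+1 = #|nbh e v :&: A0| + #|nbh e v :&: B0| + #|nbh e v :&: X|.
  rewrite -(reg v) -(cardsID (A0 :|: B0) (nbh e v)) setIUr cardsU.
  by rewrite [_ :&: _ :&: _](_ : _ = set0) ?cards0 ?subn0 ?setDE // setIACA (disjoint_setI0 dAB) setI0.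
have own v (Y : {set T}) : v \in Y -> #|nbh e v :&: Y| + 1 <= #|Y|.
  move=> vY; rewrite (cardsD1 v Y) vY addnC leq_add2l; apply: subset_leq_card.
  apply/subsetP => y; rewrite !inE => /andP[vy ->]; rewrite andbT.
  by apply: contraTneq vy => ->; rewrite ei.
have empty (Y Z : {set T}) : K < #|Y| -> \sum_(v in Y) #|nbh e v :&: Z| < K ->
    exists2 v, v \in Y & #|nbh e v :&: Z| = 0.
  move=> KY sK; apply: contrapT => no; move: sK; rewrite ltnNge => /negP[].
  apply: leq_trans (ltnW KY) _; rewrite -sum1_card; apply: leq_sum => v vY.
  by rewrite lt0n; apply/eqP => h; apply: no; exists v.
have cA0 : #|A| <= #|A0| + #|P|.
  by rewrite -(cardsID P A) addnC leq_add2l; apply: subset_leq_card; apply: subsetIr.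
have cB0 : #|~: A| <= #|B0| + #|Q|.
  by rewrite -(cardsID Q (~: A)) addnC leq_add2l; apply: subset_leq_card; apply: subsetIr.
move: PQ; rewrite mul1n => PQ.
(* A vertex of [A0] without neighbours in [B0] forces [A0] and [X] together to have at least [n.+2]
   elements, hence [B0] at most [n - 2]. *)
have [a aA a0] : exists2 v, v \in A0 & #|nbh e v :&: B0| = 0.
  by apply: empty; rewrite ?cross; clear -KA cA0 PQ MK; lia.
have [b bB b0] : exists2 v, v \in B0 & #|nbh e v :&: A0| = 0.
  by apply: empty; rewrite ?crossB; clear -KB cB0 PQ MK; lia.
have leX v : #|nbh e v :&: X| <= #|X| by apply/subset_leq_card/subsetIr.
have hA : n.+2 <= #|A0| + #|X|.
  have := split_deg a; have := own a A0 aA; have := leX a; rewrite a0; clear; lia.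
have hB : n.+2 <= #|B0| + #|X|.
  have := split_deg b; have := own b B0 bB; have := leX b; rewrite b0; clear; lia.
have sA : #|A0| * n.+1 <= #|A0| * #|A0|.-1 + #|uncovered E P Q| + \sum_(v in A0) #|nbh e v :&: X|.
  rewrite -cross -!sum_nat_const -!big_split /=; apply: leq_sum => v vA.
  by have := split_deg v; have := own v A0 vA; clear; lia.
have sB : #|B0| * n.+1 <= #|B0| * #|B0|.-1 + #|uncovered E P Q| + \sum_(v in B0) #|nbh e v :&: X|.
  rewrite -crossB -!sum_nat_const -!big_split /=; apply: leq_sum => v vB.
  by have := split_deg v; have := own v B0 vB; clear; lia.
have sX : \sum_(v in A0) #|nbh e v :&: X| + \sum_(v in B0) #|nbh e v :&: X| <= #|X| * n.+1.
  rewrite !(double_count _ X es) -big_split /= -sum_nat_const; apply: leq_sum => x _.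
  by have := split_deg x; clear; lia.
move: cX XK PQ MK nK hA hB sA sB sX; clear.
move: #|A0| #|B0| #|X| #|P| #|Q| #|M| #|uncovered E P Q| (\sum_(v in A0) _) (\sum_(v in B0) _).
move=> x y z p q m c s t h1 h2 h3 h4 h5 h6 h7 h8 h9 h10.
have zK : z < K by lia. have cK : c < K by lia.
(* A vertex of [A0] has at least [i + 2] neighbours outside [A0], one of [B0] at least [j + 2]
   outside [B0]. Summing, the demand on [X] exceeds its capacity [z * n.+1] by [4 * n] up to terms
   of order [K ^ 2]. *)
have [i xi] : exists i, n = x + i by exists (n - x); lia.
have [j yj] : exists j, n = y + j by exists (n - y); lia.
have ij : i + j = z by lia.
have iz : i + 2 <= z by lia.
have jz : j + 2 <= z by lia.
have zn : z < n by move: h5; move: (K ^ 2) => K2; clear - zK; lia.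
have x0 : 0 < x by clear - zn h6; lia.
have y0 : 0 < y by clear - zn h7; lia.
have key (u k r : nat) : 0 < u -> u * (u + k).+1 <= u * u.-1 + c + r -> u * (k + 2) <= c + r.
  by case: u => // u _; rewrite /=; clear; nia.
have kx : x * (i + 2) <= c + s by apply: key; rewrite -?xi.
have ky : y * (j + 2) <= c + t by apply: key; rewrite -?yj.
have ex : n * (i + 2) = x * (i + 2) + i * (i + 2) by rewrite [in LHS]xi; ring.
have ey : n * (j + 2) = y * (j + 2) + j * (j + 2) by rewrite [in LHS]yj; ring.
have ez : n * (i + 2) + n * (j + 2) = z * n + 4 * n by rewrite -ij; ring.
have eK (k : nat) : k + 2 <= z -> k * (k + 2) <= K * K.
  by move=> kz; apply: leq_mul; clear - kz zK; lia.
have := eK i iz; have := eK j jz.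
have e1 : z * n.+1 = z * n + z by rewrite mulnS addnC.
move: h5; rewrite -mulnn; move: kx ky ex ey ez h10 e1 zK cK; clear.
move: (n * (i + 2)) (n * (j + 2)) (z * n) (z * n.+1) (x * (i + 2)) (y * (j + 2)) (i * (i + 2)) (j * (j + 2)) (K * K).
by move=> *; lia.
Qed.

End TwoCliques.

(** * Hamiltonicity near a complete bipartite graph *)

Section NearBipartite.
Variable T : finType.
Implicit Types (e : rel T) (A S G : {set T}) (x y u v : T) (M : {set T * T}).

(** Inside the sides only the arcs of [M] are kept, and only pairs across may be added. The vertices
    charged by the correction term of [cross_count] are ends of these arcs, whence [2 * #|M|]. Two
    rounds of closure make the pair of sides complete. *)
Lemma ham_near_bipartite e S A (GA GB : {set T}) M (dg db : nat) :
  symmetric e -> irreflexive e -> forest M -> M \subset setX (S :\: A) (S :\: A) ->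
  {in M, forall p, e p.1 p.2} -> #|S :\: A| = #|S :&: A| + #|M| -> 1 < #|S :&: A| ->
  GA \subset S :&: A -> GB \subset S :\: A ->
  {in GA, forall g, dg <= #|nbh e g :&: (S :\: A)|} ->
  {in GB, forall g, dg <= #|nbh e g :&: (S :&: A)|} ->
  {in S :&: A, forall v, db <= #|nbh e v :&: (S :\: A)|} ->
  {in S :\: A, forall v, db <= #|nbh e v :&: (S :&: A)|} ->
  #|S :&: A| + 2 * #|M| < dg + db -> #|S :&: A| + 2 * #|M| < #|GA| + #|GB| -> ham e S.
Proof.
set P := S :&: A; set Q := S :\: A.
move=> es ei fM MQ Me cQ P1 GAP GBQ dgA dgB dbA dbB hd hG.
have PS : P \subset S by apply: subsetIl.
have QS : Q \subset S by apply: subsetDl.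
have SPQ : S :\: P = Q by rewrite /P /Q setDIr setDv set0U.
have PA x : x \in P -> x \in A by rewrite inE => /andP[].
have QA x : x \in Q -> x \in A = false by rewrite inE => /andP[/negPf].
have dPQ : [disjoint P & Q].
  by apply/pred0P => x /=; apply/negP => /andP[/PA xA /QA]; rewrite xA.
pose e0 : rel T := fun x y =>
  (e x y && ((x \in A) != (y \in A))) || ((x, y) \in M) || ((y, x) \in M).
pose K : rel T := fun x y => (x \in A) != (y \in A).
have e0s : symmetric e0.
  by move=> x y; rewrite /e0 es [(x \in A) == _]eq_sym -!orbA [(_ \in M) || _]orbC.
have e0e x y : e0 x y -> e x y.
  by case/orP => [/orP[/andP[]//|/Me]|/Me] //; rewrite es.
apply: contrapT => nh.
have nh0 : ~ ham e0 S by move=> h; apply: nh; apply: ham_sub h => x y _ _ /e0e.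
have [e' [e's see' e'K nh' mx]] := maximal_nonham K e0s nh0.
have e'i : irreflexive e'.
  move=> x; apply/negP => /e'K; rewrite /K eqxx !orbF => /e0e.
  by rewrite ei.
have sub x y : e x y -> (x \in A) != (y \in A) -> e' x y.
  by move=> exy xyA; apply: see'; rewrite /e0 exy xyA.
have low u v : u \in P -> v \in Q -> ~~ e' u v ->
    #|nbh e' v :&: P| + #|nbh e' u :&: Q| <= #|P| + 2 * #|M|.
  move=> uP vQ nuv; have Kuv : K u v by rewrite /K PA ?QA.
  have uv : u != v by apply: contraTneq uP => ->; rewrite (disjointFl dPQ vQ).
  have := cross_count e's e'i uv nh' (mx u v Kuv nuv) PS QS.
  move/leq_trans; apply; apply: leq_add; first by apply/subset_leq_card/subD1set.
  apply: leq_trans (_ : #|[set p.1 | p in M] :|: [set p.2 | p in M]| <= _).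
    apply: subset_leq_card; apply/subsetP => y; rewrite inE => /andP[yQ /existsP[x]].
    rewrite SPQ => /andP[xQ /e'K]; rewrite /K /e0 (QA x xQ) (QA y yQ) !andbF !orbF /=.
    by move=> /orP[]h; rewrite inE; apply/orP; [right|left]; apply/imsetP; eexists; eauto.
  apply: leq_trans (leq_card_setU _ _) _; rewrite mul2n -addnn.
  by apply: leq_add; apply: leq_imset_card.
have monoP v : v \in P -> #|nbh e v :&: Q| <= #|nbh e' v :&: Q|.
  move=> vP; apply: subset_leq_card; apply/subsetP => y /setIP[vy yQ].
  by rewrite in_setI yQ andbT inE; move: vy; rewrite inE => vy; rewrite sub // (PA v vP) (QA y yQ).
have monoQ v : v \in Q -> #|nbh e v :&: P| <= #|nbh e' v :&: P|.
  move=> vQ; apply: subset_leq_card; apply/subsetP => y /setIP[vy yP].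
  by rewrite in_setI yP andbT inE; move: vy; rewrite inE => vy; rewrite sub // (PA y yP) (QA v vQ).
have GAP' g : g \in GA -> g \in P := subsetP GAP g.
have GBQ' g : g \in GB -> g \in Q := subsetP GBQ g.
have goodA g v : g \in GA -> v \in Q -> e' g v.
  move=> gG vQ; apply: contraT => ngv; have gP := GAP' g gG.
  have h1 := low g v gP vQ ngv; have h2 := dgA g gG; have h3 := dbB v vQ.
  have h4 := monoP g gP; have h5 := monoQ v vQ.
  by move: h1 h2 h3 h4 h5 hd; clear; lia.
have goodB g v : g \in GB -> v \in P -> e' v g.
  move=> gG vP; apply: contraT => ngv; have gQ := GBQ' g gG.
  have h1 := low v g vP gQ ngv; have h2 := dgB g gG; have h3 := dbA v vP.
  have h4 := monoP v vP; have h5 := monoQ g gQ.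
  by move: h1 h2 h3 h4 h5 hd; clear; lia.
have all u v : u \in P -> v \in Q -> e' u v.
  move=> uP vQ; apply: contraT => nuv; have h1 := low u v uP vQ nuv.
  have h2 : #|GB| <= #|nbh e' u :&: Q|.
    by apply: subset_leq_card; apply/subsetP => g gG; rewrite in_setI GBQ' // andbT inE goodB.
  have h3 : #|GA| <= #|nbh e' v :&: P|.
    by apply: subset_leq_card; apply/subsetP => g gG; rewrite in_setI GAP' // andbT inE e's goodA.
  by move: h1 h2 h3 hG; clear; lia.
case: nh'; have -> : S = P :|: Q by rewrite setID.
apply: (ham_bipartite e's dPQ P1 fM MQ cQ) => //.
by move=> [x y] xyM; apply: see'; rewrite /e0 xyM /= orbT.
Qed.

End NearBipartite.

(** * Central binomial coefficients *)

(** Replaces Stirling's formula; the induction step is [(2n+1)(2n+3) <= 4 (n+1)^2]. *)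
Lemma bin_central_sq n : 'C(2 * n, n) ^ 2 * (2 * n).+1 <= 16 ^ n.
Proof.
elim: n => // n IH.
have rec : n.+1 * 'C(2 * n.+1, n.+1) = 2 * ((2 * n).+1 * 'C(2 * n, n)).
  have -> : 2 * n.+1 = (2 * n).+2 by lia.
  have h1 := mul_bin_diag (2 * n).+2 n; rewrite /= in h1.
  have h3 := mul_bin_diag (2 * n).+1 n; rewrite /= in h3.
  have h4 : (2 * n).+1 - n.+1 = n by lia.
  have := @bin_sub (2 * n).+1 n.+1; rewrite h4 => e.
  rewrite -h1 e ?h3; last by lia.
  by rewrite mulnA; congr muln; lia.
rewrite -(leq_pmul2l (m := n.+1 ^ 2)) //.
have -> : n.+1 ^ 2 * ('C(2 * n.+1, n.+1) ^ 2 * (2 * n.+1).+1) =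
    (2 * ((2 * n).+1 * 'C(2 * n, n))) ^ 2 * (2 * n.+1).+1.
  by rewrite -rec; ring.
have -> : (2 * ((2 * n).+1 * 'C(2 * n, n))) ^ 2 * (2 * n.+1).+1 =
    (4 * (2 * n).+1 * (2 * n.+1).+1) * ('C(2 * n, n) ^ 2 * (2 * n).+1) by ring.
apply: leq_trans (leq_mul (leqnn _) IH) _.
rewrite [16 ^ n.+1]expnS [X in _ <= X]mulnA leq_mul2r; apply/orP; right; nia.
Qed.

Lemma bin_succ_le N k : k.*2.+1 <= N -> 'C(N, k) <= 'C(N, k.+1).
Proof.
by move=> h; rewrite -(leq_pmul2l (ltn0Sn k)) mul_bin_left leq_mul2r; apply/orP; right; lia.
Qed.

Lemma bin_succ_ge N k : N <= k.*2.+1 -> 'C(N, k.+1) <= 'C(N, k).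
Proof.
by move=> h; rewrite -(leq_pmul2l (ltn0Sn k)) mul_bin_left leq_mul2r; apply/orP; right; lia.
Qed.

Lemma bin_central_max n k : 'C(2 * n, k) <= 'C(2 * n, n).
Proof.
have [kn|nk] := leqP k n.
  have -> : k = n - (n - k) by lia.
  elim: (n - k) => [|i IH]; first by rewrite subn0.
  have [ni|ni] := ltnP i n; last by rewrite (_ : n - i.+1 = n - i); [|lia].
  apply: leq_trans IH; have -> : n - i = (n - i.+1).+1 by lia.
  by apply: bin_succ_le; lia.
have -> : k = n + (k - n) by lia.
elim: (k - n) => [|i IH]; first by rewrite addn0.
by apply: leq_trans IH; rewrite addnS; apply: bin_succ_ge; lia.
Qed.



Local Open Scope ring_scope.

(** * Uniform random subsets *)

Section Expectation.
Variable R : realType.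

Definition Ex (X : finType) (f : X -> R) : R := (\sum_x f x) / #|X|%:R.

Variable X : finType.
Implicit Types (f g : X -> R) (P Q : X -> Prop).

Lemma uniform_prE P : uniform_pr R P = Ex (fun x => (`[< P x >])%:R).
Proof.
rewrite /uniform_pr /Ex; congr (_ / _); rewrite -sum1_card natr_sum big_mkcond /=.
by apply: eq_bigr => x _; rewrite inE; case: `[< _ >].
Qed.

Lemma eq_Ex f g : f =1 g -> Ex f = Ex g.
Proof. by move=> fg; congr (_ / _); apply: eq_bigr => x _. Qed.

Lemma ExD f g : Ex (fun x => f x + g x) = Ex f + Ex g.
Proof. by rewrite /Ex big_split mulrDl. Qed.

Lemma ExN f : Ex (fun x => - f x) = - Ex f.
Proof. by rewrite /Ex sumrN mulNr. Qed.

Lemma ExB f g : Ex (fun x => f x - g x) = Ex f - Ex g.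
Proof. by rewrite ExD ExN. Qed.

Lemma ExZ a f : Ex (fun x => a * f x) = a * Ex f.
Proof. by rewrite /Ex -mulr_sumr mulrA. Qed.

Lemma Ex_sum (I : Type) (s : seq I) (p : pred I) (F : I -> X -> R) :
  Ex (fun x => \sum_(i <- s | p i) F i x) = \sum_(i <- s | p i) Ex (F i).
Proof. by rewrite /Ex exchange_big /= mulr_suml. Qed.

Lemma ler_Ex f g : (forall x, f x <= g x) -> Ex f <= Ex g.
Proof. by move=> fg; rewrite /Ex ler_wpM2r ?invr_ge0 ?ler0n // ler_sum. Qed.

Lemma Ex_cst a : (0 < #|X|)%N -> Ex (fun _ : X => a) = a.
Proof.
move=> X0; rewrite /Ex big_const iter_addr_0 -[a *+ _]mulr_natr -mulrA divff ?mulr1 //.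
by rewrite pnatr_eq0 -lt0n.
Qed.

Lemma Ex_ge0 f : (forall x, 0 <= f x) -> 0 <= Ex f.
Proof. by move=> f0; rewrite /Ex divr_ge0 ?ler0n // sumr_ge0. Qed.

Lemma Ex_inj (h : X -> X) f : injective h -> Ex (fun x => f (h x)) = Ex f.
Proof. by move=> hi; congr (_ / _); rewrite [RHS](reindex_inj hi). Qed.

Lemma pr_ge0 P : 0 <= uniform_pr R P.
Proof. by rewrite /uniform_pr divr_ge0 ?ler0n. Qed.

Lemma pr_mono P Q : (forall x, P x -> Q x) -> uniform_pr R P <= uniform_pr R Q.
Proof.
move=> PQ; rewrite !uniform_prE; apply: ler_Ex => x; rewrite ler_nat.
by case: asboolP => // /PQ Qx; case: asboolP.
Qed.

Lemma pr_inj (h : X -> X) P : injective h ->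
  uniform_pr R (fun x => P (h x)) = uniform_pr R P.
Proof. by move=> hi; rewrite !uniform_prE (Ex_inj (fun x => (`[< P x >])%:R) hi). Qed.

Lemma pr_or P Q :
  uniform_pr R (fun x => P x \/ Q x) <= uniform_pr R P + uniform_pr R Q.
Proof.
rewrite !uniform_prE -ExD; apply: ler_Ex => x; rewrite -natrD ler_nat.
by rewrite asbool_or; case: `[< P x >]; case: `[< Q x >].
Qed.

Lemma pr_exists (I : finType) (P : I -> X -> Prop) :
  uniform_pr R (fun x => exists i, P i x) <= \sum_i uniform_pr R (P i).
Proof.
under eq_bigr do rewrite uniform_prE; rewrite uniform_prE -Ex_sum; apply: ler_Ex => x.
case: asboolP => [[i Pi]|_]; last by apply: sumr_ge0 => i _; rewrite ler0n.
rewrite (bigD1 i) //=; case: asboolP => // _.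
by rewrite lerDl sumr_ge0 // => j _; rewrite ler0n.
Qed.

Lemma pr_true P : (0 < #|X|)%N -> (forall x, P x) -> uniform_pr R P = 1.
Proof.
move=> X0 Pt; rewrite uniform_prE -[RHS](Ex_cst 1 X0); apply: eq_Ex => x.
by case: asboolP (Pt x).
Qed.

Lemma pr_diff P Q (B : X -> Prop) : (forall x, P x -> Q x \/ B x) ->
  uniform_pr R P - uniform_pr R B <= uniform_pr R Q.
Proof.
by move=> PQ; rewrite lerBlDr; apply: le_trans (pr_or _ _); apply: pr_mono.
Qed.

Lemma pr_neg P : (0 < #|X|)%N -> uniform_pr R (fun x => ~ P x) = 1 - uniform_pr R P.
Proof.
move=> X0; apply: (addIr (uniform_pr R P)); rewrite subrK !uniform_prE -ExD.
rewrite -[RHS](Ex_cst 1 X0); apply: eq_Ex => x.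
by rewrite asbool_neg; case: `[< P x >]; rewrite /= ?addr0 ?add0r.
Qed.

Lemma markov P f a : 0 < a -> (forall x, 0 <= f x) -> (forall x, P x -> a <= f x) ->
  uniform_pr R P <= Ex f / a.
Proof.
move=> a0 f0 fP; rewrite ler_pdivlMr // mulrC uniform_prE -ExZ; apply: ler_Ex => x.
by case: asboolP => [/fP|_]; rewrite ?mulr1 ?mulr0.
Qed.

Lemma chebyshev P f m t : 0 < t -> (forall x, P x -> t <= `|f x - m|) ->
  uniform_pr R P <= Ex (fun x => (f x - m) ^+ 2) / t ^+ 2.
Proof.
move=> t0 h; apply: markov; first by rewrite exprn_gt0.
- by move=> x; rewrite sqr_ge0.
- by move=> x /h tx; rewrite -(real_normK (num_real (f x - m))) lerXn2r ?nnegrE // ltW.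
Qed.

(** Covariances vanish off [bad] and are at most 1 on it, so the variance is at most the number of
    dependent pairs. *)
Lemma variance_bound (I : finType) (F : {set I}) (f : I -> X -> R) (bad : rel I) :
  (0 < #|X|)%N ->
  (forall i x, 0 <= f i x <= 1) ->
  (forall i j, ~~ bad i j -> Ex (fun x => f i x * f j x) = Ex (f i) * Ex (f j)) ->
  Ex (fun x => (\sum_(i in F) f i x - \sum_(i in F) Ex (f i)) ^+ 2) <=
  \sum_(i in F) \sum_(j in F) (bad i j)%:R.
Proof.
move=> X0 f01 ind; pose m := \sum_(i in F) Ex (f i).
have -> : Ex (fun x => (\sum_(i in F) f i x - m) ^+ 2) =
    \sum_(i in F) \sum_(j in F) (Ex (fun x => f i x * f j x) - Ex (f i) * Ex (f j)).
  rewrite (eq_Ex (g := fun x => (\sum_(i in F) \sum_(j in F) f i x * f j x) -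
      ((2 * m) * \sum_(i in F) f i x + - m ^+ 2))); last first.
    move=> x; set s := \sum_(i in F) f i x.
    have -> : \sum_(i in F) \sum_(j in F) f i x * f j x = s * s.
      by rewrite mulr_suml; apply: eq_bigr => i _; rewrite mulr_sumr.
    by ring.
  have EA : Ex (fun x => \sum_(i in F) \sum_(j in F) f i x * f j x) =
      \sum_(i in F) \sum_(j in F) Ex (fun x => f i x * f j x).
    by rewrite Ex_sum; apply: eq_bigr => i _; rewrite Ex_sum.
  rewrite ExB ExD ExZ Ex_cst // EA Ex_sum -/m.
  under [in RHS]eq_bigr do rewrite sumrB; rewrite sumrB; congr (_ - _).
  under [in RHS]eq_bigr do rewrite -mulr_sumr; rewrite -mulr_suml -/m.
  by ring.
apply: ler_sum => i _; apply: ler_sum => j _.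
have Ege0 k : 0 <= Ex (f k) by apply: Ex_ge0 => x; case/andP: (f01 k x).
have [bij|/ind->] := boolP (bad i j); last by rewrite subrr.
rewrite lerBlDr; apply: (@le_trans _ _ 1); last by rewrite lerDl mulr_ge0.
rewrite -[leRHS](Ex_cst 1 X0); apply: ler_Ex => x.
have /andP[? ?] := f01 i x; have /andP[? ?] := f01 j x.
by rewrite mulr_ile1.
Qed.

End Expectation.

Section Marginal.
Variables (R : realType) (X Y : finType).

(** Lets auxiliary randomness [Y], such as random levels, be introduced without changing the law of
    [X]. *)
Lemma Ex_fst (f : X -> R) : (0 < #|Y|)%N -> Ex (fun z : X * Y => f z.1) = Ex f.
Proof.
move=> Y0; rewrite /Ex card_prod.
rewrite (eq_bigr (fun z : X * Y => (fun x (y : Y) => f x) z.1 z.2)) //.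
rewrite -(pair_bigA _ (fun x (y : Y) => f x)) /=.
under eq_bigr do rewrite big_const iter_addr_0 -[_ *+ #|Y|]mulr_natr.
rewrite -mulr_suml natrM -mulf_div divff ?mulr1 //.
by rewrite pnatr_eq0 -lt0n.
Qed.

Lemma pr_fst (P : X -> Prop) : (0 < #|Y|)%N ->
  uniform_pr R (fun z : X * Y => P z.1) = uniform_pr R P.
Proof. by move=> Y0; rewrite !uniform_prE (Ex_fst (fun x => (`[< P x >])%:R)). Qed.

Lemma Ex_prod (f : X -> R) (g : Y -> R) :
  Ex (fun z : X * Y => f z.1 * g z.2) = Ex f * Ex g.
Proof.
rewrite /Ex card_prod -(pair_bigA _ (fun x y => f x * g y)) /=.
under eq_bigr do rewrite -mulr_sumr; rewrite -mulr_suml natrM.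
by rewrite mulf_div.
Qed.

End Marginal.

Section Moments.
Variables (R : realType) (T : finType).
Implicit Types (S U : {set T}) (u v : T).

Definition sgn v S : R := if v \in S then 1 else -1.
Definition zsum U S : R := \sum_(v in U) sgn v S.
Lemma sgn_toggle v S : sgn v (toggle v S) = - sgn v S.
Proof. by rewrite /sgn in_toggle eqxx; case: (v \in S); rewrite ?opprK. Qed.

Lemma sgn_toggle_neq u v S : u != v -> sgn u (toggle v S) = sgn u S.
Proof. by move=> uv; rewrite /sgn in_toggle (negPf uv) addbF. Qed.

Lemma zsum_toggle U v S : v \notin U -> zsum U (toggle v S) = zsum U S.
Proof.
by move=> vU; apply: eq_bigr => u uU; rewrite sgn_toggle_neq //; apply: contraNneq vU => <-.
Qed.

Lemma sgn_sq v S : sgn v S * sgn v S = 1.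
Proof. by rewrite /sgn; case: ifP => _; ring. Qed.

Lemma Ex_sgn v (f : {set T} -> R) : (forall S, f (toggle v S) = f S) ->
  Ex (fun S => f S * sgn v S) = 0.
Proof.
move=> fv; pose g S := f S * sgn v S.
have : Ex g = - Ex g.
  rewrite -{1}(Ex_inj g (inv_inj (toggleK v))) -ExN; apply: eq_Ex => S.
  by rewrite /g fv sgn_toggle mulrN.
by rewrite -/g; lra.
Qed.

Lemma card_set_gt0 : (0 < #|{: {set T}}|)%N.
Proof. by apply/card_gt0P; exists set0. Qed.

(** Split off one sign: the terms with an odd power of it vanish, since [toggle] reverses them. The
    constants 3 and 15 are the Gaussian moments. *)
Lemma zsum_moments U :
  [/\ Ex (fun S => zsum U S ^+ 2) = #|U|%:R,
      Ex (fun S => zsum U S ^+ 4) <= 3 * #|U|%:R ^+ 2 &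
      Ex (fun S => zsum U S ^+ 6) <= 15 * #|U|%:R ^+ 3].
Proof.
have [m] := ubnP #|U|; elim: m U => // m IH U lt_m.
have [->|/set0Pn[v vU]] := eqVneq U set0.
  have z0 k : Ex (fun S => zsum set0 S ^+ k.+1) = 0.
    rewrite -[RHS](Ex_cst 0 card_set_gt0); apply: eq_Ex => S.
    by rewrite /zsum big_set0 expr0n.
  by rewrite !z0 cards0 !expr0n /= !mulr0.
have cU : #|U| = #|U :\ v|.+1 by rewrite (cardsD1 v) vU.
have [|h2 h4 h6] := IH (U :\ v); first by rewrite cU in lt_m.
have vU' : v \notin U :\ v by rewrite !inE eqxx.
have zU S : zsum U S = zsum (U :\ v) S + sgn v S by rewrite /zsum (big_setD1 v vU) addrC.
have odd k : Ex (fun S => zsum (U :\ v) S ^+ k * sgn v S) = 0.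
  by apply: Ex_sgn => S; rewrite zsum_toggle.
have odd1 : Ex (fun S => zsum (U :\ v) S * sgn v S) = 0 := odd 1%N.
have sE S : sgn v S = 1 \/ sgn v S = -1 by rewrite /sgn; case: ifP; [left|right].
have c1 := Ex_cst (1 : R) card_set_gt0.
rewrite cU -natr1; set n : R := #|U :\ v|%:R in h2 h4 h6 *.
have n0 : 0 <= n by rewrite ler0n.
have e2 : Ex (fun S => zsum U S ^+ 2) = n + 1.
  rewrite (eq_Ex (g := fun S => zsum (U :\ v) S ^+ 2 + 1 + 2 * (zsum (U :\ v) S * sgn v S))).
    by rewrite !ExD ExZ h2 odd1 c1; ring.
  by move=> S; rewrite zU; case: (sE S) => ->; ring.
have e4 : Ex (fun S => zsum U S ^+ 4) = Ex (fun S => zsum (U :\ v) S ^+ 4) + 6 * n + 1.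
  rewrite (eq_Ex (g := fun S => zsum (U :\ v) S ^+ 4 + 6 * zsum (U :\ v) S ^+ 2 + 1 +
     (4 * (zsum (U :\ v) S ^+ 3 * sgn v S) + 4 * (zsum (U :\ v) S * sgn v S)))).
    by rewrite !ExD !ExZ h2 odd odd1 c1; ring.
  by move=> S; rewrite zU; case: (sE S) => ->; ring.
have e6 : Ex (fun S => zsum U S ^+ 6) = Ex (fun S => zsum (U :\ v) S ^+ 6) +
    15 * Ex (fun S => zsum (U :\ v) S ^+ 4) + 15 * n + 1.
  rewrite (eq_Ex (g := fun S => zsum (U :\ v) S ^+ 6 + 15 * zsum (U :\ v) S ^+ 4 +
     15 * zsum (U :\ v) S ^+ 2 + 1 + (6 * (zsum (U :\ v) S ^+ 5 * sgn v S) +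
     20 * (zsum (U :\ v) S ^+ 3 * sgn v S) + 6 * (zsum (U :\ v) S * sgn v S)))).
    by rewrite !ExD !ExZ h2 !odd odd1 c1; ring.
  by move=> S; rewrite zU; case: (sE S) => ->; ring.
rewrite e2 e4 e6; split => //; last by nra.
by nra.
Qed.

Lemma card_zsum U S : (#|U :&: S|%:R : R) = (#|U|%:R + zsum U S) / 2.
Proof.
have -> : (#|U|%:R : R) = \sum_(v in U) 1 by rewrite sumr_const.
rewrite /zsum -big_split /= mulr_suml.
have -> : (#|U :&: S|%:R : R) = \sum_(v in U) (v \in S)%:R.
  rewrite -sum1_card natr_sum big_mkcond [RHS]big_mkcond /=.
  by apply: eq_bigr => v _; rewrite inE; case: (v \in U); case: (v \in S).
by apply: eq_bigr => v _; rewrite /sgn; case: (v \in S) => /=; lra.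
Qed.

Lemma zsum_setC U S : zsum U (~: S) = - zsum U S.
Proof.
by rewrite /zsum -sumrN; apply: eq_bigr => v _; rewrite /sgn inE; case: (v \in S); rewrite ?opprK.
Qed.

(** The union bound runs over up to order [n ^ 2] sets with [t] of order [n]: the fourth moment
    would only give a bound of order 1, the sixth gives [1 / n]. *)
Lemma zsum_concentration (I : finType) (U : I -> {set T}) (N t : R) : 0 < t ->
  (forall i, #|U i|%:R <= N) ->
  uniform_pr R (fun S => exists i, t <= `|zsum (U i) S|) <= #|I|%:R * (15 * N ^+ 3 / t ^+ 6).
Proof.
move=> t0 UN; apply: le_trans (pr_exists _ _) _.
rewrite mulr_natl -sumr_const; apply: ler_sum => i _.
have [_ _ h6] := zsum_moments (U i).
apply: (@le_trans _ _ (Ex (fun S => zsum (U i) S ^+ 6) / t ^+ 6)).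
  apply: markov; first by rewrite exprn_gt0.
    by move=> S; rewrite (exprM _ 2 3) exprn_ge0 ?sqr_ge0.
  move=> S tS; rewrite !(exprM _ 2 3) -(real_normK (num_real (zsum _ _))).
  rewrite lerXn2r ?nnegrE ?sqr_ge0 // lerXn2r ?nnegrE ?normr_ge0 //; exact: ltW.
apply: ler_wpM2r; first by rewrite invr_ge0 exprn_ge0 // ltW.
apply: le_trans h6 _; rewrite ler_wpM2l // lerXn2r ?nnegrE ?ler0n //.
by apply: le_trans (UN i); rewrite ler0n.
Qed.

End Moments.

(** * Linear forests in random induced digraphs *)

Section Levels.
Variables (R : realType) (T : finType) (q : nat).
Notation r := q.+1.
Notation omega := ({set T} * {ffun T -> 'I_r})%type.
Implicit Types (w z : omega) (U V N : {set T}) (u v : T).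

Lemma card_omega_gt0 : (0 < #|{: omega}|)%N.
Proof. by apply/card_gt0P; exists (set0, [ffun=> ord0]). Qed.

Lemma card_levels_gt0 : (0 < #|{: {ffun T -> 'I_r}}|)%N.
Proof. by apply/card_gt0P; exists [ffun=> ord0]. Qed.

Definition determined U (f : omega -> R) := forall w w',
  (forall v, v \in U -> (v \in w.1) = (v \in w'.1) /\ w.2 v = w'.2 v) -> f w = f w'.

Definition mix U w w' : omega :=
  ([set v | if v \in U then v \in w.1 else v \in w'.1],
   [ffun v => if v \in U then w.2 v else w'.2 v]).

(* Two independent samples keep their joint law when they exchange their coordinates
   outside [U]; this turns f(w) g(w') into f(w) g(w). *)
Lemma independent U V (f g : omega -> R) : [disjoint U & V] ->
  determined U f -> determined V g ->
  Ex (fun w => f w * g w) = Ex f * Ex g.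
Proof.
move=> dUV fU gV; rewrite -Ex_prod -(Ex_fst (Y := omega)) ?card_omega_gt0 //.
pose h (z : omega * omega) := (mix U z.1 z.2, mix U z.2 z.1).
have hK : involutive h.
  move=> [[S1 l1] [S2 l2]]; rewrite /h /mix /=; congr ((_, _), (_, _)).
  - by apply/setP => v; rewrite !inE; case: (v \in U).
  - by apply/ffunP => v; rewrite !ffunE; case: (v \in U).
  - by apply/setP => v; rewrite !inE; case: (v \in U).
  - by apply/ffunP => v; rewrite !ffunE; case: (v \in U).
rewrite -(Ex_inj _ (inv_inj hK)); apply: eq_Ex => -[w w'] /=.
congr (_ * _).
  by apply: fU => v vU; rewrite /mix /= inE ffunE vU.
by apply: gV => v vV; rewrite /mix /= inE ffunE (disjointFl dUV vV).
Qed.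

Definition at_level v (t : 'I_r) w : bool := (v \in w.1) && (w.2 v == t).

(** Toggling [v] shows that it is present with probability 1/2; transposing two values shows that
    all levels are equally likely. *)
Lemma Ex_at_level v t : Ex (fun w => (at_level v t w)%:R : R) = (2 * r%:R)^-1.
Proof.
rewrite (eq_Ex (g := fun w => (v \in w.1)%:R * (w.2 v == t)%:R)); last first.
  by move=> w; rewrite -natrM mulnb.
rewrite (Ex_prod (fun S : {set T} => (v \in S)%:R) (fun l : {ffun T -> 'I_r} => (l v == t)%:R)).
rewrite invfM; congr (_ * _).
  have : Ex (fun S : {set T} => (v \in S)%:R : R) + Ex (fun S : {set T} => (v \in S)%:R) = 1.
    rewrite -{1}(Ex_inj _ (inv_inj (@toggleK _ v))) -ExD -[RHS](Ex_cst 1 (card_set_gt0 T)).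
    by apply: eq_Ex => S; rewrite in_toggle eqxx; case: (v \in S); rewrite /= ?addr0 ?add0r.
  by move=> h; lra.
pose E (s : 'I_r) := Ex (fun l : {ffun T -> 'I_r} => (l v == s)%:R : R).
have Es s : E s = E t.
  pose h (l : {ffun T -> 'I_r}) := [ffun x => tperm s t (l x)].
  have hi : injective h.
    move=> l l' /ffunP ll'; apply/ffunP => x; have := ll' x; rewrite !ffunE.
    exact: perm_inj.
  rewrite /E -[RHS](Ex_inj _ hi); apply: eq_Ex => l; rewrite ffunE.
  by rewrite -{2}(tpermL s t) (inj_eq perm_inj).
have : \sum_s E s = 1.
  rewrite -Ex_sum -[RHS](Ex_cst 1 card_levels_gt0); apply: eq_Ex => l.
  rewrite (bigD1 (l v)) //= eqxx big1 ?addr0 // => s.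
  by rewrite eq_sym => /negPf->.
rewrite (eq_bigr (fun=> E t)) // sumr_const card_ord -/(E t) -[E t *+ _]mulr_natr.
move=> h; apply: (mulIf (x := r%:R)); first by rewrite pnatr_eq0.
by rewrite [LHS]h mulVf ?pnatr_eq0.
Qed.

Lemma determined_at_level v t : determined [set v] (fun w => (at_level v t w)%:R).
Proof.
by move=> w w' /(_ v (set11 v)); rewrite /at_level => -[-> ->].
Qed.

Lemma bool01 (b : bool) : 0 <= (b%:R : R) <= 1.
Proof. by case: b; rewrite ?lexx ler01. Qed.

Definition level_count N t w : R := \sum_(v in N) (at_level v t w)%:R.

Lemma level_count_tail N t (a : R) : 0 < a ->
  uniform_pr R (fun w => #|N|%:R / (2 * r%:R) + a < level_count N t w)
    <= #|N|%:R / a ^+ 2.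
Proof.
move=> a0; pose f v w : R := (at_level v t w)%:R.
have mE : \sum_(v in N) Ex (f v) = #|N|%:R / (2 * r%:R).
  rewrite (eq_bigr (fun=> (2 * r%:R)^-1)); last by move=> v _; rewrite /f Ex_at_level.
  by rewrite sumr_const -[LHS]mulr_natl.
apply: le_trans (chebyshev (f := level_count N t) (m := #|N|%:R / (2 * r%:R)) a0 _) _.
  by move=> w h; apply: le_trans (ler_norm _); rewrite lerBrDl; apply: ltW.
apply: ler_wpM2r; first by rewrite invr_ge0 sqr_ge0.
rewrite -mE; apply: le_trans (variance_bound (bad := fun u v => u == v) _ card_omega_gt0 _ _) _.
- by move=> v w; apply: bool01.
- move=> u v uv; apply: (@independent [set u] [set v]); [|exact: determined_at_level..].
  by rewrite disjoints1 inE.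
- rewrite (eq_bigr (fun=> 1)) ?sumr_const // => v vN.
  rewrite (bigD1 v) //= eqxx big1 ?addr0 // => u /andP[_].
  by rewrite eq_sym => /negPf->.
Qed.

(** Rising by exactly one level confines the out-neighbours of a vertex to one level. Degrees thus
    drop by a factor [r] and the number of arcs by [r ^ 2 / q]: acyclicity costs only the factor
    [q / r] in the ratio of arcs to degree. *)
Definition up_arc (p : T * T) w : bool :=
  [&& p.1 \in w.1, p.2 \in w.1 & w.2 p.2 == (w.2 p.1).+1 :> nat].

Lemma determined_up_arc p : determined [set p.1; p.2] (fun w => (up_arc p w)%:R).
Proof.
move=> w w' h; have [h1 h2] := h p.1 (set21 _ _); have [h3 h4] := h p.2 (set22 _ _).
by rewrite /up_arc h1 h2 h3 h4.
Qed.

Lemma Ex_up_arc p : p.1 != p.2 ->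
  Ex (fun w => (up_arc p w)%:R : R) = q%:R / (2 * r%:R) ^+ 2.
Proof.
move=> np.
rewrite (eq_Ex (g := fun w => \sum_(s < r) \sum_(t < r | t == s.+1 :> nat)
    (at_level p.1 s w)%:R * (at_level p.2 t w)%:R)); last first.
  move=> w; rewrite (bigD1 (w.2 p.1)) //= [X in _ + X]big1 ?addr0; last first.
    by move=> s; rewrite eq_sym => /negPf sN; apply: big1 => t _; rewrite /at_level sN andbF mul0r.
  have [e|ne] := boolP (w.2 p.2 == (w.2 p.1).+1 :> nat); last first.
    rewrite /up_arc (negPf ne) !andbF big1 // => t /eqP te.
    rewrite /at_level; case: (w.2 p.2 =P t) => [wt|_]; last by rewrite andbF mulr0.
    by rewrite wt te eqxx in ne.
  rewrite (bigD1 (w.2 p.2)) //= big1 ?addr0; last first.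
    move=> t /andP[_]; rewrite eq_sym => /negPf tN.
    by rewrite /at_level tN andbF mulr0.
  by rewrite /at_level /up_arc !eqxx e !andbT -natrM mulnb.
rewrite Ex_sum (eq_bigr (fun s : 'I_r => (s < q)%:R * (2 * r%:R) ^- 2)).
  rewrite -mulr_suml; congr (_ * _).
  rewrite -natr_sum big_ord_recr /= ltnn addn0.
  by rewrite (eq_bigr (fun=> 1%N)) ?sum_nat_const ?card_ord ?muln1 // => i _; rewrite ltn_ord.
move=> s _; rewrite Ex_sum.
rewrite (eq_bigr (fun=> (2 * r%:R) ^- 2)); last first.
  move=> t _; rewrite (independent (U := [set p.1]) (V := [set p.2])).
  - by rewrite !Ex_at_level -invfM expr2.
  - by rewrite disjoints1 inE.
  - exact: determined_at_level.
  - exact: determined_at_level.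
have [sq|sq] := ltnP s q; last first.
  rewrite mul0r big1 // => t /eqP ts; have := ltn_ord t.
  by rewrite ts ltnS ltnNge sq.
by rewrite (big_pred1 (Ordinal (sq : s.+1 < r)%N)) ?mul1r.
Qed.

Definition share (p p' : T * T) := [|| p.1 == p'.1, p.1 == p'.2, p.2 == p'.1 | p.2 == p'.2].

Variables (F : {set T * T}) (D : nat).
Hypotheses (F_irr : {in F, forall p, p.1 != p.2}).
Hypotheses (F_out : forall u, (outdeg F u <= D)%N) (F_in : forall v, (indeg F v <= D)%N).

Lemma share_count p : (\sum_(p' in F) share p p' <= 4 * D)%N.
Proof.
have sumE (a : pred (T * T)) : (\sum_(p' in F) a p' = #|[set p' in F | a p']|)%N.
  rewrite -sum1_card big_mkcond [RHS]big_mkcond /=; apply: eq_bigr => x _.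
  by rewrite inE; case: (x \in F); case: (a x).
have le4 : (4 * D = D + D + (D + D))%N by lia.
apply: (@leq_trans (\sum_(p' in F) ((p'.1 == p.1) + (p'.2 == p.1) + ((p'.1 == p.2) + (p'.2 == p.2))))%N).
  apply: leq_sum => p' _; rewrite /share !(eq_sym p.1) !(eq_sym p.2).
  by case: (p'.1 == p.1); case: (p'.2 == p.1); case: (p'.1 == p.2); case: (p'.2 == p.2).
rewrite !big_split /= le4 (sumE (fun p' => p'.1 == p.1)) (sumE (fun p' => p'.2 == p.1)).
rewrite (sumE (fun p' => p'.1 == p.2)) (sumE (fun p' => p'.2 == p.2)).
by rewrite !leq_add //; [apply: F_out|apply: F_in|apply: F_out|apply: F_in].
Qed.

Lemma up_arc_tail (a : R) : 0 < a ->
  uniform_pr R (fun w => \sum_(p in F) (up_arc p w)%:R < #|F|%:R * (q%:R / (2 * r%:R) ^+ 2) - a)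
    <= #|F|%:R * (4 * D%:R) / a ^+ 2.
Proof.
move=> a0; pose f p w : R := (up_arc p w)%:R.
have mE : \sum_(p in F) Ex (f p) = #|F|%:R * (q%:R / (2 * r%:R) ^+ 2).
  rewrite (eq_bigr (fun=> (q%:R / (2 * r%:R) ^+ 2))); last by move=> p /F_irr np; rewrite /f Ex_up_arc.
  by rewrite sumr_const -[LHS]mulr_natl.
apply: le_trans (chebyshev (f := fun w => \sum_(p in F) f p w) (m := \sum_(p in F) Ex (f p)) a0 _) _.
  by move=> w h; rewrite mE -normrN; apply: le_trans (ler_norm _); rewrite opprB lerBrDl -lerBrDr; apply: ltW.
apply: ler_wpM2r; first by rewrite invr_ge0 sqr_ge0.
apply: le_trans (variance_bound (bad := share) _ card_omega_gt0 _ _) _.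
- by move=> p w; apply: bool01.
- move=> p p' /norP[n11 /norP[n12 /norP[n21 n22]]].
  apply: (@independent [set p.1; p.2] [set p'.1; p'.2]); [|exact: determined_up_arc..].
  apply/pred0P => x; rewrite /= !inE.
  have [->|] := eqVneq x p.1; first by rewrite (negPf n11) (negPf n12).
  by have [->|] := eqVneq x p.2; first by rewrite (negPf n21) (negPf n22).
- rewrite mulr_natl -sumr_const; apply: ler_sum => p _.
  by rewrite -natr_sum -natrM ler_nat share_count.
Qed.

(** After discarding arcs at overloaded vertices all degrees are at most [K], so unit capacities
    retain a fraction [1 / K] of the arcs; the levels serve as labels of the forest. *)
Lemma level_forest w (K : R) : 1 <= K ->
  exists M, [/\ forest M, M \subset F, M \subset setX w.1 w.1 &
    \sum_(p in F) (up_arc p w)%:R <= K * #|M|%:R +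
    \sum_(p in F) ((`[< exists t, K < level_count [set v | (p.1, v) \in F] t w >])%:R +
                   (`[< exists t, K < level_count [set u | (u, p.2) \in F] t w >])%:R)].
Proof.
move=> K1.
pose Bo u := `[< exists t, K < level_count [set v | (u, v) \in F] t w >].
pose Bi v := `[< exists t, K < level_count [set u | (u, v) \in F] t w >].
pose G := [set p in F | [&& up_arc p w, ~~ Bo p.1 & ~~ Bi p.2]].
have [M [P [Q [MG Mo Mi PQ]]]] := max_flow_min_cut 1 G.
exists M; split.
- exists (fun v => w.2 v : nat); split.
  + move=> p /(subsetP MG); rewrite inE => /and3P[_ /and3P[_ _ /eqP->] _].
    exact: ltnSn.
  + move=> p p' pM p'M e; have := Mo p.1; rewrite /outdeg leqNgt => /negP h.
    apply/eqP; apply: contraT => ne; case: h.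
    apply: (@leq_trans #|[set p; p']|); first by rewrite cards2 ne.
    apply/subset_leq_card/subsetP => x.
    by rewrite !inE => /orP[]/eqP->; rewrite ?pM ?p'M /= ?eqxx // -e eqxx.
  + move=> p p' pM p'M e; have := Mi p.2; rewrite /indeg leqNgt => /negP h.
    apply/eqP; apply: contraT => ne; case: h.
    apply: (@leq_trans #|[set p; p']|); first by rewrite cards2 ne.
    apply/subset_leq_card/subsetP => x.
    by rewrite !inE => /orP[]/eqP->; rewrite ?pM ?p'M /= ?eqxx // -e eqxx.
- by apply: subset_trans MG _; apply/subsetP => p; rewrite inE => /andP[].
- apply: subset_trans MG _; apply/subsetP => p; rewrite !inE => /andP[_ /andP[/and3P[-> -> _] _]].
  by [].
have countE N t : level_count N t w = #|[set v in N | at_level v t w]|%:R.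
  rewrite /level_count -natr_sum -sum1_card; congr (_%:R).
  rewrite big_mkcond [RHS]big_mkcond; apply: eq_bigr => v _; rewrite inE.
  by case: (v \in N); case: (at_level v t w).
have outG u : #|[set p in G | p.1 == u]|%:R <= K.
  have [->|/set0Pn[p0]] := eqVneq [set p in G | p.1 == u] set0; first by rewrite cards0; lra.
  rewrite !inE => /andP[/andP[p0F /and3P[/and3P[_ p02 /eqP lev] B _]] /eqP p0u].
  move: B; rewrite p0u => /negP B; apply: contraT; rewrite -ltNge => lt.
  case: B; apply/asboolP; exists (w.2 p0.2); apply: lt_le_trans lt _.
  rewrite countE ler_nat -(card_in_imset (f := snd) (D := [set p in G | p.1 == u])); last first.
    move=> [x y] [x' y']; rewrite !inE /= => /andP[_ /eqP->] /andP[_ /eqP->] -> //.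
  apply/subset_leq_card/subsetP => v /imsetP[[x y]]; rewrite !inE /=.
  move=> /andP[/andP[xF /andP[/and3P[_ /= yS /eqP /= ly] _]] /eqP xu] ->.
  rewrite -xu xF /at_level yS /=; apply/eqP/val_inj; rewrite /= ly lev.
  by rewrite xu p0u.
have inG u : #|[set p in G | p.2 == u]|%:R <= K.
  have [->|/set0Pn[p0]] := eqVneq [set p in G | p.2 == u] set0; first by rewrite cards0; lra.
  rewrite !inE => /andP[/andP[p0F /and3P[/and3P[p01 _ /eqP lev] _ B]] /eqP p0u].
  move: B; rewrite p0u => /negP B; apply: contraT; rewrite -ltNge => lt.
  case: B; apply/asboolP; exists (w.2 p0.1); apply: lt_le_trans lt _.
  rewrite countE ler_nat -(card_in_imset (f := fst) (D := [set p in G | p.2 == u])); last first.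
    move=> [x y] [x' y']; rewrite !inE /= => /andP[_ /eqP->] /andP[_ /eqP->] -> //.
  apply/subset_leq_card/subsetP => v /imsetP[[x y]]; rewrite !inE /=.
  move=> /andP[/andP[xF /andP[/and3P[/= xS _ /eqP /= ly] _]] /eqP xu] ->.
  rewrite -xu xF /at_level xS /=; apply/eqP/val_inj => /=; apply: succn_inj.
  by rewrite -ly -lev xu p0u.
(* A vertex of the cover accounts for at most [K] arcs, an uncovered arc for one, which is at most
   [K] too. *)
have Gle : #|G|%:R <= K * #|M|%:R.
  have cov : (#|G| <= \sum_(u in P) #|[set p in G | p.1 == u]| +
      \sum_(v in Q) #|[set p in G | p.2 == v]| + #|uncovered G P Q|)%N.
    have E1 (X : {set T}) (f : T * T -> T) :
        (\sum_(u in X) #|[set p in G | f p == u]| = #|[set p in G | f p \in X]|)%N.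
      rewrite -sum1_card (partition_big f (mem X)) /=; last by move=> p; rewrite inE => /andP[].
      apply: eq_bigr => u uX; rewrite -sum1_card; apply: eq_bigl => p.
      by rewrite !inE; have [->|] := eqVneq (f p) u; rewrite ?uX ?andbT ?andbF.
    rewrite !E1; apply: leq_trans (leq_add (leq_card_setU _ _) (leqnn _)).
    apply: leq_trans (leq_card_setU _ _).
    apply/subset_leq_card/subsetP => p; rewrite /uncovered !inE => ->.
    by case: (p.1 \in P); case: (p.2 \in Q).
  apply: (@le_trans _ _ (K * (#|P| + #|Q|)%:R + #|uncovered G P Q|%:R)).
    apply: (le_trans (y := (\sum_(u in P) #|[set p in G | p.1 == u]| +
      \sum_(v in Q) #|[set p in G | p.2 == v]| + #|uncovered G P Q|)%N%:R)).
      by rewrite ler_nat.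
    rewrite !natrD !natr_sum mulrDr lerD2r lerD //.
      rewrite mulr_natr -sumr_const; apply: ler_sum => u _; exact: outG.
    rewrite mulr_natr -sumr_const; apply: ler_sum => u _; exact: inG.
  move: PQ; rewrite mul1n -(ler_nat R) natrD => PQ.
  have u0 : 0 <= #|uncovered G P Q|%:R :> R by rewrite ler0n.
  nra.
apply: (@le_trans _ _ (#|G|%:R + \sum_(p in F) ((Bo p.1)%:R + (Bi p.2)%:R))); last first.
  by rewrite lerD2r; exact: Gle.
have -> : #|G|%:R = \sum_(p in F) ([&& up_arc p w, ~~ Bo p.1 & ~~ Bi p.2])%:R :> R.
  rewrite -natr_sum -sum1_card; congr (_%:R).
  rewrite big_mkcond [RHS]big_mkcond; apply: eq_bigr => p _; rewrite inE.
  by case: (p \in F) => //=; case: [&& _, _ & _].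
rewrite -big_split /=; apply: ler_sum => p _; rewrite -/(Bo p.1) -/(Bi p.2).
by rewrite -!natrD ler_nat; case: (up_arc p w); case: (Bo _); case: (Bi _).
Qed.

End Levels.

(* Each arc survives with probability 1/4; spreading the surviving vertices over many
   levels and keeping the arcs that go up one level gives a nearly regular acyclic
   digraph, where integrality of flows yields a large system of disjoint paths. *)
Lemma forest_sampling (R : realType) (g : R) : 0 < g < 1 ->
  exists c0 : R, 0 < c0 /\ forall (T : finType) (F : {set T * T}) (D : nat) (phi : R),
    {in F, forall p, p.1 != p.2} ->
    (forall u, outdeg F u <= D)%N -> (forall v, indeg F v <= D)%N ->
    c0 <= D%:R -> c0 <= phi -> D%:R * phi <= #|F|%:R ->
    uniform_pr R (fun S : {set T} => ~ exists M, [/\ forest M, M \subset F,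
        M \subset setX S S & (1 - g) * phi / 2 <= #|M|%:R]) <= g.
Proof.
(* With [a = g / 4] the factors [1 - 2 a], [q / r >= 1 - a] and [1 / (1 + a)] multiply to at least
   [1 - g]. *)
move=> /andP[g0 g1]; have [a a0 ag] : exists2 a : R, 0 < a & 4 * a = g by exists (g / 4); lra.
have [q q_ge] : exists q : nat, a^-1 <= q%:R.
  by exists (Num.bound a^-1); apply: ltW; apply: archi_boundP; rewrite invr_ge0 ltW.
have q0 : 0 < q%:R :> R by apply: lt_le_trans q_ge; rewrite invr_gt0.
pose r : R := q.+1%:R.
have r0 : 0 < r by rewrite ltr0n.
have [p0 p00 p0E] : exists2 p0 : R, 0 < p0 & p0 = q%:R / (2 * r) ^+ 2.
  by eexists; last by []; rewrite divr_gt0 // exprn_gt0 // mulr_gt0.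
(* [c1] controls the variance of the number of upward arcs, [c2] the expected number of arcs at
   overloaded vertices; either may fail with probability [g / 2]. The further summand [2 * r] below
   ensures [1 <= K]. *)
pose c1 := 8 / (a ^+ 2 * p0 ^+ 2 * g).
pose c2 := 16 * r ^+ 3 / (a ^+ 3 * p0 * g).
have c10 : 0 < c1 by rewrite divr_gt0 // !mulr_gt0 ?exprn_gt0.
have c20 : 0 < c2 by rewrite divr_gt0 ?mulr_gt0 ?exprn_gt0 ?ltr0n //.
exists (c1 + c2 + 2 * r); split; first by rewrite !addr_gt0 // mulr_gt0.
move=> T F D phi Firr Fo Fi cD cphi Fphi.
have D0 : 0 < D%:R :> R by lra.
have phi0 : 0 < phi by lra.
have F0 : 0 < #|F|%:R :> R by apply: lt_le_trans Fphi; rewrite mulr_gt0.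
(* The expected number [D / (2 r)] of neighbours on one level, with relative slack [a]. *)
pose K := (1 + a) * D%:R / (2 * r).
have K1 : 1 <= K.
  rewrite /K ler_pdivlMr ?mulr_gt0 // mul1r.
  have : 0 <= a * D%:R by rewrite mulr_ge0 ?ltW.
  by lra.
pose Bo (w : {set T} * {ffun T -> 'I_q.+1}) u := exists t, K < level_count R [set v | (u, v) \in F] t w.
pose Bi (w : {set T} * {ffun T -> 'I_q.+1}) v := exists t, K < level_count R [set u | (u, v) \in F] t w.
pose bad w : R := \sum_(p in F) ((`[< Bo w p.1 >])%:R + (`[< Bi w p.2 >])%:R).
pose low (w : {set T} * {ffun T -> 'I_q.+1}) := \sum_(p in F) (up_arc p w)%:R < #|F|%:R * p0 - a * #|F|%:R * p0.
pose many w := a * #|F|%:R * p0 <= bad w.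
rewrite -(@pr_fst _ _ {ffun T -> 'I_q.+1}) ?card_levels_gt0 //.
apply: (@le_trans _ _ (uniform_pr R low + uniform_pr R many)).
  apply: (le_trans _ (pr_or _ _ _)); apply: pr_mono => w nM.
  apply/or_asboolP; apply: contraT; rewrite negb_or => /andP[/asboolPn nl /asboolPn nm].
  case: nM; have [M [fM MF MS Mle]] := level_forest F w K1.
  exists M; split => //.
  move/negP: nl; rewrite -leNgt => nl; move/negP: nm; rewrite -ltNge => nm.
  have h : (1 - 2 * a) * p0 * #|F|%:R <= K * #|M|%:R.
    by move: Mle nm; rewrite -/(bad w) => Mle nm; nra.
  have [x x0 qx] : exists2 x : R, 1 - a <= x & q%:R = x * r.
    exists (q%:R / r); last by rewrite divfK // gt_eqF.
    rewrite ler_pdivlMr // /r -natr1.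
    have : 1 <= a * q%:R by rewrite -ler_pdivrMl // mulr1.
    by nra.
  have rn : r != 0 by rewrite gt_eqF.
  have h2 : (1 - 2 * a) * x * #|F|%:R <= 2 * (1 + a) * D%:R * #|M|%:R.
    have e1 (r' y z : R) : r' != 0 -> 4 * r' * (y * (x * r' / (2 * r') ^+ 2) * z) = y * x * z.
      by move=> ?; field.
    have e2 (r' y z t : R) : r' != 0 -> 4 * r' * (y * z / (2 * r') * t) = 2 * y * z * t.
      by move=> ?; field.
    rewrite p0E qx /K in h.
    have := ler_wpM2l (ltW (mulr_gt0 (ltr0n R 4) r0)) h.
    by rewrite e1 // e2.
  have h3 : (1 - 2 * a) * x * phi <= 2 * (1 + a) * #|M|%:R.
    rewrite -(ler_pM2l D0); apply: le_trans (_ : (1 - 2 * a) * x * #|F|%:R <= _); last first.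
      by apply: le_trans h2 _; rewrite le_eqVlt; apply/orP; left; apply/eqP; ring.
    rewrite mulrCA ler_wpM2l // mulr_ge0 //; first lra.
    by apply: le_trans x0; lra.
  have h4 : (1 - 2 * a) * (1 - a) * phi <= (1 - 2 * a) * x * phi.
    by rewrite ler_pM2r // ler_wpM2l //; lra.
  have h5 : (1 - 4 * a) * (1 + a) * phi <= (1 - 2 * a) * (1 - a) * phi.
    by rewrite ler_pM2r //; nra.
  rewrite -ag -(@ler_pM2l _ (2 * (1 + a))); last by rewrite mulr_gt0 ?addr_gt0.
  apply: le_trans (le_trans h4 h3); apply: le_trans h5.
  by rewrite le_eqVlt; apply/orP; left; apply/eqP; field.
apply: (@le_trans _ _ (g / 2 + g / 2)); last by lra.
apply: lerD.
  pose b := a * #|F|%:R * p0.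
  have b0 : 0 < b by rewrite !mulr_gt0.
  have := @up_arc_tail R T q F D Firr Fo Fi b b0; rewrite -/r -p0E => /le_trans; apply.
  rewrite ler_pdivrMr ?exprn_gt0 //.
  have h1 : 8 <= phi * (a ^+ 2 * p0 ^+ 2 * g).
    by rewrite -ler_pdivrMr ?mulr_gt0 ?exprn_gt0 //; apply: le_trans cphi; rewrite -/c1; lra.
  have h2 : 8 * D%:R <= #|F|%:R * (a ^+ 2 * p0 ^+ 2 * g).
    apply: (@le_trans _ _ (D%:R * phi * (a ^+ 2 * p0 ^+ 2 * g))).
      by rewrite mulrC -mulrA ler_pM2l.
    by rewrite ler_pM2r ?mulr_gt0 ?exprn_gt0.
  have -> : g / 2 * b ^+ 2 = #|F|%:R * (#|F|%:R * (a ^+ 2 * p0 ^+ 2 * g) / 2).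
    by rewrite /b; field.
  by rewrite ler_pM2l //; lra.
have b0 : 0 < a * #|F|%:R * p0 by rewrite !mulr_gt0.
apply: le_trans (markov (f := bad) b0 _ _) _.
- by move=> w; apply: sumr_ge0 => p _; rewrite addr_ge0 ?ler0n.
- by [].
pose s := a * D%:R / (2 * r).
have s0 : 0 < s by rewrite divr_gt0 // mulr_gt0.
have tail (N : {set T}) : (#|N| <= D)%N -> Ex (fun w =>
    (`[< exists t : 'I_q.+1, K < level_count R N t w >])%:R : R) <= r * (D%:R / s ^+ 2).
  move=> ND; rewrite -uniform_prE; apply: le_trans (pr_exists _ _) _.
  have -> : r * (D%:R / s ^+ 2) = \sum_(t < q.+1) (D%:R / s ^+ 2).
    by rewrite sumr_const card_ord -[RHS]mulr_natl.
  apply: ler_sum => t _.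
  have NDR : (#|N|%:R : R) <= D%:R by rewrite ler_nat.
  apply: (@le_trans _ _ (uniform_pr R (fun w => #|N|%:R / (2 * r) + s < level_count R N t w))).
    apply: pr_mono => w; apply: le_lt_trans.
    have -> : K = D%:R / (2 * r) + s by rewrite /K /s; ring.
    by rewrite lerD2r ler_pM2r // invr_gt0 mulr_gt0.
  apply: le_trans (level_count_tail _ _ s0) _.
  by rewrite ler_pM2r ?invr_gt0 ?exprn_gt0.
have Ebad : Ex bad <= #|F|%:R * (2 * (r * (D%:R / s ^+ 2))).
  rewrite Ex_sum mulr_natl -sumr_const; apply: ler_sum => p _.
  rewrite ExD; have -> : 2 * (r * (D%:R / s ^+ 2)) = r * (D%:R / s ^+ 2) + r * (D%:R / s ^+ 2) by ring.
  apply: lerD; apply: tail.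
    apply: leq_trans (Fo p.1); rewrite /outdeg -(card_imset _ (f := fun v => (p.1, v))); last by move=> x y [].
    apply/subset_leq_card/subsetP => x /imsetP[v]; rewrite !inE => vF ->.
    by rewrite vF eqxx.
  apply: leq_trans (Fi p.2); rewrite /indeg -(card_imset _ (f := fun v => (v, p.2))); last by move=> x y [].
  apply/subset_leq_card/subsetP => x /imsetP[v]; rewrite !inE => vF ->.
  by rewrite vF eqxx.
rewrite ler_pdivrMr //; apply: le_trans Ebad _.
have -> : g / 2 * (a * #|F|%:R * p0) = #|F|%:R * (g / 2 * a * p0) by ring.
rewrite ler_pM2l //.
have h1 : 16 * r ^+ 3 <= D%:R * (a ^+ 3 * p0 * g).
  by rewrite -ler_pdivrMr ?mulr_gt0 ?exprn_gt0 //; apply: le_trans cD; rewrite -/c2; lra.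
have -> : 2 * (r * (D%:R / s ^+ 2)) = 16 * r ^+ 3 / (D%:R * a ^+ 2 * 2).
  have e (r' d a' : R) : r' != 0 -> d != 0 -> a' != 0 ->
      2 * (r' * (d / (a' * d / (2 * r')) ^+ 2)) = 16 * r' ^+ 3 / (d * a' ^+ 2 * 2).
    by move=> r1 d1 a1; field; rewrite ?r1 ?d1 ?a1.
  by apply: e; rewrite gt_eqF.
rewrite ler_pdivrMr ?mulr_gt0 ?exprn_gt0 //; apply: le_trans h1 _.
by rewrite le_eqVlt; apply/orP; left; apply/eqP; field.
Qed.

(** * The binomial distribution *)

Section Additivity.
Variables (R : realType) (X : finType).
Implicit Types (P Q : X -> Prop).

Lemma pr_add_disjoint P Q : (forall x, P x -> ~ Q x) ->
  uniform_pr R (fun x => P x \/ Q x) = uniform_pr R P + uniform_pr R Q.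
Proof.
move=> PQ; rewrite !uniform_prE -ExD; apply: eq_Ex => x; rewrite asbool_or.
by case: (asboolP (P x)) => [/PQ|_]; case: (asboolP (Q x)); rewrite /= ?addr0 ?add0r.
Qed.

Lemma pr_exists_ord (m : nat) (f : X -> nat) (h : nat -> nat) : injective h ->
  uniform_pr R (fun x => exists i : 'I_m, f x = h i) =
  \sum_(i < m) uniform_pr R (fun x => f x = h i).
Proof.
move=> hi; under eq_bigr do rewrite uniform_prE; rewrite uniform_prE -Ex_sum.
apply: eq_Ex => x; case: asboolP => [[i fi]|no].
  rewrite (bigD1 i) //=; case: asboolP => // _; rewrite big1 ?addr0 // => j ji.
  case: asboolP => // fj; case/eqP: ji; apply/val_inj/hi; by rewrite -fj fi.
rewrite big1 // => i _; case: asboolP => // fi; by case: no; exists i.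
Qed.
End Additivity.

Section Binomial.
Variables (R : realType) (T : finType) (n : nat).
Hypothesis (cardT : #|T| = (2 * n)%N).
Implicit Types (S : {set T}).
Let w : R := Num.sqrt n%:R.

Definition surplus S : R := #|S|%:R - n%:R.

Lemma surplus_zsum S : surplus S = zsum R setT S / 2.
Proof.
rewrite /surplus -{1}(setTI S) card_zsum cardsT cardT natrM.
by field.
Qed.

Lemma surplus_setC S : surplus (~: S) = - surplus S.
Proof. by rewrite !surplus_zsum zsum_setC mulNr. Qed.

Lemma pr_setC (P : {set T} -> Prop) : uniform_pr R (fun S => P (~: S)) = uniform_pr R P.
Proof. by apply: pr_inj; apply: setC_inj. Qed.

Lemma surplus_tail t : 0 < t ->
  uniform_pr R (fun S => t < `|surplus S|) <= n%:R / (2 * t ^+ 2).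
Proof.
move=> t0; apply: le_trans (chebyshev (f := surplus) (m := 0) t0 _) _.
  by move=> S; rewrite subr0; apply: ltW.
rewrite (eq_Ex (g := fun S => 4^-1 * zsum R setT S ^+ 2)); last first.
  by move=> S; rewrite subr0 surplus_zsum; field.
rewrite ExZ; have [-> _ _] := zsum_moments R [set: T].
rewrite cardsT cardT natrM le_eqVlt; apply/orP; left; apply/eqP; field.
by rewrite gt_eqF.
Qed.

(** By symmetry, half of the two-sided bound; [small_ball] and [interval_prob] use this gain. *)
Lemma surplus_tail1 t : 0 < t ->
  uniform_pr R (fun S => t < surplus S) <= n%:R / (4 * t ^+ 2).
Proof.
move=> t0; have h := surplus_tail t0.
have hs : uniform_pr R (fun S => t < - surplus S) = uniform_pr R (fun S => t < surplus S).
  by rewrite -pr_setC; congr uniform_pr; apply/funext => S; rewrite surplus_setC opprK.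
have : uniform_pr R (fun S => t < surplus S \/ t < - surplus S) <=
    uniform_pr R (fun S => t < `|surplus S|).
  apply: pr_mono => S [] lt; apply: lt_le_trans lt _; first exact: ler_norm.
  by rewrite -normrN; apply: ler_norm.
rewrite pr_add_disjoint ?hs; last by move=> S; lra.
have -> : n%:R / (4 * t ^+ 2) = n%:R / (2 * t ^+ 2) / 2 by field; rewrite gt_eqF.
lra.
Qed.

Lemma pr_card k : uniform_pr R (fun S => #|S| = k) = 'C(2 * n, k)%:R / 4 ^+ n.
Proof.
rewrite /uniform_pr -cardT -card_draws; congr (_%:R / _).
  apply: eq_card => S; rewrite !inE; apply/asboolP/eqP => //.
rewrite -cardsT -powersetT card_powerset cardsT cardT expnM natrX.
by [].
Qed.

Lemma pr_card_le k : (0 < n)%N -> uniform_pr R (fun S => #|S| = k) <= w^-1.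
Proof.
move=> n0; rewrite pr_card.
have w0 : 0 < w by rewrite sqrtr_gt0 ltr0n.
apply: (@le_trans _ _ ('C(2 * n, n)%:R / 4 ^+ n)).
  by rewrite ler_pM2r ?invr_gt0 ?exprn_gt0 // ler_nat bin_central_max.
rewrite ler_pdivrMr ?exprn_gt0 // mulrC -ler_pdivrMr ?invr_gt0 // invrK.
rewrite -(@ler_pXn2r _ 2%N) ?nnegrE ?mulr_ge0 ?ler0n ?exprn_ge0 ?sqrtr_ge0 //.
rewrite exprMn sqr_sqrtr ?ler0n //.
have -> : (4 ^+ n) ^+ 2 = 16%:R ^+ n :> R.
  by rewrite -exprM mulnC exprM; congr (_ ^+ _); ring.
have : ('C(2 * n, n) ^ 2 * n <= 16 ^ n)%N.
  apply: leq_trans (bin_central_sq n).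
  by rewrite leq_mul2l; apply/orP; right; lia.
by rewrite -(ler_nat R) natrM !natrX.
Qed.

Lemma pr_window (m : nat) (h : nat -> nat) : (0 < n)%N ->
  uniform_pr R (fun S => exists i : 'I_m, #|S| = h i) <= m%:R / w.
Proof.
move=> n0; apply: le_trans (pr_exists _ _) _.
rewrite mulr_natl -[X in _ *+ X]card_ord -sumr_const.
by apply: ler_sum => i _; apply: pr_card_le.
Qed.

Lemma pr_surplus_eq0 : (0 < n)%N -> uniform_pr R (fun S => surplus S = 0) <= w^-1.
Proof.
move=> n0; apply: le_trans (pr_card_le n n0); apply: pr_mono => S /eqP.
by rewrite subr_eq0 eqr_nat => /eqP.
Qed.

Lemma pr_surplus_sym : (0 < n)%N ->
  (1 - w^-1) / 2 <= uniform_pr R (fun S => surplus S < 0) /\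
  1 / 2 <= uniform_pr R (fun S => 0 <= surplus S).
Proof.
move=> n0.
have hs : uniform_pr R (fun S => 0 < surplus S) = uniform_pr R (fun S => surplus S < 0).
  by rewrite -pr_setC; congr uniform_pr; apply/funext => S; rewrite surplus_setC oppr_gt0.
have ge : uniform_pr R (fun S => surplus S < 0) <= uniform_pr R (fun S => 0 <= surplus S).
  by rewrite -hs; apply: pr_mono => S; apply: ltW.
have : uniform_pr R (fun S => surplus S < 0 \/ 0 <= surplus S) = 1.
  apply: pr_true; first exact: card_set_gt0.
  by move=> S; have [|] := ltP (surplus S) 0; [left|right].
rewrite pr_add_disjoint; last by move=> S; lra.
have : uniform_pr R (fun S => 0 <= surplus S) <=
    uniform_pr R (fun S => surplus S = 0) + uniform_pr R (fun S => 0 < surplus S).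
  rewrite -pr_add_disjoint; last by move=> S ->; rewrite ltxx.
  by apply: pr_mono => S; rewrite le_eqVlt => /orP[/eqP<-|]; [left|right].
have := pr_surplus_eq0 n0; rewrite hs; lra.
Qed.

(** The atoms decrease to the right of [n], so their mean over the first [m] is at least their mean
    over the first [W]. *)
Lemma central_window (m W : nat) : (m <= W)%N ->
  m%:R * uniform_pr R (fun S => exists i : 'I_W, #|S| = (n + i)%N) <=
  W%:R * uniform_pr R (fun S => exists i : 'I_m, #|S| = (n + i)%N).
Proof.
move=> mW; rewrite !(pr_exists_ord _ _ _ (@addnI n)).
pose g i := uniform_pr R (fun S => #|S| = (n + i)%N); rewrite -![\sum_(i < _) _]/(\sum_(i < _) g i).
have gdec i j : (i <= j)%N -> g j <= g i.
  elim: j => [|j IH]; first by rewrite leqn0 => /eqP->.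
  rewrite leq_eqVlt => /orP[/eqP->//|]; rewrite ltnS => /IH; apply: le_trans.
  rewrite /g !pr_card ler_pM2r ?invr_gt0 ?exprn_gt0 // ler_nat addnS.
  by apply: bin_succ_ge; lia.
rewrite -!(big_mkord predT g) (big_cat_nat (n := m)) //= mulrDr.
have -> : W%:R = m%:R + (W - m)%:R :> R by rewrite -natrD subnKC.
rewrite mulrDl lerD2l.
case: m mW => [|m] mW; first by rewrite mul0r big_geq ?mulr0.
apply: (@le_trans _ _ (m.+1%:R * ((W - m.+1)%:R * g m))).
  rewrite ler_pM2l ?ltr0n // mulr_natl -sumr_const_nat.
  by rewrite !big_nat; apply: ler_sum => i /andP[mi _]; apply: gdec; apply: ltnW.
rewrite mulrCA ler_wpM2l ?ler0n // mulr_natl -[X in _ *+ X]subn0 -sumr_const_nat.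
by rewrite !big_nat; apply: ler_sum => i /andP[_ mi]; apply: gdec.
Qed.

(** The interval from 0 to [w] has mass at least 1/2 - 1/4 by the one-sided tail bound, and
    unimodality gives [[0, J]] its proportional share. *)
Lemma small_ball (J : R) : (0 < n)%N -> 0 <= J <= w ->
  J / (4 * (w + 1)) <= uniform_pr R (fun S => 0 <= surplus S <= J).
Proof.
move=> n0 /andP[J0 Jw].
have w0 : 0 < w by rewrite sqrtr_gt0 ltr0n.
have w2 : w ^+ 2 = n%:R by rewrite sqr_sqrtr ?ler0n.
pose m := (Num.truncn J).+1; pose W := (Num.truncn w).+1.
have mW : (m <= W)%N.
  rewrite ltnS truncn_ge_nat ?sqrtr_ge0 //.
  by apply: le_trans Jw; case/andP: (truncn_itv J0).
have hW : 4^-1 <= uniform_pr R (fun S => exists i : 'I_W, #|S| = (n + i)%N).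
  have [_ half] := pr_surplus_sym n0.
  have tl := surplus_tail1 w0.
  have e : n%:R / (4 * w ^+ 2) = 4^-1 :> R.
    by rewrite w2; field; rewrite pnatr_eq0 -lt0n.
  have : uniform_pr R (fun S => 0 <= surplus S) - uniform_pr R (fun S => w < surplus S) <=
     uniform_pr R (fun S => exists i : 'I_W, #|S| = (n + i)%N).
    apply: pr_diff => S s0; have [sw|] := leP (surplus S) w; last by right.
    left; have nS : (n <= #|S|)%N by rewrite -(ler_nat R) -subr_ge0.
    have iW : (#|S| - n < W)%N.
      rewrite -(ltr_nat R) natrB //; apply: le_lt_trans sw _; exact: truncnS_gt.
    by exists (Ordinal iW) => /=; rewrite subnKC.
  rewrite e in tl; lra.
have hm : uniform_pr R (fun S => exists i : 'I_m, #|S| = (n + i)%N) <=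
    uniform_pr R (fun S => 0 <= surplus S <= J).
  apply: pr_mono => S [i Si]; rewrite /surplus Si natrD addrC addKr ler0n /=.
  have /andP[tJ _] := truncn_itv J0; apply: le_trans tJ.
  by rewrite ler_nat -ltnS.
have := central_window mW.
have m1 : J <= m%:R by apply/ltW/truncnS_gt.
have W1 : W%:R <= w + 1.
  by rewrite /W -natr1 lerD2r; case/andP: (truncn_itv (ltW w0)).
have W0 : 0 < W%:R :> R by rewrite ltr0n.
set pm := uniform_pr R _ in hm *; set pW := uniform_pr R _ in hW *.
move=> h; apply: le_trans hm; rewrite ler_pdivrMr ?mulr_gt0 ?addr_gt0 //.
have pm0 : 0 <= pm by apply: pr_ge0.
by nra.
Qed.

Lemma negative_window (x : R) : (0 < n)%N -> 0 <= x ->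
  uniform_pr R (fun S => - x < surplus S < 0) <= (x + 1) / w.
Proof.
move=> n0 x0; have w0 : 0 < w by rewrite sqrtr_gt0 ltr0n.
apply: le_trans (_ : (Num.truncn x).+1%:R / w <= _); last first.
  by rewrite ler_pM2r ?invr_gt0 // -natr1 lerD2r; case/andP: (truncn_itv x0).
apply: le_trans (pr_window _ (fun k => n - k.+1)%N n0).
apply: pr_mono => S /andP[xS S0].
have Sn : (#|S| < n)%N by rewrite -(ltr_nat R) -subr_lt0.
have iW : (n - #|S| - 1 < (Num.truncn x).+1)%N.
  apply: (@leq_ltn_trans (n - #|S|)%N); first exact: leq_subr.
  rewrite -(ltr_nat R) natrB 1?ltnW //; apply: lt_trans (truncnS_gt x).
  by rewrite -opprB ltrNl.
by exists (Ordinal iW) => /=; lia.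
Qed.

Lemma negative_part (I : R) : (0 < n)%N -> 0 < I ->
  1 / 2 - w^-1 / 2 - n%:R / (4 * I ^+ 2) <= uniform_pr R (fun S => - I <= surplus S < 0).
Proof.
move=> n0 I0; have [half _] := pr_surplus_sym n0.
have tl := surplus_tail1 I0.
have hs : uniform_pr R (fun S => I < - surplus S) = uniform_pr R (fun S => I < surplus S).
  by rewrite -pr_setC; congr uniform_pr; apply/funext => S; rewrite surplus_setC opprK.
have : uniform_pr R (fun S => surplus S < 0) - uniform_pr R (fun S => I < - surplus S) <=
    uniform_pr R (fun S => - I <= surplus S < 0).
  apply: pr_diff => S ->; rewrite andbT lerNl.
  by have [|] := leP (- surplus S) I; [left|right].
rewrite hs; lra.
Qed.

(** For [J >= 0] the mass of [[0, J]] is gained; for [- x <= J < 0] at most [(x + 1) / w] is lost.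
    One formula serves both, as the term with [Num.min] is negative in the second case. *)
Lemma interval_prob_aux (I J x : R) : (0 < n)%N -> 0 < I -> 0 <= x -> - x <= J ->
  1 / 2 - w^-1 / 2 - n%:R / (4 * I ^+ 2) + Num.min J w / (4 * (w + 1)) - (x + 1) / w <=
  uniform_pr R (fun S => - I <= surplus S <= J).
Proof.
move=> n0 I0 x0 xJ; have w0 : 0 < w by rewrite sqrtr_gt0 ltr0n.
have hI := negative_part n0 I0.
have [J0|J0] := ltP J 0.
  have hx := negative_window n0 x0.
  have m0 : Num.min J w / (4 * (w + 1)) <= 0.
    rewrite pmulr_lle0 ?invr_gt0 ?mulr_gt0 ?addr_gt0 //.
    by rewrite ge_min (ltW J0).
  have : uniform_pr R (fun S => - I <= surplus S < 0) - uniform_pr R (fun S => - x < surplus S < 0)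
     <= uniform_pr R (fun S => - I <= surplus S <= J).
    apply: pr_diff => S /andP[-> ->] /=.
    by have [|lt] := leP (surplus S) J; [left|right; rewrite (le_lt_trans xJ lt)].
  lra.
have hJ : Num.min J w / (4 * (w + 1)) <= uniform_pr R (fun S => 0 <= surplus S <= Num.min J w).
  by apply: small_ball => //; rewrite ge_min lexx orbT andbT le_min J0 (ltW w0).
have x1 : 0 <= (x + 1) / w by rewrite divr_ge0 ?addr_ge0 // ltW.
have : uniform_pr R (fun S => - I <= surplus S < 0 \/ 0 <= surplus S <= Num.min J w) <=
    uniform_pr R (fun S => - I <= surplus S <= J).
  apply: pr_mono => S [/andP[-> lt]|/andP[ge]]; first by rewrite (le_trans (ltW lt)).
  rewrite le_min => /andP[-> _]; rewrite andbT; apply: le_trans ge; lra.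
rewrite pr_add_disjoint; last by move=> S /andP[_ lt] /andP[ge _]; move: (le_lt_trans ge lt); rewrite ltxx.
lra.
Qed.

End Binomial.

Lemma eventually_sqrt_ge (R : realType) (K : R) :
  exists n0 : nat, forall n, (n0 <= n)%N -> K <= Num.sqrt n%:R.
Proof.
exists (Num.truncn (K ^+ 2)).+1 => n nn.
apply: le_trans (ler_norm K) _; rewrite -sqrtr_sqr ler_wsqrtr //.
by apply: le_trans (ltW (truncnS_gt _)) _; rewrite ler_nat.
Qed.

(* For J <= I the tail beyond -I costs at most n / (4 I^2) by Chebyshev, while by
   unimodality [0, J] has mass at least about J / (4 sqrt n), which is as much. *)
Lemma interval_prob (R : realType) (theta : R) : 0 < theta ->
  exists g : R, 0 < g <= 16^-1 /\ exists n0 : nat, forall (n : nat) (T : finType) (I J : R),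
    (n0 <= n)%N -> #|T| = (2 * n)%N -> 0 < I + 1 -> 0 < J + 1 ->
    (1 - g) * n%:R <= (I + 1) * (J + 1) ->
    1 / 2 - theta <= uniform_pr R (fun S : {set T} =>
      - I + g * Num.sqrt n%:R <= surplus R n S <= J - g * Num.sqrt n%:R).
Proof.
move=> th0; pose g := Num.min 16^-1 (theta / 20).
have g0 : 0 < g by rewrite lt_min; apply/andP; split; lra.
have g16 : g <= 16^-1 by rewrite ge_min lexx.
have gth : 20 * g <= theta.
  have : g <= theta / 20 by rewrite ge_min lexx orbT.
  by lra.
exists g; split; first by rewrite g0.
have [n0 hn0] := eventually_sqrt_ge (2 / g).
exists n0.+1 => n T I J nn cT I1 J1 IJ.
have n_gt0 : (0 < n)%N by apply: leq_trans nn.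
pose w : R := Num.sqrt n%:R.
have wg : 2 / g <= w by apply/hn0/ltnW.
have w2 : w * w = n%:R by rewrite -expr2 sqr_sqrtr ?ler0n.
have w0 : 0 < w by rewrite sqrtr_gt0 ltr0n.
(* Complementation reverses the interval. *)
wlog le : I J I1 J1 IJ / J <= I.
  move=> H; have [|/ltW JI] := leP J I; first exact: H.
  have IJ' : (1 - g) * n%:R <= (J + 1) * (I + 1) by rewrite [(J + 1) * _]mulrC.
  apply: le_trans (H J I J1 I1 IJ' JI) _; rewrite -pr_setC; apply: pr_mono => S.
  by rewrite (surplus_setC R cT) => /andP[h1 h2]; apply/andP; split; lra.
have n_0 : (n%:R : R) = w * w by [].
(* In these units the hypothesis is [1 - g <= a * b], and [b <= a] makes [a] at least [1 - g]. *)
pose a := (I + 1) / w; pose b := (J + 1) / w.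
have Ia : I = a * w - 1 by rewrite /a divfK ?gt_eqF // addrK.
have Jb : J = b * w - 1 by rewrite /b divfK ?gt_eqF // addrK.
have a0 : 0 < a by rewrite divr_gt0.
have b0 : 0 < b by rewrite divr_gt0.
have ba : b <= a by rewrite ler_pM2r ?invr_gt0 // lerD2r.
have ab : 1 - g <= a * b.
  rewrite -(@ler_pM2r _ (w * w)) ?mulr_gt0 // -n_0; apply: le_trans IJ _.
  by rewrite Ia Jb n_0 le_eqVlt; apply/orP; left; apply/eqP; ring.
have gw : 2 <= g * w by rewrite mulrC -ler_pdivrMr.
have a1 : 1 - g <= a by nra.
pose u := w^-1.
have u0 : 0 < u by rewrite invr_gt0.
have wu : w * u = 1 by rewrite mulfV // gt_eqF.
have u1 : u <= g / 2 by nra.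
pose c := a - u - g.
have c1 : a - 3 / 2 * g <= c by rewrite /c; lra.
have c0 : 3 / 4 <= c by lra.
pose I' := I - g * w; pose J' := J - g * w.
have I'c : I' = c * w by rewrite /I' Ia /c mulrBl mulrBl [u * w]mulrC wu.
have I'0 : 0 < I' by rewrite I'c mulr_gt0 //; lra.
(* The shrunken end [J'] can be negative, but since [J > -1] not below [- (1 + g * w)]. *)
have x0 : 0 <= 1 + g * w by lra.
have xJ : - (1 + g * w) <= J' by rewrite /J'; lra.
apply: (@le_trans _ _ (uniform_pr R (fun S : {set T} => - I' <= surplus R n S <= J'))); last first.
  by apply: pr_mono => S; rewrite /I' opprB [g * w - I]addrC.
apply: (le_trans _ (interval_prob_aux cT n_gt0 I'0 x0 xJ)); rewrite -/w -/u.
have e1 : n%:R / (4 * I' ^+ 2) = (4 * c ^+ 2)^-1.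
  by rewrite I'c n_0; field; rewrite !gt_eqF //; lra.
have e2 : (1 + g * w + 1) * u <= 2 * g.
  have -> : (1 + g * w + 1) * u = 2 * u + g * (w * u) by ring.
  by rewrite wu; lra.
pose z := Num.min (b - 3 / 2 * g) 1.
have e3 : (z - g / 2) / 4 <= Num.min J' w / (4 * (w + 1)).
  rewrite ler_pdivlMr ?mulr_gt0 ?addr_gt0 //.
  have -> : (z - g / 2) / 4 * (4 * (w + 1)) = z * w + (z - (g * w) / 2 - g / 2) by field.
  have z1 : z <= 1 by rewrite ge_min lexx orbT.
  have zb : z <= b - 3 / 2 * g by rewrite ge_min lexx.
  rewrite le_min; apply/andP; split; last by nra.
  by rewrite /J' Jb; nra.
(* Up to terms in [g] this says [1 / a ^ 2 <= min b 1], which follows from [a * b >= 1] and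
   [a >= 1]. *)
have e4 : (4 * c ^+ 2)^-1 <= (z + 12 * g) / 4.
  have zc : 1 <= (z + 12 * g) * c ^+ 2.
    have c2 : 9 / 16 <= c ^+ 2 by nra.
    rewrite /z minElt; case: ifP => _; last by nra.
    have : 1 - 5 * g <= b * c ^+ 2.
      have [bb|bb] := leP 1 b; first by nra.
      have : (a - 3 / 2 * g) ^+ 2 <= c ^+ 2 by nra.
      have : 1 - 5 * g <= b * (a - 3 / 2 * g) ^+ 2 by nra.
      by nra.
    by nra.
  have cp : 0 < c ^+ 2 by rewrite exprn_gt0 //; lra.
  by rewrite invfM mulrC ler_pM2r ?invr_gt0 // -[c ^- 2]mul1r ler_pdivrMr.
by rewrite e1; lra.
Qed.

(** * Graphs far from both extremal structures *)

Section Stability.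
Variables (R : realType) (T : finType).
Implicit Types (A B S X : {set T}).

Lemma card_setD_le A B : (#|A|%:R : R) - #|B|%:R <= #|A :\: B|%:R.
Proof.
rewrite lerBlDr -natrD ler_nat addnC -(cardsID B A) leq_add2r.
by apply: subset_leq_card; apply: subsetIr.
Qed.

(* Closure argument: in an edge-maximal non-Hamiltonian extension e' of e on S the
   high-degree vertices L form a clique and the set U of vertices of e'-degree at
   least N/2 + 2E is joined to everything.  If U is small then L is nearly a
   component of e; otherwise the rest W of S has almost all its e-edges to U. *)
Lemma closure_stability (e : rel T) S (N E D : R) :
  symmetric e -> irreflexive e -> ~ ham e S -> 1 <= E -> 6 * E <= D -> 8 * D <= N ->
  `|#|S|%:R - N| <= E ->
  (forall v, `|#|nbh e v :&: S|%:R - N / 2| <= E) ->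
  N / 2 - E <= #|[set v in S | (#|S| <= 2 * #|nbh e v :&: S|)%N]|%:R ->
  let k := N / 2 - (9 * E + D + 3 * E * N / D + 2) in
  exists2 x, x \in S &
    k <= #|[set y in S | (y \in nbh e x) && (k <= #|nbh e x :&: nbh e y :&: S|%:R)]|%:R \/
    k <= #|[set y in S | (y \notin nbh e x) && (k <= #|nbh e x :&: nbh e y :&: S|%:R)]|%:R.
Proof.
move=> es ei nh E1 ED DN mN dN LN k.
have S2 : (2 < #|S|)%N.
  rewrite -(ltr_nat R); move: mN; rewrite ler_norml => /andP[h _]; lra.
have [e' [e's e'i see' low [u0 [v0 [u0S v0S uv0 nuv0]]]]] := nonham_pair es ei S2 nh.
pose d' v : R := #|nbh e' v :&: S|%:R.
have lowR u v : u \in S -> v \in S -> u != v -> ~~ e' u v -> d' v + d' u + 1 <= #|S|%:R.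
  by move=> uS vS uv nuv; rewrite /d' -!natrD natr1 ler_nat low.
have mle : #|S|%:R <= N + E by move: mN; rewrite ler_norml; lra.
have mge : N - E <= #|S|%:R by move: mN; rewrite ler_norml; lra.
have dle v : #|nbh e v :&: S|%:R <= N / 2 + E by move: (dN v); rewrite ler_norml; lra.
have dge v : N / 2 - E <= #|nbh e v :&: S|%:R by move: (dN v); rewrite ler_norml; lra.
have sub_nb v : nbh e v :&: S \subset nbh e' v :&: S.
  by apply: setSI; apply/subsetP => y; rewrite !inE => /see'.
have dd' v : #|nbh e v :&: S|%:R <= d' v by rewrite ler_nat; apply: subset_leq_card.
pose U := [set v in S | N / 2 + 2 * E <= d' v].
pose W := S :\: U.
pose L := [set v in S | (#|S| <= 2 * #|nbh e v :&: S|)%N].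
have US : U \subset S by apply/subsetP => v; rewrite inE => /andP[].
have univ u v : u \in U -> v \in S -> u != v -> e' u v.
  rewrite inE => /andP[uS du] vS uv; apply: contraT => nuv.
  have := lowR u v uS vS uv nuv; have := dge v; have := dd' v; lra.
have clique u v : u \in L -> v \in L -> u != v -> e' u v.
  rewrite !inE => /andP[uS du] /andP[vS dv] uv; apply: contraT => nuv.
  have := lowR u v uS vS uv nuv; have := dd' v; have := dd' u.
  move: du dv; rewrite -!(ler_nat R) !natrM; lra.
have WP w : w \in W -> w \in S /\ d' w < N / 2 + 2 * E.
  by rewrite !inE => /andP[nU wS]; move: nU; rewrite wS /= -ltNge.
(* A vertex of [W] has gained at most [3 * E] neighbours in passing to the closure. *)
have diff w (X : {set T}) : w \in W -> X \subset nbh e' w :&: S ->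
    #|X :\: nbh e w|%:R <= 3 * E.
  move=> wW XS; have [wS d'w] := WP w wW.
  have : (#|X :\: nbh e w| + #|nbh e w :&: S| <= #|nbh e' w :&: S|)%N.
    rewrite -cardsUI [X in (_ + X)%N](_ : _ = 0%N) ?addn0; last first.
      by apply/eqP; rewrite cards_eq0 -subset0; apply/subsetP => y; rewrite !inE; case: (e w y); rewrite ?andbF.
    apply: subset_leq_card; rewrite subUset sub_nb andbT.
    by apply: subset_trans XS; apply: subsetDl.
  rewrite -(ler_nat R) natrD -/(d' w); have := dge w; lra.
have v0W : v0 \in W.
  rewrite in_setD v0S andbT; apply/negP => v0U.
  have := univ v0 u0 v0U u0S; rewrite eq_sym => /(_ uv0).
  by rewrite e's (negPf nuv0).
have UW w : w \in W -> U \subset nbh e' w :&: S.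
  move=> wW; have [wS _] := WP w wW; apply/subsetP => u uU.
  rewrite !inE (subsetP US u uU) andbT e's univ //.
  by apply: contraTneq uU => ->; move: wW; rewrite inE => /andP[].
have Ule : #|U|%:R <= N / 2 + 2 * E.
  have [_ /ltW] := WP v0 v0W; apply: le_trans; rewrite ler_nat.
  exact/subset_leq_card/UW.
have cU : #|U|%:R + #|W|%:R = #|S|%:R :> R.
  by rewrite -natrD -(cardsID U S) (setIidPr US).
have N0 : 0 < N by lra.
have D0 : 0 < D by lra.
have EN0 : 0 <= 3 * E * N / D by rewrite divr_ge0 ?mulr_ge0; lra.
have codeg x y (X : {set T}) c c' : X \subset S -> #|X :\: nbh e x|%:R <= c ->
    #|X :\: nbh e y|%:R <= c' -> #|X|%:R - (c + c') <= #|nbh e x :&: nbh e y :&: S|%:R :> R.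
  move=> XS cx cy.
  have : (#|X| <= #|X :\: nbh e x| + #|X :\: nbh e y| + #|nbh e x :&: nbh e y :&: S|)%N.
    apply: leq_trans (leq_add (leq_card_setU _ _) (leqnn _)).
    apply: leq_trans (leq_card_setU _ _); apply: subset_leq_card.
    apply/subsetP => z zX; rewrite !inE zX (subsetP XS z zX).
    by case: (e x z); case: (e y z).
  rewrite -(ler_nat R) !natrD; lra.
have [UD|UD] := ltP #|U|%:R D; last first.
  have Wdeg w : w \in W -> #|U|%:R - 3 * E <= #|nbh e w :&: U|%:R :> R.
    move=> wW; have := diff w U wW (UW w wW).
    have : (#|U| = #|nbh e w :&: U| + #|U :\: nbh e w|)%N by rewrite -(cardsID (nbh e w) U) setIC.
    move/(congr1 (fun i => i%:R : R)); rewrite natrD; lra.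
  (* Counting the [e]-edges between [W] and [U] from both ends shows that [U] has almost half of the
     vertices. *)
  have dc : #|W|%:R * (#|U|%:R - 3 * E) <= #|U|%:R * (N / 2 + E).
    apply: (@le_trans _ _ (\sum_(w in W) #|nbh e w :&: U|%:R)).
      by rewrite mulr_natl -sumr_const; apply: ler_sum => w /Wdeg.
    rewrite -natr_sum double_count // natr_sum mulr_natl -sumr_const.
    apply: ler_sum => u uU; apply: le_trans (dle u); rewrite ler_nat.
    by apply: subset_leq_card; apply: setIS; apply: subsetDl.
  have Uge : N / 2 - (2 * E + 3 * E * N / D) <= #|U|%:R.
    set q := 3 * E * N / D in EN0 *.
    have qD : q * D = 3 * E * N by rewrite /q divfK // gt_eqF.
    set u : R := #|U|%:R in UD dc Ule cU *; set v : R := #|W|%:R in dc cU.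
    have [//|lt] := leP (N / 2 - (2 * E + q)) u.
    have : q * u <= 3 * E * N.
      have v1 : N / 2 + q + E < v by lra.
      have : (N / 2 + q + E) * (u - 3 * E) <= u * (N / 2 + E).
        by apply: le_trans dc; rewrite ler_wpM2r; lra.
      by nra.
    by nra.
  (* The vertices of [W] not adjacent to [v0] have almost all of [U] as common neighbours with
     [v0]. *)
  exists v0 => //; right; apply: (@le_trans _ _ #|W :\: nbh e v0|%:R).
    have := card_setD_le W (nbh e v0 :&: W).
    have -> : W :\: (nbh e v0 :&: W) = W :\: nbh e v0.
      by rewrite setIC setDIr setDv set0U.
    have : (#|nbh e v0 :&: U| + #|nbh e v0 :&: W| <= #|nbh e v0 :&: S|)%N.
      rewrite -cardsUI -setIUr (_ : U :|: W = S); last by rewrite -(setID S U) (setIidPr US).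
      rewrite (_ : _ :&: _ :&: (_ :&: _) = set0) ?cards0 ?addn0 //.
      apply/setP => y; rewrite !in_setI in_setD in_set0.
      by case: (y \in U); rewrite /= ?andbF.
    rewrite -(ler_nat R) natrD; have := Wdeg v0 v0W; have := dle v0; rewrite /k; lra.
  rewrite ler_nat; apply: subset_leq_card; apply/subsetP => w; rewrite in_setD => /andP[nw wW].
  rewrite inE nw /=; have [-> _] := WP w wW; rewrite /=.
  have := codeg v0 w U _ _ US (diff _ _ v0W (UW _ v0W)) (diff _ _ wW (UW _ wW)).
  by apply: le_trans; rewrite /k; lra.
(* With [U] small, most vertices of [L] lie in [W]; being joined to all of [L] in the closure, they
   are joined to almost all of it in [e]. *)
have LS : L \subset S by apply/subsetP => v; rewrite inE => /andP[].
have LU : N / 2 - E - D <= #|L :\: U|%:R.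
  by have := card_setD_le L U; rewrite -/L in LN; lra.
have [x xLU] : exists x, x \in L :\: U.
  by apply/card_gt0P; rewrite -(ltr_nat R); lra.
have ldiff y : y \in L :\: U -> #|L :\: nbh e y|%:R <= 3 * E + 1.
  move=> yLU; move: (yLU); rewrite in_setD => /andP[nyU yL].
  have yW : y \in W by rewrite in_setD nyU (subsetP LS).
  have : #|(L :\ y) :\: nbh e y|%:R <= 3 * E.
    apply: diff yW _; apply/subsetP => z /setD1P[zy zL].
    by rewrite !inE (subsetP LS) // andbT clique // eq_sym.
  have : (#|L :\: nbh e y| <= #|(L :\ y) :\: nbh e y| + 1)%N.
    rewrite -(cards1 y); apply: leq_trans (leq_card_setU _ _); apply: subset_leq_card.
    by apply/subsetP => z; rewrite !inE => /andP[-> ->]; case: (z == y).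
  rewrite -(ler_nat R) natrD; lra.
exists x; first by move: xLU; rewrite in_setD => /andP[_ /(subsetP LS)].
left; apply: (@le_trans _ _ #|(L :\: U) :&: nbh e x|%:R).
  have : (#|L :\: U| <= #|(L :\: U) :&: nbh e x| + #|L :\: nbh e x|)%N.
    rewrite -(cardsID (nbh e x) (L :\: U)) leq_add2l; apply: subset_leq_card.
    by apply: setSD; apply: subsetDl.
  rewrite -(ler_nat R) natrD; have := ldiff x xLU; rewrite /k; lra.
rewrite ler_nat; apply: subset_leq_card; apply/subsetP => y; rewrite in_setI => /andP[yLU nxy].
rewrite inE nxy; move: (yLU); rewrite in_setD => /andP[_ /(subsetP LS)->] /=.
have := codeg x y L _ _ LS (ldiff x xLU) (ldiff y yLU); apply: le_trans.
by rewrite -/L in LN; rewrite /k; lra.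
Qed.
End Stability.

(** * Vertices of at least half degree into a random set *)

Section LargeSide.
Variables (R : realType) (T : finType) (n : nat) (e : rel T).
Hypotheses (cardT : #|T| = (2 * n)%N) (n0 : (0 < n)%N).
Implicit Types (S : {set T}) (u v x : T).
Let w : R := Num.sqrt n%:R.

Definition heavy S : {set T} := [set v | (#|S| <= 2 * #|nbh e v :&: S|)%N].

(** A toggle changes [#|S| - 2 * #|nbh e x :&: S|] by exactly one; heaviness of [x] can only change
    from the values 0 and 1. *)
Definition marginal x S := (#|S| == 2 * #|nbh e x :&: S|)%N || (#|S| == (2 * #|nbh e x :&: S|).+1)%N.

(** Up to sign and a constant, [#|S| - 2 * #|nbh e x :&: S|] is the size of the symmetric difference
    of [S] with the set [X] of non-neighbours, so each marginal value is one binomial atom. *)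
Lemma pr_marginal x : uniform_pr R (fun S => marginal x S) <= 2 / w.
Proof.
pose X := ~: nbh e x.
have h j : uniform_pr R (fun S => #|S| = (2 * #|nbh e x :&: S| + j)%N) <= w^-1.
  apply: (le_trans _ (pr_card_le R cardT (#|X| - j) n0)).
  rewrite -[leRHS](pr_inj _ _ (inv_inj (@symdiffK _ X))); apply: pr_mono => S.
  have := card_symdiff X S; have := cardsID X S.
  have -> : S :\: X = nbh e x :&: S by apply/setP => y; rewrite !inE negbK andbC.
  move: #|S| #|symdiff X S| #|S :&: X| #|X| #|nbh e x :&: S| => a b c d f h1 h2 h3.
  by lia.
have -> : 2 / w = w^-1 + w^-1 by rewrite mulrDl mul1r.
apply: le_trans (le_trans (pr_or _ _ _) (lerD (h 0%N) (h 1%N))).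
by apply: pr_mono => S /orP[]/eqP h'; [left|right]; rewrite ?addn0 ?addn1.
Qed.

Lemma heavy_toggle u v S : ~~ marginal v S -> (v \in heavy (toggle u S)) = (v \in heavy S).
Proof.
rewrite /marginal !inE; have := card_toggle (nbh e v) u S; have := card_toggle setT u S.
rewrite !setTI inE andbT.
by case: (u \in S); case: (u \in nbh e v) => /= h1 h2 /norP[/eqP h3 /eqP h4]; apply/idP/idP; lia.
Qed.

(** The set [heavy S] depends on [S], so the moments for fixed sets do not apply. Toggling [u]
    cancels the product for [u] and [v] unless [u] or [v] is marginal, an event of probability of
    order [1 / w]. *)
Lemma Ex_heavy_sq :
  Ex (fun S => zsum R (heavy S) S ^+ 2) <= (2 * n)%:R + (2 * n)%:R ^+ 2 * (2 / w).
Proof.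
pose h v S : R := (v \in heavy S)%:R * sgn R v S.
have zE S : zsum R (heavy S) S = \sum_v h v S.
  by rewrite /zsum big_mkcond; apply: eq_bigr => v _; rewrite /h; case: (v \in _); rewrite ?mul1r ?mul0r.
have -> : Ex (fun S => zsum R (heavy S) S ^+ 2) = \sum_u \sum_v Ex (fun S => h u S * h v S).
  rewrite (eq_Ex (g := fun S => \sum_u \sum_v h u S * h v S)).
    by rewrite Ex_sum; apply: eq_bigr => u _; rewrite Ex_sum.
  move=> S; rewrite zE expr2 mulr_suml; apply: eq_bigr => u _.
  by rewrite mulr_sumr.
have bnd u v : Ex (fun S => h u S * h v S) <= (u == v)%:R + 2 / w.
  have w0 : 0 <= 2 / w :> R by rewrite divr_ge0 // sqrtr_ge0.
  have [<-|uv] := eqVneq u v.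
    apply: (@le_trans _ _ 1); last by rewrite mulr1n lerDl.
    rewrite -[leRHS](Ex_cst (1 : R) (card_set_gt0 T)); apply: ler_Ex => S; rewrite /h; case: (u \in _); rewrite ?mul0r ?ler01 // !mul1r.
    by rewrite sgn_sq.
  rewrite add0r.
  pose f S := h u S * h v S.
  have e2 : Ex f = Ex (fun S => f (toggle u S)) by rewrite (Ex_inj f (inv_inj (@toggleK _ u))).
  have : Ex (fun S => f S + f (toggle u S)) <=
      uniform_pr R (fun S => marginal u S) + uniform_pr R (fun S => marginal v S).
    rewrite !uniform_prE -ExD; apply: ler_Ex => S; rewrite !asboolb.
    rewrite /f /h sgn_toggle sgn_toggle_neq 1?eq_sym //.
    have [mu|mu] := boolP (marginal u S); have [mv|mv] := boolP (marginal v S); last first.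
    - by rewrite !heavy_toggle //=; lra.
    - rewrite (heavy_toggle u mu) /sgn; case: (u \in heavy S); case: (v \in heavy S); case: (v \in heavy _); case: (u \in S); case: (v \in S) => /=; lra.
    - rewrite (heavy_toggle u mv) /sgn; case: (u \in heavy S); case: (v \in heavy S); case: (u \in heavy _); case: (u \in S); case: (v \in S) => /=; lra.
    - rewrite /sgn; case: (u \in heavy S); case: (v \in heavy S); case: (u \in heavy _); case: (v \in heavy _); case: (u \in S); case: (v \in S) => /=; lra.
  rewrite ExD -e2; have := pr_marginal u; have := pr_marginal v; lra.
apply: le_trans (_ : \sum_(u : T) \sum_(v : T) ((u == v)%:R + 2 / w) <= _).
  by apply: ler_sum => u _; apply: ler_sum => v _.
rewrite (eq_bigr (fun=> 1 + (2 * n)%:R * (2 / w))); last first.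
  move=> u _; rewrite big_split /= (bigD1 u) //= eqxx big1 ?addr0; last first.
    by move=> v; rewrite eq_sym => /negPf->.
  by rewrite sumr_const -[(2 / w) *+ _]mulr_natl; congr (_ + _%:R * _).
rewrite sumr_const -[leLHS]mulr_natl (_ : #|_| = (2 * n)%N) //.
set c : R := (2 * n)%:R; set z := 2 / w.
rewrite le_eqVlt; apply/orP; left; apply/eqP; ring.
Qed.

(** The degrees of [v] into [S] and its complement sum to [n.+1], the half sizes only to [n]. *)
Lemma heavy_setC (reg : forall x, #|nbh e x| = n.+1) S :
  (2 * n <= #|heavy S| + #|heavy (~: S)|)%N.
Proof.
rewrite -cardT -cardsT; apply: leq_trans (leq_card_setU _ _); apply: subset_leq_card.
apply/subsetP => v _; rewrite !inE.
have := cardsC S; have := cardsID S (nbh e v); rewrite cardT reg.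
by rewrite setDE; case: leqP => //=; lia.
Qed.

End LargeSide.

(** * The generic case *)

Section NonExtremal.
Variables (R : realType).

(** Both structures are detected from one vertex [x] by sets that do not depend on [S], so that a
    union bound over order [n ^ 2] sets suffices. *)
Definition clique_like (T : finType) (e : rel T) (n : nat) (eta : R) (x : T) : {set T} :=
  [set y | (y \in nbh e x) && ((1 - eta) * n%:R <= #|nbh e x :&: nbh e y|%:R)].
Definition bip_like (T : finType) (e : rel T) (n : nat) (eta : R) (x : T) : {set T} :=
  [set y | (y \notin nbh e x) && ((1 - eta) * n%:R <= #|nbh e x :&: nbh e y|%:R)].

Lemma eventually_ge (K : R) : exists n0 : nat, forall n, (n0 <= n)%N -> K <= n%:R.
Proof.
exists (Num.truncn K).+1 => n nn.
by apply: le_trans (ltW (truncnS_gt _)) _; rewrite ler_nat.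
Qed.

(** [eps] is quadratic in [eta] because the error term [3 * E * N / D], of order [eps / eta * N],
    has to stay below [eta * N]. *)
Lemma nonextremal_numerics (eta eps N : R) : 0 < eta -> eta <= 1 ->
  eps = eta ^+ 2 / 1000 -> 0 < N -> 8 / eta <= N ->
  let E := eps * N in let D := eta / 8 * N in
  [/\ 6 * E <= D, 8 * D <= N &
    (1 - eta) * N + E <= 2 * (N / 2 - (9 * E + D + 3 * E * N / D + 2))].
Proof.
move=> eta0 eta1 -> N0 nE E D.
have ede : eta * eta <= eta by rewrite ler_piMl // ltW.
have eN0 : 0 < eta * N by rewrite mulr_gt0.
have eN1 : eta * N <= N by rewrite ler_piMl // ltW.
have eN : 8 <= eta * N by rewrite mulrC -ler_pdivrMr.
have EeN : E <= eta * N / 1000.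
  have -> : E = eta * eta * N / 1000 by rewrite /E; ring.
  by rewrite ler_pM2r ?invr_gt0 ?ltr0n // ler_pM2r.
have DE : D = eta * N / 8 by rewrite /D; ring.
have -> : 3 * E * N / D = 24 / 1000 * (eta * N).
  by rewrite /E /D; field; rewrite !gt_eqF.
by rewrite DE; split; lra.
Qed.

Definition atypical (T : finType) (I : finType) (U : I -> {set T}) (E : R) (S : {set T}) :=
  exists i, E <= `|zsum R (U i) S|.

Lemma typical_dev (T I : finType) (U : I -> {set T}) (E : R) S : ~ atypical U E S ->
  forall i, (#|U i|%:R - E) / 2 <= #|U i :&: S|%:R <= (#|U i|%:R + E) / 2.
Proof.
move=> nb i; rewrite card_zsum.
have : `|zsum R (U i) S| <= E.
  by apply/ltW; rewrite ltNge; apply/negP => h; apply: nb; exists i.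
by rewrite ler_norml => /andP[h1 h2]; apply/andP; split; rewrite ler_pM2r ?invr_gt0 ?ltr0n // lerD2l.
Qed.

(** [16 * n ^ 2] is the number of indices of [probe]. *)
Lemma pr_atypical (eps theta : R) : 0 < eps -> 0 < theta ->
  exists n0 : nat, forall (n : nat) (T I : finType) (U : I -> {set T}),
  (n0 <= n)%N -> #|T| = (2 * n)%N -> (#|I| <= 16 * n ^ 2)%N ->
  uniform_pr R (atypical U (eps * n%:R)) <= theta.
Proof.
move=> ep0 th0; have [n0 hn] := eventually_ge (1920 / eps ^+ 6 / theta).
exists n0.+1 => n T I U nn cT cI.
have N0 : 0 < n%:R :> R by rewrite ltr0n; apply: leq_trans nn.
have {hn} := hn n (ltnW nn); set N : R := n%:R in N0 *; rewrite ler_pdivrMr // => h.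
have E0 : 0 < eps * N by rewrite mulr_gt0.
apply: le_trans (zsum_concentration (N := 2 * N) E0 _) _.
  by move=> i; rewrite -natrM ler_nat -cT; apply: max_card.
apply: (@le_trans _ _ (16 * N ^+ 2 * (15 * (2 * N) ^+ 3 / (eps * N) ^+ 6))).
  rewrite ler_wpM2r ?divr_ge0 ?mulr_ge0 ?exprn_ge0 ?mulr_ge0 ?ler0n ?(ltW ep0) ?(ltW N0) //.
  by rewrite -natrX -natrM ler_nat.
have -> : 16 * N ^+ 2 * (15 * (2 * N) ^+ 3 / (eps * N) ^+ 6) = 1920 / eps ^+ 6 / N.
  by field; rewrite !gt_eqF.
by rewrite ler_pdivrMr // [theta * N]mulrC.
Qed.

Lemma pr_heavy_dev (eps theta : R) : 0 < eps -> 0 < theta ->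
  exists n0 : nat, forall (n : nat) (T : finType) (e : rel T),
  (n0 <= n)%N -> #|T| = (2 * n)%N ->
  uniform_pr R (fun S => eps * n%:R <= `|zsum R (heavy e S) S|) <= theta.
Proof.
move=> ep0 th0; have [n0 hn] := eventually_sqrt_ge (10 / eps ^+ 2 / theta).
exists n0.+1 => n T e nn cT.
have n_0 : (0 < n)%N by apply: leq_trans nn.
have {hn} := hn n (ltnW nn); rewrite ler_pdivrMr //.
have w2 : Num.sqrt n%:R ^+ 2 = n%:R :> R by rewrite sqr_sqrtr ?ler0n.
have w1 : 1 <= Num.sqrt n%:R :> R.
  have /ler_wsqrtr : 1 <= n%:R :> R by rewrite ler1n.
  by rewrite sqrtr1.
have N0 : 0 < n%:R :> R by rewrite ltr0n.
have E0 : 0 < eps * n%:R by rewrite mulr_gt0.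
have hsq := @Ex_heavy_sq R T n e cT n_0.
move: w2 w1 N0 E0 hsq; rewrite natrM; set N : R := n%:R; set w : R := Num.sqrt N.
move=> w2 w1 N0 E0 hsq h.
have w0 : 0 < w by apply: lt_le_trans w1.
have wN : w <= N by rewrite -w2 expr2 ler_peMl // ltW.
apply: le_trans (chebyshev (f := fun S => zsum R (heavy e S) S) (m := 0) E0 _) _.
  by move=> S; rewrite subr0.
rewrite (eq_Ex (g := fun S => zsum R (heavy e S) S ^+ 2)); last by move=> S; rewrite subr0.
apply: le_trans (_ : (2 * N + (2 * N) ^+ 2 * (2 / w)) / (eps * N) ^+ 2 <= _).
  by rewrite ler_pM2r ?invr_gt0 ?exprn_gt0.
rewrite ler_pdivrMr ?exprn_gt0 //.
have -> : 2 * N + (2 * N) ^+ 2 * (2 / w) = 2 * N + 8 * N ^+ 2 / w.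
  by field; rewrite gt_eqF.
apply: (@le_trans _ _ (10 * N ^+ 2 / w)).
  have -> : 10 * N ^+ 2 / w = 2 * N * (N / w) + 8 * N ^+ 2 / w by field; rewrite gt_eqF.
  by rewrite lerD2r ler_peMr ?mulr_ge0 ?(ltW N0) // ler_pdivlMr // mul1r.
rewrite ler_pdivrMr //.
have h' : 10 <= w * theta * eps ^+ 2 by rewrite -ler_pdivrMr ?exprn_gt0.
have -> : theta * (eps * N) ^+ 2 * w = w * theta * eps ^+ 2 * N ^+ 2 by ring.
by rewrite ler_pM2r ?exprn_gt0.
Qed.

(** Common neighbourhoods (degrees when the two vertices coincide), the two structure sets, and the
    whole vertex set, in one family. *)
Definition probe (T : finType) (e : rel T) (n : nat) (eta : R) (i : (T * T) * 'I_4) : {set T} :=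
  if i.2 == 0 :> nat then nbh e i.1.1 :&: nbh e i.1.2
  else if i.2 == 1 :> nat then clique_like e n eta i.1.1
  else if i.2 == 2 :> nat then bip_like e n eta i.1.1 else setT.

(** Were [S] not Hamiltonian, [closure_stability] would yield a structure inside [S]. Every probed
    set is about twice its trace on a typical [S], so the structure would be extremal in the whole
    graph. *)
Lemma heavy_ham (eta eps : R) (n : nat) (T : finType) (e : rel T) (S : {set T}) :
  0 < eta -> eta <= 1 -> eps = eta ^+ 2 / 1000 -> 8 / eta <= n%:R -> 1 <= eps * n%:R ->
  (0 < n)%N -> #|T| = (2 * n)%N -> symmetric e -> irreflexive e ->
  (forall x, #|nbh e x| = n.+1) ->
  (forall x, #|clique_like e n eta x|%:R < (1 - eta) * n%:R) ->
  (forall x, #|bip_like e n eta x|%:R < (1 - eta) * n%:R) ->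
  ~ atypical (probe e n eta) (eps * n%:R) S ->
  ~ (eps * n%:R <= `|zsum R (heavy e S) S|) -> (n <= #|heavy e S|)%N -> ham e S.
Proof.
move=> eta0 eta1 epE nE E1 n0 cT es ei reg noC noB ty hty hv.
have N0 : 0 < n%:R :> R by rewrite ltr0n.
have [ED DN kE] := nonextremal_numerics eta0 eta1 epE N0 nE.
have {ty} := typical_dev ty; have {hty} : `|zsum R (heavy e S) S| <= eps * n%:R.
  by apply/ltW; rewrite ltNge; apply/negP.
have {}hv : n%:R <= #|heavy e S|%:R :> R by rewrite ler_nat.
have regR x : #|nbh e x|%:R = n%:R + 1 :> R by rewrite reg natr1.
have cTR : #|T|%:R = 2 * n%:R :> R by rewrite cT natrM.
have [x0 _] : exists x : T, x \in T by apply/card_gt0P; rewrite cT muln_gt0.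
clear epE nE reg cT n0 eta0.
move: (eps * n%:R) (eta / 8 * n%:R) E1 ED DN kE => E D E1 ED DN kE hdev dev.
move: hv noC noB cTR regR kE DN; set N : R := n%:R => hv noC noB cTR regR kE DN.
apply: contrapT => nh.
have dev0 x y := dev ((x, y), @Ordinal 4 0 isT).
have dev1 x := dev ((x, x), @Ordinal 4 1 isT).
have dev2 x := dev ((x, x), @Ordinal 4 2 isT).
have := dev ((x0, x0), @Ordinal 4 3 isT).
rewrite /probe /= setTI cardsT cTR => /andP[m1 m2].
rewrite /probe /= in dev0 dev1 dev2 => {dev}.
have mN : `|#|S|%:R - N| <= E.
  by clear - m1 m2 E1; rewrite ler_norml; apply/andP; split; lra.
have dN v : `|#|nbh e v :&: S|%:R - N / 2| <= E.
  have := dev0 v v; rewrite setIid regR => /andP[h1 h2].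
  by clear - h1 h2 E1; rewrite ler_norml; apply/andP; split; lra.
have LN : N / 2 - E <= #|[set v in S | (#|S| <= 2 * #|nbh e v :&: S|)%N]|%:R.
  have -> : [set v in S | (#|S| <= 2 * #|nbh e v :&: S|)%N] = heavy e S :&: S.
    by apply/setP => v; rewrite !inE andbC.
  move: hdev; rewrite card_zsum ler_norml => /andP[h _].
  by clear - h hv E1; lra.
pose k := N / 2 - (9 * E + D + 3 * E * N / D + 2).
have k2 : (1 - eta) * N + E <= 2 * k by [].
have cd x y : k <= #|nbh e x :&: nbh e y :&: S|%:R ->
    (1 - eta) * N <= #|nbh e x :&: nbh e y|%:R.
  have /andP[_ h] := dev0 x y; move=> h'; clear - h h' k2; lra.
have [x xS [hC|hB]] := closure_stability es ei nh E1 ED DN mN dN LN.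
  have /andP[_ h] := dev1 x; have := noC x; apply/negP; rewrite -leNgt.
  have : k <= #|clique_like e n eta x :&: S|%:R.
    apply: le_trans hC _; rewrite ler_nat; apply: subset_leq_card; apply/subsetP => y.
    by rewrite !inE => /and3P[-> -> /cd->].
  by move=> h'; clear - h h' k2; lra.
have /andP[_ h] := dev2 x; have := noB x; apply/negP; rewrite -leNgt.
have : k <= #|bip_like e n eta x :&: S|%:R.
  apply: le_trans hB _; rewrite ler_nat; apply: subset_leq_card; apply/subsetP => y.
  by rewrite !inE => /and3P[-> -> /cd->].
by move=> h'; clear - h h' k2; lra.
Qed.

Lemma nonextremal_case (eta theta : R) : 0 < eta -> eta <= 1 -> 0 < theta ->
  exists n0 : nat, forall (n : nat) (T : finType) (e : rel T),
  (n0 <= n)%N -> #|T| = (2 * n)%N -> symmetric e -> irreflexive e ->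
  (forall x, #|nbh e x| = n.+1) ->
  (forall x, #|clique_like e n eta x|%:R < (1 - eta) * n%:R) ->
  (forall x, #|bip_like e n eta x|%:R < (1 - eta) * n%:R) ->
  1 / 2 - theta <= uniform_pr R (ham e).
Proof.
move=> eta0 eta1 th0.
have [eps ep0 epE] : exists2 eps : R, 0 < eps & eps = eta ^+ 2 / 1000.
  by eexists; last by []; rewrite divr_gt0 ?exprn_gt0 ?ltr0n.
have th2 : 0 < theta / 2 by rewrite divr_gt0.
have [n1 hn1] := pr_atypical ep0 th2.
have [n2 hn2] := pr_heavy_dev ep0 th2.
have [n3 hn3] := eventually_ge (8 / eta).
have [n4 hn4] := eventually_ge (1 / eps).
exists (n1 + n2 + n3 + n4).+1 => n T e nn cT es ei reg noC noB.
have n0 : (0 < n)%N by apply: leq_trans nn.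
have [nn1 nn2 nn3 nn4] : [/\ n1 <= n, n2 <= n, n3 <= n & n4 <= n]%N.
  by clear - nn; split; lia.
pose bad S := atypical (probe e n eta) (eps * n%:R) S \/ eps * n%:R <= `|zsum R (heavy e S) S|.
have good S : ~ bad S -> (n <= #|heavy e S|)%N -> ham e S.
  move=> nb; apply: (heavy_ham eta0 eta1 epE (hn3 n nn3) _ n0 cT es ei reg noC noB).
  - by rewrite mulrC -ler_pdivrMr // hn4.
  - by move=> h; apply: nb; left.
  - by move=> h; apply: nb; right.
have pbad : uniform_pr R bad <= theta.
  apply: le_trans (pr_or _ _ _) _; rewrite (splitr theta); apply: lerD.
    by apply: hn1 => //; rewrite !card_prod card_ord cT; clear; nia.
  exact: hn2.
have h1 : uniform_pr R (fun S => ham e S \/ ham e (~: S)) <= 2 * uniform_pr R (ham e).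
  by apply: le_trans (pr_or _ _ _) _; rewrite (pr_setC R (ham e)) mulr_natl.
have h2 : uniform_pr R (fun S => bad S \/ bad (~: S)) <= 2 * theta.
  apply: le_trans (pr_or _ _ _) _; rewrite (pr_setC R bad) mulr_natl mulr2n.
  exact: lerD.
have h3 : uniform_pr R (fun _ : {set T} => True) - uniform_pr R (fun S => bad S \/ bad (~: S)) <=
    uniform_pr R (fun S => ham e S \/ ham e (~: S)).
  apply: pr_diff => S _; have [b|nb] := pselect (bad S \/ bad (~: S)); first by right.
  left; have := heavy_setC cT n0 reg S => hS.
  have [hv|hv] := leqP n #|heavy e S|; [left|right]; apply: good.
  - by move=> b; apply: nb; left.
  - by [].
  - by move=> b; apply: nb; right.
  - by rewrite -(leq_add2l n) addnn -mul2n (leq_trans hS) // leq_add2r ltnW.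
rewrite pr_true ?card_set_gt0 // in h3.
by clear - h1 h2 h3; lra.
Qed.

End NonExtremal.

(** * Two near-cliques *)

Section CliqueCase.
Variable R : realType.

(** The number of surviving matching edges has mean [#|M| / 4]; if at most one survives, the
    deviation is at least [#|M| / 4 - 1 >= #|M| / 8]. *)
Lemma two_edges (T : finType) (A : {set T}) (M : {set T * T}) :
  (8 <= #|M|)%N -> {in M, forall p, p.1 \in A /\ p.2 \notin A} ->
  {in M &, injective fst} -> {in M &, injective snd} ->
  uniform_pr R (fun S : {set T} => ~ exists p p', [/\ p \in M, p' \in M, p != p',
    (p.1 \in S) && (p.2 \in S) & (p'.1 \in S) && (p'.2 \in S)]) <= 64 / #|M|%:R.
Proof.
move=> M8 MA inj1 inj2.
(* With a single level, [independent] for levelled samples applies to plain subsets. *)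
rewrite -(@pr_fst _ _ {ffun T -> 'I_1}) ?card_levels_gt0 //.
pose f (p : T * T) (w : {set T} * {ffun T -> 'I_1}) : R :=
  if p \in M then (at_level p.1 ord0 w)%:R * (at_level p.2 ord0 w)%:R else 0.
have np p : p \in M -> p.1 != p.2.
  by move=> /MA[p1 p2]; apply: contraNneq p2 => <-.
have Ef p : p \in M -> Ex (f p) = 4^-1.
  move=> pM; rewrite /f pM (independent (U := [set p.1]) (V := [set p.2])).
  - by rewrite !Ex_at_level; field.
  - by rewrite disjoints1 inE np.
  - exact: determined_at_level.
  - exact: determined_at_level.
have detf p : determined [set p.1; p.2] (f p).
  move=> w w' h; rewrite /f; case: ifP => // _.
  have [h1 h2] := h p.1 (set21 _ _); have [h3 h4] := h p.2 (set22 _ _).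
  by rewrite /at_level h1 h2 h3 h4.
have m0 : 0 < #|M|%:R :> R by rewrite ltr0n; apply: leq_trans M8.
have m8 : 8 <= #|M|%:R :> R by rewrite ler_nat.
have t0 : 0 < #|M|%:R / 8 :> R by rewrite divr_gt0.
have mE : \sum_(p in M) Ex (f p) = #|M|%:R / 4.
  by rewrite (eq_bigr (fun=> 4^-1)) // sumr_const -[LHS]mulr_natl.
have fE w : \sum_(p in M) f p w = #|[set p in M | (p.1 \in w.1) && (p.2 \in w.1)]|%:R.
  rewrite -sum1_card natr_sum big_mkcond [RHS]big_mkcond; apply: eq_bigr => p _.
  rewrite inE /f; case: (p \in M) => //=; rewrite /at_level.
  have lev v : (w.2 v == ord0) by rewrite ord1.
  by rewrite !lev !andbT; case: (p.1 \in w.1); case: (p.2 \in w.1); rewrite /= ?mulr1 ?mulr0.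
apply: le_trans (chebyshev (f := fun w => \sum_(p in M) f p w) (m := \sum_(p in M) Ex (f p)) t0 _) _.
  move=> w no; have : (#|[set p in M | (p.1 \in w.1) && (p.2 \in w.1)]| <= 1)%N.
    rewrite leqNgt; apply/negP => /card_gt1P[p [p' [pM p'M pp']]].
    apply: no; exists p, p'; move: pM p'M; rewrite !inE => /andP[-> ->] /andP[-> ->].
    by split.
  rewrite fE mE -(ler_nat R) => le1; rewrite -normrN.
  by apply: le_trans (ler_norm _); move: le1 m8; clear; lra.
have bnd : Ex (fun w => (\sum_(p in M) f p w - \sum_(p in M) Ex (f p)) ^+ 2) <= #|M|%:R.
  apply: le_trans (variance_bound (bad := fun p p' => (p == p') || (p \notin M) || (p' \notin M)) _ (card_omega_gt0 T 0) _ _) _.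
  - move=> p w; rewrite /f; case: ifP => _; last by rewrite lexx ler01.
    by rewrite -natrM mulnb bool01.
  - move=> p p'; rewrite !negb_or !negbK => /andP[/andP[pp' pM] p'M].
    apply: (@independent _ _ _ [set p.1; p.2] [set p'.1; p'.2]); [|exact: detf..].
    have [pA pB] := MA p pM; have [p'A p'B] := MA p' p'M.
    apply/pred0P => x /=; rewrite !inE; apply/negP.
    move=> /andP[/orP[]/eqP-> /orP[]/eqP e].
    + by rewrite (inj1 _ _ pM p'M e) eqxx in pp'.
    + by rewrite e (negPf p'B) in pA.
    + by rewrite e p'A in pB.
    + by rewrite (inj2 _ _ pM p'M e) eqxx in pp'.
  - rewrite (eq_bigr (fun=> 1)) ?sumr_const // => p pM.
    rewrite (bigD1 p) //= eqxx /= big1 ?addr0 // => p' /andP[p'M].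
    by rewrite eq_sym pM p'M => /negPf->.
apply: (@le_trans _ _ (#|M|%:R / (#|M|%:R / 8) ^+ 2)).
  by rewrite ler_pM2r // invr_gt0 exprn_gt0.
by rewrite le_eqVlt; apply/orP; left; apply/eqP; field; rewrite gt_eqF.
Qed.

(** The set [C] sends few edges out, so the set [X] of outside vertices with many neighbours in [C]
    is small. A vertex of [X] joins [C] if it has [n / 3] neighbours there; otherwise about
    [2 n / 3] of its neighbours are on the other side. *)
Lemma clique_partition (T : finType) (e : rel T) (n : nat) (eta rho : R) (x : T) :
  symmetric e -> #|T| = (2 * n)%N -> (forall v, #|nbh e v| = n.+1) ->
  0 < rho <= 1 / 4 -> 0 < eta -> 100 * eta <= rho ^+ 2 -> 1 <= eta * n%:R ->
  (1 - eta) * n%:R <= #|clique_like e n eta x|%:R ->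
  exists A GA GB : {set T}, [/\ GA \subset A, GB \subset ~: A,
    (1 - rho) * n%:R <= #|GA|%:R /\ (1 - rho) * n%:R <= #|GB|%:R,
    {in GA, forall v, (1 - rho) * n%:R <= #|nbh e v :&: A|%:R} /\
    {in GB, forall v, (1 - rho) * n%:R <= #|nbh e v :&: ~: A|%:R} &
    {in A, forall v, n%:R / 3 <= #|nbh e v :&: A|%:R :> R} /\
    {in ~: A, forall v, n%:R / 3 <= #|nbh e v :&: ~: A|%:R :> R}].
Proof.
move=> es cT reg /andP[rho0 rho1] eta0 etarho etaN; set N : R := n%:R in etaN *.
set C := clique_like e n eta x => cC.
have regR v : #|nbh e v|%:R = N + 1 :> R by rewrite reg natr1.
have eta_rho : 100 * eta <= rho / 4.
  by apply: le_trans etarho _; rewrite expr2 ler_pM2l //; lra.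
have N0 : 0 < N.
  by rewrite ltNge; apply/negP => h; have := le_trans etaN (mulr_ge0_le0 (ltW eta0) h); rewrite ler10.
have rhoN : 100 * (eta * N) <= rho / 4 * N.
  by rewrite mulrA ler_pM2r.
have rhoN1 : rho * N <= N / 4 by rewrite mulrC ler_pM2l //; lra.
have CN : C \subset nbh e x by apply/subsetP => y; rewrite !inE => /andP[].
have cCN : #|nbh e x :\: C|%:R = N + 1 - #|C|%:R :> R.
  by rewrite -(regR x) -(cardsID C (nbh e x)) (setIidPr CN) natrD; ring.
have inC y : y \in C -> (1 - 3 * eta) * N <= #|nbh e y :&: C|%:R.
  rewrite inE => /andP[_ h].
  have : (#|nbh e x :&: nbh e y| <= #|nbh e y :&: C| + #|nbh e x :\: C|)%N.
    apply: leq_trans (leq_card_setU _ _); apply: subset_leq_card; apply/subsetP => z.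
    by rewrite in_setU in_setI (in_setI z) in_setD => /andP[-> ->]; case: (z \in C).
  rewrite -(ler_nat R) natrD cCN; move: h cC etaN; rewrite -/N; clear; lra.
have cCle : #|C|%:R <= N + 1 by rewrite -(regR x) ler_nat subset_leq_card.
have crossC : \sum_(v in ~: C) #|nbh e v :&: C|%:R <= 8 * (eta * N) * N.
  rewrite -natr_sum double_count // natr_sum.
  apply: (@le_trans _ _ (#|C|%:R * (4 * (eta * N)))).
    rewrite [leRHS]mulr_natl -sumr_const; apply: ler_sum => y yC.
    have := inC y yC; have := regR y; rewrite -(cardsID C (nbh e y)) setDE natrD.
    by move: etaN; clear; lra.
  have : 1 <= N by move: etaN eta_rho rho1 N0; clear; nra.
  by move: cCle etaN N0; clear; nra.
pose X := [set v in ~: C | rho / 2 * N <= #|nbh e v :&: C|%:R].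
have cX : #|X|%:R <= rho / 4 * N.
  have h : #|X|%:R * (rho / 2 * N) <= 8 * (eta * N) * N.
    apply: le_trans crossC; rewrite mulr_natl -sumr_const big_mkcond [leRHS]big_mkcond.
    apply: ler_sum => v _; rewrite [v \in X]inE; case: (v \in ~: C) => //=.
    by case: ifP => // _; rewrite ler0n.
  have h2 : #|X|%:R * rho <= 16 * (eta * N).
    rewrite -(@ler_pM2r _ N) //.
    have -> : #|X|%:R * rho * N = 2 * (#|X|%:R * (rho / 2 * N)) by field.
    by move: h; clear; lra.
  have h3 : 100 * (eta * N) <= rho ^+ 2 * N by rewrite mulrA ler_pM2r.
  rewrite -(@ler_pM2r _ rho) //; apply: le_trans h2 _.
  have -> : rho / 4 * N * rho = rho ^+ 2 * N / 4 by field.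
  by move: h3 etaN; clear; lra.
pose A := C :|: [set v in X | N / 3 <= #|nbh e v :&: C|%:R].
exists A, C, (~: C :\: X).
have AC v : #|nbh e v :&: C|%:R <= #|nbh e v :&: A|%:R :> R.
  by rewrite ler_nat; apply: subset_leq_card; apply: setIS; apply: subsetUl.
have nA v : N + 1 <= #|nbh e v :&: ~: A|%:R + #|nbh e v :&: C|%:R + #|X|%:R.
  have : (#|nbh e v :&: A| <= #|nbh e v :&: C| + #|X|)%N.
    apply: leq_trans (leq_card_setU _ _); apply: subset_leq_card; apply/subsetP => z.
    move=> /setIP[zv /setUP[zC|]]; first by rewrite in_setU in_setI zv zC.
    by rewrite inE => /andP[zX _]; rewrite in_setU zX orbT.
  have := regR v; rewrite -(cardsID A (nbh e v)) setDE natrD -(ler_nat R) natrD; clear; lra.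
have outA v : v \in ~: A -> #|nbh e v :&: C|%:R < N / 3.
  rewrite in_setC in_setU negb_or => /andP[vC vX].
  rewrite ltNge; apply: contra vX => h; rewrite inE h andbT inE in_setC vC /=.
  by apply: le_trans h; move: rhoN1 N0; clear; lra.
split.
- exact: subsetUl.
- apply/subsetP => v; rewrite in_setD !in_setC in_setU negb_or => /andP[vX vC].
  by rewrite vC inE (negPf vX).
- split; first by apply: le_trans cC; move: rhoN etaN; clear; lra.
  have := cardsID X (~: C); have := cardsC C; rewrite cT => h1 h2.
  have h3 : (#|~: C :&: X| <= #|X|)%N by apply/subset_leq_card/subsetIr.
  have : 2 * N <= #|C|%:R + #|X|%:R + #|~: C :\: X|%:R.
    by rewrite -natrM -!natrD ler_nat; clear - h1 h2 h3; lia.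
  by move: cCle cX rhoN etaN; clear; lra.
- split=> v.
    by move=> /inC h; apply: le_trans (AC v); move: h rhoN etaN; clear; lra.
  rewrite in_setD inE in_setC => /andP[+ vC]; rewrite vC /= -ltNge => h.
  by have := nA v; move: h cX rhoN etaN; clear; lra.
- split=> v; last by move=> /outA h; have := nA v; move: h cX rhoN1 N0; clear; lra.
  rewrite in_setU => /orP[/inC|]; last by rewrite inE => /andP[_ h]; apply: le_trans (AC v).
  by move=> h; apply: le_trans (AC v); move: h rhoN rhoN1 N0; clear; lra.
Qed.

Lemma clique_case (eta theta : R) : 0 < eta -> 1000 * (1000 * eta) <= 1 -> 0 < theta ->
  exists n0 : nat, forall (n : nat) (T : finType) (e : rel T),
  (n0 <= n)%N -> #|T| = (2 * n)%N -> symmetric e -> irreflexive e ->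
  (forall x, #|nbh e x| = n.+1) ->
  (exists x, (1 - eta) * n%:R <= #|clique_like e n eta x|%:R) ->
  1 - theta <= uniform_pr R (ham e).
Proof.
move=> eta0 eta1 th0.
have th2 : 0 < theta / 2 by rewrite divr_gt0.
have r100 : 0 < 1 / 100 :> R by rewrite divr_gt0 ?ltr0n.
have [n1 hn1] := pr_atypical r100 th2.
have [n2 hn2] := eventually_ge (1 / eta).
have [K0 hK0] := eventually_ge (128 / theta).
(* Makes [64 / K] at most [theta / 2] and provides the 8 edges required by [two_edges]. *)
pose K := (K0 + 8)%N.
have [n3 hn3] := eventually_ge (100 * (K%:R + 1) : R).
exists (n1 + n2 + n3 + (K ^ 2 + 3 * K) + 1)%N => n T e nn cT es ei reg [x hx].
have nnK : (K ^ 2 + 3 * K < n)%N by move: nn; move: (K ^ 2 + 3 * K)%N; clear; lia.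
have [nn1 nn2 nn3] : [/\ n1 <= n, n2 <= n & n3 <= n]%N.
  by move: nn; move: (K ^ 2 + 3 * K)%N; clear; split; lia.
have {nn} n0 : (0 < n)%N by apply: leq_ltn_trans nnK.
have etaN : 1 <= eta * n%:R by rewrite mulrC -ler_pdivrMr // hn2.
have rhoP : 0 < (1 / 100 : R) <= 1 / 4 by rewrite r100 /=; clear; lra.
have etarho : 100 * eta <= (1 / 100) ^+ 2 by move: eta1; clear; lra.
have [A [GA [GB [GAA GBA [cGA cGB] [dGA dGB] [dA dB]]]]] :=
  clique_partition es cT reg rhoP eta0 etarho etaN hx.
have NK := hn3 n nn3.
have KA (Y G : {set T}) : G \subset Y -> (1 - 1 / 100) * n%:R <= #|G|%:R :> R -> (2 * K < #|Y|)%N.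
  move=> GY cG; rewrite -(ltr_nat R) natrM; apply: lt_le_trans (_ : #|G|%:R <= _); last first.
    by rewrite ler_nat subset_leq_card.
  by move: cG NK; have := ler0n R K; clear; lra.
have KA1 := KA _ _ GAA cGA; have KB1 := KA _ _ GBA cGB.
have [M [KM Mcross inj1 inj2]] := cross_matching es ei cT reg KA1 KB1 nnK.
pose U (i : T * 'I_6) : {set T} :=
  if i.2 == 0 :> nat then nbh e i.1 :&: A
  else if i.2 == 1 :> nat then nbh e i.1 :&: ~: A
  else if i.2 == 2 :> nat then A else if i.2 == 3 :> nat then ~: A
  else if i.2 == 4 :> nat then GA else GB.
pose noedge (S : {set T}) := ~ exists p p', [/\ p \in M, p' \in M, p != p',
    (p.1 \in S) && (p.2 \in S) & (p'.1 \in S) && (p'.2 \in S)].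
have p1 : uniform_pr R (atypical U ((1 / 100 : R) * n%:R)) <= theta / 2.
  apply: hn1 => //; rewrite card_prod card_ord cT; clear - n0; nia.
have p2 : uniform_pr R noedge <= theta / 2.
  apply: le_trans (two_edges (A := A) _ _ inj1 inj2) _.
  - by apply: leq_trans KM; rewrite /K leq_addl.
  - by move=> p /Mcross[]; split.
  have M0 : 128 / theta <= #|M|%:R.
    by apply: le_trans (hK0 K0 (leqnn _)) _; rewrite ler_nat (leq_trans _ KM) // leq_addr.
  have Mp : 0 < #|M|%:R :> R by apply: lt_le_trans M0; rewrite divr_gt0 ?ltr0n.
  rewrite ler_pdivrMr //; move: M0; rewrite ler_pdivrMr //.
  by move: (#|M|%:R) => m; clear; lra.
have good S : ~ atypical U ((1 / 100 : R) * n%:R) S -> ~ noedge S -> ham e S.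
  move=> /typical_dev dev /contrapT[p [p' [pM p'M pp' /andP[p1S p2S] /andP[p1S' p2S']]]].
  have [pA pB epp] := Mcross p pM; have [p'A p'B epp'] := Mcross p' p'M.
  have ne1 : p.1 != p'.1 by apply: contraNneq pp' => h; rewrite (inj1 _ _ pM p'M h).
  have ne2 : p.2 != p'.2 by apply: contraNneq pp' => h; rewrite (inj2 _ _ pM p'M h).
  have dev0 v := dev (v, @Ordinal 6 0 isT).
  have dev1 v := dev (v, @Ordinal 6 1 isT).
  have := dev (x, @Ordinal 6 5 isT); have := dev (x, @Ordinal 6 4 isT).
  have := dev (x, @Ordinal 6 3 isT); have := dev (x, @Ordinal 6 2 isT).
  rewrite /U /= in dev0 dev1 *; move=> /andP[_ sA] /andP[_ sB] /andP[sGA _] /andP[sGB _].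
  have sizes : #|A|%:R + #|~: A|%:R = 2 * n%:R :> R.
    by rewrite -natrD cardsC cT natrM.
  have cAle : #|A|%:R <= 101 / 100 * n%:R :> R.
    have : #|GB|%:R <= #|~: A|%:R :> R by rewrite ler_nat subset_leq_card.
    by move: cGB sizes; clear; lra.
  have cBle : #|~: A|%:R <= 101 / 100 * n%:R :> R.
    have : #|GA|%:R <= #|A|%:R :> R by rewrite ler_nat subset_leq_card.
    by move: cGA sizes; clear; lra.
  (* With deviations [n / 100], core vertices keep degree [(99 - 1) / 200 * n] inside their side and
     all others at least [(1 / 3 - 1 / 100) / 2 * n]. The sum exceeds [51 / 100 * n], the largest
     possible size of a side of [S]. *)
  have SD : S :\: A = S :&: ~: A by rewrite setDE.
  pose dg := Num.truncn (49 / 100 * n%:R : R); pose db := Num.truncn (16 / 100 * n%:R : R).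
  have N0 : 0 <= n%:R :> R by rewrite ler0n.
  have dgle : dg%:R <= 49 / 100 * n%:R :> R by rewrite truncn_le; move: N0; clear; lra.
  have dbgt : 16 / 100 * n%:R - 1 < db%:R :> R.
    by rewrite ltrBlDr natr1; apply: truncnS_gt.
  have dggt : 49 / 100 * n%:R - 1 < dg%:R :> R.
    by rewrite ltrBlDr natr1; apply: truncnS_gt.
  have dble : db%:R <= 16 / 100 * n%:R :> R by rewrite truncn_le; move: N0; clear; lra.
  have n100 : 100 <= n%:R :> R by move: NK; have := ler0n R K; clear; lra.
  apply: (@ham_near_cliques _ e S A p.1 p'.1 p.2 p'.2 (S :&: GA) (S :&: GB) dg db es ei) => //.
  - by rewrite inE p1S.
  - by rewrite inE p1S'.
  - by rewrite inE p2S pB.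
  - by rewrite inE p2S' p'B.
  - exact: setIS.
  - by rewrite SD; apply: setIS.
  - move=> g /setIP[_ gG]; rewrite -(ler_nat R) [S :&: A]setIC setIA.
    have /andP[h _] := dev0 g; have h2 := dGA g gG; move: h h2 dgle; clear; lra.
  - move=> g /setIP[_ gG]; rewrite -(ler_nat R) SD [S :&: _]setIC setIA.
    have /andP[h _] := dev1 g; have h2 := dGB g gG; move: h h2 dgle; clear; lra.
  - move=> v /setIP[_ vA]; rewrite -(ler_nat R) [S :&: A]setIC setIA.
    have /andP[h _] := dev0 v; have h2 := dA v vA; move: h h2 dble N0; clear; lra.
  - move=> v; rewrite SD => /setIP[_ vA]; rewrite -(ler_nat R) [S :&: _]setIC setIA.
    have /andP[h _] := dev1 v; have h2 := dB v vA; move: h h2 dble N0; clear; lra.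
  - rewrite -(ltr_nat R) !natrD [S :&: A]setIC.
    by move: sA cAle dggt dbgt n100; clear; lra.
  - rewrite -(ltr_nat R) !natrD SD [S :&: _]setIC.
    by move: sB cBle dggt dbgt n100; clear; lra.
  - rewrite -(ltr_nat R) natrD natrM [S :&: A]setIC [S :&: GA]setIC.
    by move: sA sGA cGA cAle n100; clear; lra.
  - rewrite -(ltr_nat R) natrD natrM SD [S :&: ~: A]setIC [S :&: GB]setIC.
    by move: sB sGB cGB cBle n100; clear; lra.
have : uniform_pr R (fun _ : {set T} => True) -
    uniform_pr R (fun S => atypical U ((1 / 100 : R) * n%:R) S \/ noedge S) <= uniform_pr R (ham e).
  apply: pr_diff => S _.
  have [b|nb] := pselect (atypical U ((1 / 100 : R) * n%:R) S \/ noedge S); first by right.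
  by left; apply: good => h; apply: nb; [left|right].
rewrite pr_true ?card_set_gt0 //; have := pr_or R (atypical U ((1 / 100 : R) * n%:R)) noedge.
by move: p1 p2; clear; lra.
Qed.

End CliqueCase.

(** * Nearly bipartite graphs *)

Section Counting.
Variables (R : realType) (T : finType).
Implicit Types (e : rel T) (A P Q : {set T}).

Definition inner_arcs e A : {set T * T} := [set p | [&& p.1 \in A, p.2 \in A & e p.1 p.2]].

(** Twice the fractional vertex cover defined by [P] and [Q]. *)
Definition weight P Q (v : T) : R := (v \in P)%:R + (v \in Q)%:R.

Lemma weight_sum P Q A : \sum_(v in A) weight P Q v = #|P :&: A|%:R + #|Q :&: A|%:R.
Proof.
rewrite big_split /=; congr (_ + _); rewrite -natr_sum -sum1_card; congr (_%:R);
  rewrite big_mkcond [RHS]big_mkcond; apply: eq_bigr => v _; rewrite inE.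
  by case: (v \in A); case: (v \in P).
by case: (v \in A); case: (v \in Q).
Qed.

(** An arc [xy] contributes [1 - [x in P] - [y in Q]], which is 1 if it is uncovered and at most 0
    otherwise; symmetry of [e] collects both indicators at the same vertex. *)
Lemma inner_arcs_cover e A P Q : symmetric e ->
  \sum_(v in A) #|nbh e v :&: A|%:R * (1 - weight P Q v) <= #|uncovered (inner_arcs e A) P Q|%:R.
Proof.
move=> es.
have EE v : (#|nbh e v :&: A|%:R : R) = \sum_(y in A) (e v y)%:R by rewrite -natr_sum nbh_sum.
have -> : \sum_(v in A) #|nbh e v :&: A|%:R * (1 - weight P Q v) =
    \sum_(x in A) \sum_(y in A) (e x y)%:R * (1 - (x \in P)%:R - (y \in Q)%:R).
  have -> : \sum_(v in A) #|nbh e v :&: A|%:R * (1 - weight P Q v) =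
      \sum_(v in A) #|nbh e v :&: A|%:R * (1 - (v \in P)%:R) -
      \sum_(v in A) #|nbh e v :&: A|%:R * (v \in Q)%:R.
    by rewrite -sumrB; apply: eq_bigr => v _; rewrite /weight; ring.
  have -> : \sum_(v in A) #|nbh e v :&: A|%:R * (v \in Q)%:R =
      \sum_(x in A) \sum_(y in A) (e x y)%:R * (y \in Q)%:R :> R.
    rewrite [RHS]exchange_big /=; apply: eq_bigr => v _; rewrite EE mulr_suml.
    by apply: eq_bigr => y _; rewrite es.
  rewrite -sumrB; apply: eq_bigr => x _; rewrite EE mulr_suml -sumrB.
  by apply: eq_bigr => y _; ring.
rewrite -sum1_card natr_sum pair_big_dep /= big_mkcond [leRHS]big_mkcond.
apply: ler_sum => -[x y] _; rewrite !inE /=.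
case: (x \in A) (y \in A) (x \in P) (y \in Q) (e x y) => [] [] [] [] [] /=; lra.
Qed.

(* Fractional covers of the edges inside A and inside its complement: since a non-edge
   between the sides must be paid for inside both sides, p + q <= 2 + p q / 2 makes the
   unknown number of non-edges cancel. *)
Lemma cover_inequality e A (n : nat) (PA QA PB QB : {set T}) (k a b : R) : symmetric e ->
  #|T| = (2 * n)%N -> (forall v, #|nbh e v| = n.+1) ->
  k = n%:R - #|A|%:R -> a = #|PA :&: A|%:R + #|QA :&: A|%:R ->
  b = #|PB :&: ~: A|%:R + #|QB :&: ~: A|%:R ->
  2 * n%:R + 2 * k ^+ 2 <= (1 - k) * a + (1 + k) * b + a * b / 2 +
    #|uncovered (inner_arcs e A) PA QA|%:R + #|uncovered (inner_arcs e (~: A)) PB QB|%:R.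
Proof.
move=> es cT reg kE aE bE.
have cA : #|A|%:R = n%:R - k by rewrite kE; ring.
have cB : #|~: A|%:R = n%:R + k.
  have : #|A|%:R + #|~: A|%:R = 2 * n%:R :> R by rewrite -natrD cardsC cT natrM.
  by rewrite cA; lra.
(* Non-edges across: by regularity the degree of a vertex inside its side is [1 - k], respectively
   [1 + k], plus its number of non-neighbours across. *)
pose mu x y : R := 1 - (e x y)%:R.
have regR v : #|nbh e v :&: A|%:R + #|nbh e v :&: ~: A|%:R = n%:R + 1 :> R.
  by rewrite -natrD -setDE cardsID reg natr1.
have smu v (Y : {set T}) : \sum_(y in Y) mu v y = #|Y|%:R - #|nbh e v :&: Y|%:R.
  by rewrite sumrB sumr_const -natr_sum nbh_sum.
have dA v : #|nbh e v :&: A|%:R = 1 - k + \sum_(y in ~: A) mu v y.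
  by have := regR v; rewrite smu cB; clear; lra.
have dB v : #|nbh e v :&: ~: A|%:R = 1 + k + \sum_(y in A) mu v y.
  by have := regR v; rewrite smu cA; clear; lra.
have hA := inner_arcs_cover A PA QA es; have hB := inner_arcs_cover (~: A) PB QB es.
have sA : \sum_(v in A) #|nbh e v :&: A|%:R * (1 - weight PA QA v) =
    (1 - k) * (n%:R - k - a) + \sum_(x in A) \sum_(y in ~: A) mu x y * (1 - weight PA QA x).
  rewrite (eq_bigr (fun v => (1 - k) * (1 - weight PA QA v) +
      \sum_(y in ~: A) mu v y * (1 - weight PA QA v))); last first.
    by move=> v _; rewrite dA mulrDl mulr_suml.
  by rewrite big_split /= -mulr_sumr sumrB sumr_const weight_sum cA aE.
have sB : \sum_(v in ~: A) #|nbh e v :&: ~: A|%:R * (1 - weight PB QB v) =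
    (1 + k) * (n%:R + k - b) + \sum_(x in A) \sum_(y in ~: A) mu x y * (1 - weight PB QB y).
  rewrite (eq_bigr (fun v => (1 + k) * (1 - weight PB QB v) +
      \sum_(y in A) mu y v * (1 - weight PB QB v))); last first.
    move=> v _; rewrite dB mulrDl mulr_suml; congr (_ + _); apply: eq_bigr => y _.
    by rewrite /mu es.
  rewrite big_split /= -mulr_sumr sumrB sumr_const weight_sum cB bE exchange_big.
  by [].
(* On a non-edge with weights [s] and [t] in [0, 2], [2 - s - t + s t / 2 = (2 - s) (2 - t) / 2 >=
   0]. *)
have cross : - (a * b / 2) <= \sum_(x in A) \sum_(y in ~: A) mu x y * (1 - weight PA QA x) +
    \sum_(x in A) \sum_(y in ~: A) mu x y * (1 - weight PB QB y).
  have -> : a * b / 2 = \sum_(x in A) \sum_(y in ~: A) weight PA QA x * weight PB QB y / 2.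
    rewrite aE bE -!weight_sum mulr_suml mulr_suml; apply: eq_bigr => x _.
    by rewrite mulr_sumr mulr_suml.
  rewrite -sumrN -big_split /=; apply: ler_sum => x _.
  rewrite -sumrN -big_split /=; apply: ler_sum => y _; rewrite /mu /weight.
  case: (e x y) (x \in PA) (x \in QA) (y \in PB) (y \in QB) => [] [] [] [] [] /=; lra.
move: hA hB cross; rewrite sA sB; clear; nra.
Qed.

(** With [k = n - #|A|], inner degrees outside [A] lie between [k + 1] and [n / 20]: a cover of size
    below [10 k] leaves at least [n k / 2] arcs uncovered, and this is at least [10 k D]. The larger
    side can thus always absorb the deficit [k]. *)
Lemma large_flow e A (n D : nat) (P Q : {set T}) (F : {set T * T}) :
  #|T| = (2 * n)%N -> (forall v, #|nbh e v| = n.+1) -> symmetric e ->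
  (#|A| < n)%N -> 20 * D%:R <= n%:R :> R ->
  {in ~: A, forall v, #|nbh e v :&: ~: A|%:R <= n%:R / 20 :> R} ->
  (D * (#|P| + #|Q|) + #|uncovered (inner_arcs e (~: A)) P Q| <= #|F|)%N ->
  D%:R * (10 * (n%:R - #|A|%:R)) <= #|F|%:R :> R.
Proof.
move=> cT reg es An Dn small; rewrite -(ler_nat R) natrD natrM natrD => hF.
have h := inner_arcs_cover (~: A) P Q es.
pose k : R := n%:R - #|A|%:R.
have k1 : 1 <= k by rewrite /k lerBrDl natr1 ler_nat.
have cB : #|~: A|%:R = n%:R + k.
  have : #|A|%:R + #|~: A|%:R = 2 * n%:R :> R by rewrite -natrD cardsC cT natrM.
  by rewrite /k; lra.
have dB v : k + 1 <= #|nbh e v :&: ~: A|%:R.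
  have : #|nbh e v :&: A|%:R + #|nbh e v :&: ~: A|%:R = n%:R + 1 :> R.
    by rewrite -natrD -setDE cardsID reg natr1.
  have : #|nbh e v :&: A|%:R <= #|A|%:R :> R by rewrite ler_nat subset_leq_card ?subsetIr.
  by rewrite /k; lra.
have sB : (n%:R + k) * (k + 1) - n%:R / 20 * (#|P :&: ~: A|%:R + #|Q :&: ~: A|%:R) <=
    \sum_(v in ~: A) #|nbh e v :&: ~: A|%:R * (1 - weight P Q v).
  rewrite -weight_sum -cB mulr_sumr [leLHS](_ : _ = \sum_(v in ~: A) (k + 1 - n%:R / 20 * weight P Q v)).
    apply: ler_sum => v vA; have := small v vA; have := dB v.
    rewrite mulrBr mulr1 => h1 h2; apply: lerB => //.
    by rewrite ler_wpM2r // /weight addr_ge0 ?ler0n.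
  by rewrite [RHS]sumrB sumr_const; congr (_ - _); rewrite mulr_natl.
have hP : #|P :&: ~: A|%:R <= #|P|%:R :> R by rewrite ler_nat subset_leq_card ?subsetIl.
have hQ : #|Q :&: ~: A|%:R <= #|Q|%:R :> R by rewrite ler_nat subset_leq_card ?subsetIl.
have D0 : 0 <= D%:R :> R by rewrite ler0n.
have n0 : 0 <= n%:R :> R by rewrite ler0n.
move: h sB hF hP hQ; rewrite -/k.
move: (\sum_(v in ~: A) _) (#|P :&: ~: A|%:R) (#|Q :&: ~: A|%:R) => s p' q' h sB hF hP hQ.
have [big|small'] := leP (10 * k) (#|P|%:R + #|Q|%:R).
  have : 0 <= #|uncovered (inner_arcs e (~: A)) P Q|%:R :> R by rewrite ler0n.
  by have := ler_wpM2l D0 big; move: hF; clear; lra.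
have u : n%:R * k / 2 <= #|uncovered (inner_arcs e (~: A)) P Q|%:R.
  have : n%:R / 20 * (p' + q') <= n%:R / 20 * (10 * k).
    by rewrite ler_wpM2l ?divr_ge0 //; move: hP hQ small'; clear; lra.
  by move: h sB k1 n0; clear; nra.
have : 0 <= D%:R * (#|P|%:R + #|Q|%:R) :> R by rewrite mulr_ge0 // addr_ge0 ?ler0n.
by move: u hF k1 Dn; clear; nra.
Qed.

End Counting.

Lemma imbalance_decr (a m : nat) : (a < m)%N ->
  (1 + a - m + (m - (1 + a)) < a - m + (m - a))%N.
Proof. lia. Qed.

Lemma imbalance_compl (a m : nat) : (a <= 2 * m)%N ->
  (2 * m - a - m + (m - (2 * m - a)) = a - m + (m - a))%N.
Proof. lia. Qed.

(** * Choosing a balanced bipartition *)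

Section BipartiteStructure.
Variables (R : realType) (T : finType) (n : nat) (e : rel T).
Hypotheses (es : symmetric e) (ei : irreflexive e) (cT : #|T| = (2 * n)%N).
Hypotheses (reg : forall v, #|nbh e v| = n.+1).
Implicit Types (A S X : {set T}) (x y u v : T) (M : {set T * T}).
Let N : R := n%:R.

Definition bip_core (rho : R) (A0 B0 : {set T}) : Prop :=
  [/\ [disjoint A0 & B0], (1 - rho) * N <= #|A0|%:R, (1 - rho) * N <= #|B0|%:R,
    {in A0, forall v, (1 - rho) * N <= #|nbh e v :&: B0|%:R} &
    {in B0, forall v, (1 - rho) * N <= #|nbh e v :&: A0|%:R}].

Lemma bip_core_sym rho A0 B0 : bip_core rho A0 B0 -> bip_core rho B0 A0.
Proof. by case=> d h1 h2 h3 h4; split=> //; rewrite disjoint_sym. Qed.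

Lemma regR v : #|nbh e v|%:R = N + 1 :> R.
Proof. by rewrite reg natr1. Qed.

(** One part is the set [bip_like] of [x], the other the neighbours of [x] that see nearly all of
    it; double counting bounds the set [Z] of discarded neighbours. *)
Lemma bip_core_exists (eta rho : R) x : 0 < rho <= 1 / 4 -> 0 < eta ->
  100 * eta <= rho ^+ 2 -> 1 <= eta * N ->
  (1 - eta) * N <= #|bip_like e n eta x|%:R -> exists A0 B0, bip_core rho A0 B0.
Proof.
move=> /andP[rho0 rho1] eta0 etarho etaN; set C := bip_like e n eta x => cC.
have eta_rho : 100 * eta <= rho / 4.
  by apply: le_trans etarho _; rewrite expr2 ler_pM2l //; lra.
have N0 : 0 < N.
  by rewrite ltNge; apply/negP => h; have := le_trans etaN (mulr_ge0_le0 (ltW eta0) h); rewrite ler10.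
have rhoN : 100 * (eta * N) <= rho / 4 * N by rewrite mulrA ler_pM2r.
have dCN : [disjoint C & nbh e x].
  by apply/pred0P => y /=; rewrite inE; case: (y \in nbh e x); rewrite ?andbF.
have cCle : #|C|%:R <= N.
  have : (#|C| + #|nbh e x| <= 2 * n)%N.
    by rewrite -cT -cardsUI (disjoint_setI0 dCN) cards0 addn0 max_card.
  by rewrite reg -(ler_nat R) natrD natrM -[n.+1%:R]natr1 -/N; lra.
have inC y : y \in C -> (1 - eta) * N <= #|nbh e y :&: nbh e x|%:R.
  by rewrite inE setIC => /andP[_].
pose B0 := [set v in nbh e x | (1 - rho) * N <= #|nbh e v :&: C|%:R].
have B0N : B0 \subset nbh e x by apply/subsetP => v; rewrite inE => /andP[].
pose Z := nbh e x :\: B0.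
have cZ : #|B0|%:R + #|Z|%:R = N + 1 :> R.
  by rewrite -(regR x) -(cardsID B0 (nbh e x)) (setIidPr B0N) natrD.
have dc : #|C|%:R * ((1 - eta) * N) <= #|B0|%:R * #|C|%:R + #|Z|%:R * ((1 - rho) * N).
  apply: (@le_trans _ _ (\sum_(y in C) #|nbh e y :&: nbh e x|%:R)).
    by rewrite mulr_natl -sumr_const; apply: ler_sum => y /inC.
  rewrite -natr_sum double_count // natr_sum (big_setID B0) /= (setIidPr B0N) -/Z.
  apply: lerD; rewrite mulr_natl -sumr_const; apply: ler_sum => v.
    by rewrite ler_nat subset_leq_card // subsetIr.
  rewrite inE => /andP[+ vx]; rewrite inE vx /= -ltNge; exact: ltW.
have Zle : #|Z|%:R <= rho / 4 * N.
  have h : #|Z|%:R * ((rho - eta) * N) <= 2 * (eta * N) * N.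
    have : #|Z|%:R * (#|C|%:R - (1 - rho) * N) <= #|C|%:R * (1 + eta * N).
      have -> : #|Z|%:R * (#|C|%:R - (1 - rho) * N) = (N + 1) * #|C|%:R -
          (#|B0|%:R * #|C|%:R + #|Z|%:R * ((1 - rho) * N)) by rewrite -cZ; ring.
      by move: dc; lra.
    have : #|Z|%:R * ((rho - eta) * N) <= #|Z|%:R * (#|C|%:R - (1 - rho) * N).
      by rewrite ler_wpM2l ?ler0n //; move: cC; lra.
    have : #|C|%:R * (1 + eta * N) <= N * (2 * (eta * N)).
      apply: ler_pM; rewrite ?ler0n //; move: etaN; lra.
    by lra.
  have h2 : #|Z|%:R * (rho - eta) <= 2 * (eta * N).
    by rewrite -(@ler_pM2r _ N) // -mulrA.
  have z0 : 0 <= #|Z|%:R :> R by rewrite ler0n.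
  have h3 : 100 * (eta * N) <= rho ^+ 2 * N by rewrite mulrA ler_pM2r.
  rewrite -(@ler_pM2r _ (rho / 2)); last by rewrite divr_gt0.
  apply: le_trans (_ : #|Z|%:R * (rho - eta) <= _).
    by rewrite ler_wpM2l //; move: eta_rho rho0; lra.
  apply: le_trans h2 _; have -> : rho / 4 * N * (rho / 2) = rho ^+ 2 * N / 8 by field.
  by move: h3 etaN; lra.
exists C, B0; split.
- by apply: disjointWr B0N dCN.
- by apply: le_trans cC; move: rhoN etaN; lra.
- by move: cZ Zle rhoN etaN; lra.
- move=> y yC; have := inC y yC.
  have : (#|nbh e y :&: nbh e x| <= #|nbh e y :&: B0| + #|Z|)%N.
    apply: leq_trans (leq_card_setU _ _); apply: subset_leq_card; apply/subsetP => z.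
    by move=> /setIP[zy zx]; rewrite in_setU in_setI in_setD zy zx; case: (z \in B0).
  by rewrite -(ler_nat R) natrD; move: Zle rhoN etaN; lra.
- by move=> v; rewrite inE => /andP[].
Qed.

(** The threshold [N / 40] is enough for the closure argument in [S], yet leaves most exceptional
    placements free for balancing the sides. *)
Definition admissible (A0 B0 A : {set T}) : Prop :=
  [/\ A0 \subset A, B0 \subset ~: A,
    {in A, forall v, N / 40 <= #|nbh e v :&: B0|%:R} &
    {in ~: A, forall v, N / 40 <= #|nbh e v :&: A0|%:R}].

Lemma admissible_sym A0 B0 A : admissible A0 B0 A -> admissible B0 A0 (~: A).
Proof. by case=> h1 h2 h3 h4; split; rewrite ?setCK. Qed.

Lemma core_rest rho A0 B0 v : bip_core rho A0 B0 ->
  N + 1 - 2 * (rho * N) <= #|nbh e v :&: A0|%:R + #|nbh e v :&: B0|%:R.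
Proof.
case=> d hA hB _ _; have cX : #|~: (A0 :|: B0)|%:R <= 2 * (rho * N).
  have h : (#|A0| + #|B0| + #|~: (A0 :|: B0)| = 2 * n)%N.
    by rewrite -cT -(cardsC (A0 :|: B0)) cardsU (disjoint_setI0 d) cards0 subn0.
  have : #|A0|%:R + #|B0|%:R + #|~: (A0 :|: B0)|%:R = 2 * N by rewrite -!natrD h natrM.
  by move: hA hB; lra.
have : (#|nbh e v| <= #|nbh e v :&: A0| + #|nbh e v :&: B0| + #|~: (A0 :|: B0)|)%N.
  apply: leq_trans (leq_add (leq_card_setU _ _) (leqnn _)).
  apply: leq_trans (leq_card_setU _ _); apply: subset_leq_card; apply/subsetP => z vz.
  by rewrite !in_setU !in_setI in_setC in_setU vz; case: (z \in A0); case: (z \in B0).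
by rewrite -(ler_nat R) !natrD regR; move: cX; lra.
Qed.

Definition imbalance A := ((#|A| - n) + (n - #|A|))%N.

(* Moving a flexible vertex to the smaller side would improve the balance. *)
Lemma balanced_inner rho A0 B0 A : 0 < rho <= 1 / 1000 -> 1 <= rho * N ->
  bip_core rho A0 B0 -> admissible A0 B0 A ->
  (forall A', admissible A0 B0 A' -> (imbalance A <= imbalance A')%N) ->
  (#|A| < n)%N -> {in ~: A, forall v, #|nbh e v :&: ~: A|%:R <= N / 20}.
Proof.
move=> /andP[rho0 rho1] rhoN core adm min An v vA.
have N0 : 0 < N by rewrite ltr0n; apply: leq_ltn_trans An.
have rN : rho * N <= N / 1000 by rewrite mulrC ler_pM2l //; lra.
have [A0A B0A dA dB] := adm.
have nvA : #|nbh e v :&: ~: A|%:R <= N + 1 - #|nbh e v :&: A0|%:R.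
  have : (#|nbh e v :&: A0| + #|nbh e v :&: ~: A| <= #|nbh e v|)%N.
    rewrite -setDE -(cardsID A (nbh e v)) leq_add2r.
    by apply: subset_leq_card; apply: setIS.
  by rewrite -(ler_nat R) natrD regR; lra.
have [vB|vB] := boolP (v \in B0).
  have [_ _ _ _ h] := core; have := h v vB.
  by move: nvA rN rhoN; lra.
have rest := core_rest v core.
(* With fewer than [N / 40] neighbours in [B0], nearly all neighbours of [v] lie in [A0] and the
   bound holds outright. *)
have [flex|] := leP (N / 40) #|nbh e v :&: B0|%:R; last first.
  by move: nvA rest rN rhoN; lra.
have vnA : v \notin A by rewrite inE in vA.
have adm' : admissible A0 B0 (v |: A).
  split.
  - by apply: subset_trans A0A _; apply: subsetUr.
  - apply/subsetP => z zB; rewrite in_setC in_setU1 negb_or -in_setC (subsetP B0A) // andbT.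
    by apply: contraNneq vB => <-.
  - by move=> z /setU1P[->|/dA].
  - move=> z; rewrite in_setC in_setU1 negb_or => /andP[_ zA]; apply: dB.
    by rewrite in_setC.
by have := min _ adm'; rewrite /imbalance cardsU1 vnA leqNgt imbalance_decr.
Qed.

(** Take an admissible partition of least imbalance, and exchange the sides if [A] is the larger
    one. *)
Lemma bip_partition (rho : R) A0 B0 : 0 < rho <= 1 / 1000 -> 1 <= rho * N ->
  bip_core rho A0 B0 ->
  exists A0' B0' A, [/\ bip_core rho A0' B0', admissible A0' B0' A, (#|A| <= n)%N &
    (#|A| < n)%N -> {in ~: A, forall v, #|nbh e v :&: ~: A|%:R <= N / 20}].
Proof.
move=> rhoP rhoN core; have /andP[rho0 rho1] := rhoP.
have N0 : 0 < N.
  by rewrite ltNge; apply/negP => h; have := le_trans rhoN (mulr_ge0_le0 (ltW rho0) h); rewrite ler10.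
have rN : rho * N <= N / 1000 by rewrite mulrC ler_pM2l //; lra.
have [d cA cB dA dB] := core.
(* An admissible partition exists because, by [core_rest], no vertex has few neighbours in both
   cores. *)
pose A1 := ~: B0 :&: [set v | N / 40 <= #|nbh e v :&: B0|%:R].
have adm1 : admissible A0 B0 A1.
  split.
  - apply/subsetP => v vA; rewrite in_setI in_setC (disjointFr d vA) /= inE.
    by apply: le_trans (dA v vA); move: rN N0; lra.
  - by apply/subsetP => v vB; rewrite in_setC in_setI in_setC vB.
  - by move=> v; rewrite in_setI => /andP[_]; rewrite inE.
  - move=> v; rewrite in_setC in_setI negb_and in_setC negbK => /orP[vB|].
      by apply: le_trans (dB v vB); move: rN N0; lra.
    rewrite inE -ltNge => lt; have := core_rest v core.
    by move: lt rN N0; lra.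
have ex : exists m, `[< exists2 A, admissible A0 B0 A & imbalance A = m >].
  by exists (imbalance A1); apply/asboolP; exists A1.
have [m /asboolP[A adm Am] mmin] := ex_minnP ex.
have min A' : admissible A0 B0 A' -> (imbalance A <= imbalance A')%N.
  by move=> adm'; rewrite Am; apply: mmin; apply/asboolP; exists A'.
have [An|nA] := leqP #|A| n.
  by exists A0, B0, A; split => // lt; apply: (balanced_inner rhoP rhoN core adm min lt).
have cC X : (#|~: X| = 2 * n - #|X|)%N by rewrite -cT -(cardsC X) addKn.
have leX X : (#|X| <= 2 * n)%N by rewrite -cT max_card.
have im X : imbalance (~: X) = imbalance X.
  by rewrite /imbalance cC imbalance_compl.
exists B0, A0, (~: A); split.
- exact: bip_core_sym.
- exact: admissible_sym.
- by rewrite cC leq_subLR mul2n -addnn leq_add2r ltnW.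
- move=> lt; apply: (balanced_inner rhoP rhoN (bip_core_sym core) (admissible_sym adm) _ lt).
  move=> A' /admissible_sym adm'; rewrite im -(im A'); exact: min.
Qed.

Lemma card_subset X m : (m <= #|X|)%N -> exists2 Y : {set T}, Y \subset X & #|Y| = m.
Proof.
move=> mX; exists [set z in take m (enum X)].
  by apply/subsetP => z; rewrite inE => /mem_take; rewrite mem_enum.
by rewrite cardsE (card_uniqP (take_uniq _ (enum_uniq _))) size_takel // -cardE.
Qed.

End BipartiteStructure.

Section BipartiteCase.
Variable R : realType.

Definition bip_probe (T : finType) (e : rel T) (A A0 B0 : {set T}) (i : T * 'I_6) : {set T} :=
  if i.2 == 0 :> nat then nbh e i.1 :&: A
  else if i.2 == 1 :> nat then nbh e i.1 :&: ~: A
  else if i.2 == 2 :> nat then A else if i.2 == 3 :> nat then ~: A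
  else if i.2 == 4 :> nat then A0 else B0.

Definition keeps_forest (T : finType) (e : rel T) (A : {set T}) (t : R) (S : {set T}) : Prop :=
  exists M, [/\ forest M, M \subset inner_arcs e A, M \subset setX S S & t <= #|M|%:R].

(** The surviving forest is truncated to exactly the difference of the sides, as
    [ham_near_bipartite] requires. *)
Lemma bip_ham (T : finType) (e : rel T) (n : nat) (A A0 B0 S : {set T}) :
  symmetric e -> irreflexive e -> #|T| = (2 * n)%N -> 1000 <= n%:R :> R ->
  bip_core n e (1 / 1000 : R) A0 B0 -> admissible R n e A0 B0 A ->
  ~ atypical (bip_probe e A A0 B0) ((1 / 1000 : R) * n%:R) S ->
  (#|S :&: A| <= #|S :\: A|)%N ->
  keeps_forest e (~: A) (#|S :\: A|%:R - #|S :&: A|%:R) S -> ham e S.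
Proof.
move=> es ei cT n1000 [_ cA0 cB0 dA0 dB0] [A0A B0A dA dB] /typical_dev dev le_ab.
move=> [M0 [fM0 M0A M0S M0c]].
have [M MM0 cM] : exists2 M : {set T * T}, M \subset M0 & #|M| = (#|S :\: A| - #|S :&: A|)%N.
  by apply: card_subset; rewrite -(ler_nat R) natrB.
have cMR : #|M|%:R = #|S :\: A|%:R - #|S :&: A|%:R :> R by rewrite cM natrB.
have dev0 v := dev (v, @Ordinal 6 0 isT).
have dev1 v := dev (v, @Ordinal 6 1 isT).
have [x0 _] : exists x0 : T, x0 \in T.
  by apply/card_gt0P; rewrite cT muln_gt0 /= -(ltr_nat R); apply: lt_le_trans n1000.
have := dev (x0, @Ordinal 6 5 isT); have := dev (x0, @Ordinal 6 4 isT).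
have := dev (x0, @Ordinal 6 3 isT); have := dev (x0, @Ordinal 6 2 isT).
rewrite /bip_probe /= in dev0 dev1 *; move=> /andP[sA1 sA] /andP[sB1 sB] /andP[sGA _] /andP[sGB _].
have SD : S :\: A = S :&: ~: A by rewrite setDE.
have sizes : #|A|%:R + #|~: A|%:R = 2 * n%:R :> R by rewrite -natrD cardsC cT natrM.
have A0le : #|A0|%:R <= #|A|%:R :> R by rewrite ler_nat subset_leq_card.
have B0le : #|B0|%:R <= #|~: A|%:R :> R by rewrite ler_nat subset_leq_card.
(* With deviations [n / 1000], core vertices keep [(999 - 1) / 2000 * n] neighbours across, all
   others [(25 - 1) / 2000 * n]. *)
pose dg := Num.truncn (499 / 1000 * n%:R : R); pose db := Num.truncn (12 / 1000 * n%:R : R).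
have dgle : dg%:R <= 499 / 1000 * n%:R :> R by rewrite truncn_le; move: n1000; clear; lra.
have dble : db%:R <= 12 / 1000 * n%:R :> R by rewrite truncn_le; move: n1000; clear; lra.
have dbgt : 12 / 1000 * n%:R - 1 < db%:R :> R by rewrite ltrBlDr natr1; apply: truncnS_gt.
have dggt : 499 / 1000 * n%:R - 1 < dg%:R :> R by rewrite ltrBlDr natr1; apply: truncnS_gt.
have inSA (X : {set T}) : X :&: (S :&: A) = X :&: A :&: S by rewrite [S :&: A]setIC setIA.
have inSB (X : {set T}) : X :&: (S :&: ~: A) = X :&: ~: A :&: S by rewrite [S :&: _]setIC setIA.
have monoA v : #|nbh e v :&: A0|%:R <= #|nbh e v :&: A|%:R :> R.
  by rewrite ler_nat subset_leq_card // setIS.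
have monoB v : #|nbh e v :&: B0|%:R <= #|nbh e v :&: ~: A|%:R :> R.
  by rewrite ler_nat subset_leq_card // setIS.
have sMb : #|M|%:R <= 2 / 1000 * n%:R :> R.
  rewrite cMR SD ![S :&: _]setIC; move: sA1 sA sB1 sB sizes A0le B0le cA0 cB0; clear; lra.
have M2 : #|S :&: A|%:R + 2 * #|M|%:R <= 505 / 1000 * n%:R :> R.
  rewrite [S :&: _]setIC; move: sMb sA sizes B0le cB0; clear; lra.
apply: (@ham_near_bipartite _ e S A (S :&: A0) (S :&: B0) M dg db es ei).
- exact: forest_sub MM0 fM0.
- apply/subsetP => p pM; have := subsetP M0S p (subsetP MM0 p pM).
  have := subsetP M0A p (subsetP MM0 p pM); rewrite inE => /and3P[]; rewrite !in_setC => p1 p2 _.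
  by rewrite inE => /andP[q1 q2]; rewrite inE !in_setD p1 p2 q1 q2.
- by move=> p pM; have := subsetP M0A p (subsetP MM0 p pM); rewrite inE => /and3P[].
- by rewrite cM subnKC.
- rewrite -(ltr_nat R) [S :&: _]setIC; move: sA1 A0le cA0 n1000; clear; lra.
- exact: setIS.
- by rewrite SD setIS.
- move=> g /setIP[_ gG]; rewrite -(ler_nat R) SD inSB //.
  have /andP[h _] := dev1 g; have h2 := dA0 g gG; have h3 := monoB g.
  by move: h h2 h3 dgle; clear; lra.
- move=> g /setIP[_ gG]; rewrite -(ler_nat R) inSA //.
  have /andP[h _] := dev0 g; have h2 := dB0 g gG; have h3 := monoA g.
  by move: h h2 h3 dgle; clear; lra.
- move=> v /setIP[_ vA]; rewrite -(ler_nat R) SD inSB //.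
  have /andP[h _] := dev1 v; have h2 := dA v vA; have h3 := monoB v.
  by move: h h2 h3 dble n1000; clear; lra.
- move=> v; rewrite SD => /setIP[_ vA]; rewrite -(ler_nat R) inSA //.
  have /andP[h _] := dev0 v; have h2 := dB v vA; have h3 := monoA v.
  by move: h h2 h3 dble n1000; clear; lra.
- rewrite -(ltr_nat R) natrD natrM natrD; apply: le_lt_trans M2 _.
  by move: dggt dbgt n1000; clear; lra.
- rewrite -(ltr_nat R) natrD natrM natrD; apply: le_lt_trans M2 _.
  rewrite ![S :&: _]setIC; move: sGA sGB cA0 cB0 n1000; clear; lra.
Qed.

Lemma bip_probe_sym (T : finType) (e : rel T) (A A0 B0 : {set T}) (E : R) S :
  atypical (bip_probe e (~: A) B0 A0) E S -> atypical (bip_probe e A A0 B0) E S.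
Proof.
move=> [[v [i i6]]]; rewrite /bip_probe /= setCK.
case: i i6 => [|[|[|[|[|[|//]]]]]] i6 h.
- by exists (v, @Ordinal 6 1 isT).
- by exists (v, @Ordinal 6 0 isT).
- by exists (v, @Ordinal 6 3 isT).
- by exists (v, @Ordinal 6 2 isT).
- by exists (v, @Ordinal 6 5 isT).
- by exists (v, @Ordinal 6 4 isT).
Qed.

(** The shifted surplus of [symdiff A S] is the difference of the sides of [S]; its sign decides
    which side has to supply the forest. *)
Lemma bip_ham_surplus (T : finType) (e : rel T) (n : nat) (A A0 B0 S : {set T}) (tA tB : R) :
  symmetric e -> irreflexive e -> #|T| = (2 * n)%N -> 1000 <= n%:R :> R ->
  bip_core n e (1 / 1000 : R) A0 B0 -> admissible R n e A0 B0 A ->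
  ~ atypical (bip_probe e A A0 B0) ((1 / 1000 : R) * n%:R) S ->
  keeps_forest e A tA S -> keeps_forest e (~: A) tB S ->
  (0 <= n%:R - #|A|%:R + surplus R n (symdiff A S) ->
     n%:R - #|A|%:R + surplus R n (symdiff A S) <= tB) ->
  (n%:R - #|A|%:R + surplus R n (symdiff A S) <= 0 ->
     - (n%:R - #|A|%:R + surplus R n (symdiff A S)) <= tA) -> ham e S.
Proof.
move=> es ei cT n1000 core adm ty fA fB.
have -> : n%:R - #|A|%:R + surplus R n (symdiff A S) = #|S :\: A|%:R - #|S :&: A|%:R.
  have := card_symdiff A S; move/(congr1 (fun i => i%:R : R)); rewrite !natrD /surplus; lra.
have weaken (X : {set T}) t t' : t' <= t -> keeps_forest e X t S -> keeps_forest e X t' S.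
  by move=> tt [M [h1 h2 h3 h4]]; exists M; split=> //; apply: le_trans h4.
have [le_ab|lt_ba] := leqP #|S :&: A| #|S :\: A|.
  rewrite subr_ge0 ler_nat => /(_ le_ab) hB _.
  exact: (bip_ham es ei cT n1000 core adm ty le_ab (weaken _ _ _ hB fB)).
rewrite subr_le0 ler_nat opprB => _ /(_ (ltnW lt_ba)) hA.
have SA : S :\: ~: A = S :&: A by rewrite setDE setCK.
apply: (bip_ham es ei cT n1000 (bip_core_sym core) (admissible_sym adm)).
- by move=> /bip_probe_sym.
- by rewrite SA -setDE ltnW.
- by rewrite SA -setDE setCK; apply: weaken hA fA.
Qed.

End BipartiteCase.

(** * Windows for the surplus in the nearly bipartite case *)

Section Regimes.
Variable R : realType.

Lemma pr_positive_regime (T : finType) (n : nat) (C : R) : (0 < n)%N -> #|T| = (2 * n)%N ->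
  0 < C -> 1 / 2 - 1 / (4 * C ^+ 2) <=
    uniform_pr R (fun S : {set T} => 0 <= surplus R n S <= C * Num.sqrt n%:R).
Proof.
move=> n0 cT C0; have w0 : 0 < Num.sqrt n%:R :> R by rewrite sqrtr_gt0 ltr0n.
have w2 : Num.sqrt n%:R ^+ 2 = n%:R :> R by rewrite sqr_sqrtr ?ler0n.
have [_ half] := pr_surplus_sym R cT n0.
have tl := surplus_tail1 cT (mulr_gt0 C0 w0).
have e : n%:R / (4 * (C * Num.sqrt n%:R) ^+ 2) = 1 / (4 * C ^+ 2).
  by rewrite -{1}w2; field; rewrite !gt_eqF.
have : uniform_pr R (fun S : {set T} => 0 <= surplus R n S) -
    uniform_pr R (fun S : {set T} => C * Num.sqrt n%:R < surplus R n S) <=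
    uniform_pr R (fun S : {set T} => 0 <= surplus R n S <= C * Num.sqrt n%:R).
  by apply: pr_diff => S ->; case: leP; [left|right].
by move: half tl; rewrite e; clear; lra.
Qed.

Lemma pr_negative_regime (T : finType) (n : nat) (C c : R) : (0 < n)%N -> #|T| = (2 * n)%N ->
  0 < C -> 0 <= c -> 1 / 2 - 1 / (4 * C ^+ 2) - c - 2 / Num.sqrt n%:R <=
    uniform_pr R (fun S : {set T} =>
      - (C * Num.sqrt n%:R) <= surplus R n S <= - (c * Num.sqrt n%:R)).
Proof.
move=> n0 cT C0 c0; have w0 : 0 < Num.sqrt n%:R :> R by rewrite sqrtr_gt0 ltr0n.
have w2 : Num.sqrt n%:R ^+ 2 = n%:R :> R by rewrite sqr_sqrtr ?ler0n.
have hn := negative_part cT n0 (mulr_gt0 C0 w0).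
have hw := negative_window cT n0 (mulr_ge0 c0 (ltW w0)).
have e : n%:R / (4 * (C * Num.sqrt n%:R) ^+ 2) = 1 / (4 * C ^+ 2).
  by rewrite -{1}w2; field; rewrite !gt_eqF.
have e2 : (c * Num.sqrt n%:R + 1) / Num.sqrt n%:R = c + (Num.sqrt n%:R)^-1.
  by field; rewrite gt_eqF.
have : uniform_pr R (fun S : {set T} => - (C * Num.sqrt n%:R) <= surplus R n S < 0) -
    uniform_pr R (fun S : {set T} => - (c * Num.sqrt n%:R) < surplus R n S < 0) <=
    uniform_pr R (fun S : {set T} =>
      - (C * Num.sqrt n%:R) <= surplus R n S <= - (c * Num.sqrt n%:R)).
  by apply: pr_diff => S /andP[-> ->] /=; case: leP; [left|right].
have wi : 0 < (Num.sqrt n%:R)^-1 :> R by rewrite invr_gt0.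
move: hn hw wi; rewrite e e2; clear; lra.
Qed.

Lemma forest0 (T : finType) : forest (set0 : {set T * T}).
Proof. by exists (fun=> 0%N); split=> p; rewrite inE. Qed.

Definition forest_sampler (g c0 : R) : Prop :=
  forall (T : finType) (F : {set T * T}) (D : nat) (phi : R),
    {in F, forall p, p.1 != p.2} ->
    (forall u, outdeg F u <= D)%N -> (forall v, indeg F v <= D)%N ->
    c0 <= D%:R -> c0 <= phi -> D%:R * phi <= #|F|%:R ->
    uniform_pr R (fun S : {set T} => ~ exists M, [/\ forest M, M \subset F,
        M \subset setX S S & (1 - g) * phi / 2 <= #|M|%:R]) <= g.

(** Nearly half of [#|F| / D] survives as a forest in [S]; a non-positive demand [t] is met by the
    empty forest. *)
Lemma pr_keeps_forest (g c0 : R) (T : finType) (e : rel T) (A : {set T})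
    (F : {set T * T}) (D : nat) (t : R) :
  forest_sampler g c0 -> 0 <= g -> irreflexive e -> F \subset inner_arcs e A ->
  (forall u, outdeg F u <= D)%N -> (forall v, indeg F v <= D)%N -> c0 <= D%:R -> 0 < D%:R :> R ->
  t <= 0 \/ c0 * D%:R <= #|F|%:R /\ t * D%:R <= (1 - g) * #|F|%:R / 2 ->
  uniform_pr R (fun S => ~ keeps_forest e A t S) <= g.
Proof.
move=> samp g0 ei FA Fo Fi cD D0 [t0|[cF tF]].
  apply: le_trans g0; rewrite pr_neg ?card_set_gt0 // subr_le0.
  rewrite (pr_true R (card_set_gt0 T)) // => S.
  exists set0; split; rewrite ?sub0set ?cards0 //; exact: forest0.
have Firr : {in F, forall p, p.1 != p.2}.
  move=> p /(subsetP FA); rewrite inE => /and3P[_ _]; apply: contraTneq => ->.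
  by rewrite ei.
have phiF : D%:R * (#|F|%:R / D%:R) <= #|F|%:R :> R by rewrite mulrC divfK // gt_eqF.
have cphi : c0 <= #|F|%:R / D%:R by rewrite ler_pdivlMr.
apply: le_trans (samp T F D _ Firr Fo Fi cD cphi phiF).
apply: pr_mono => S nk [M [h1 h2 h3 h4]]; apply: nk; exists M; split=> //.
  exact: subset_trans h2 FA.
apply: le_trans h4; rewrite -(@ler_pM2r _ D%:R) //.
suff -> : (1 - g) * (#|F|%:R / D%:R) / 2 * D%:R = (1 - g) * #|F|%:R / 2 by [].
by field; rewrite gt_eqF.
Qed.

(** As [symdiff A S] is uniform, it suffices to find a window of probability almost 1/2 in which the
    demands on both sides are met. *)
Lemma bip_regime (n : nat) (T : finType) (e : rel T) (A A0 B0 : {set T}) (th tA tB lo hi : R) :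
  symmetric e -> irreflexive e -> #|T| = (2 * n)%N -> 1000 <= n%:R :> R ->
  bip_core n e (1 / 1000 : R) A0 B0 -> admissible R n e A0 B0 A ->
  uniform_pr R (atypical (bip_probe e A A0 B0) ((1 / 1000 : R) * n%:R)) <= th / 8 ->
  uniform_pr R (fun S => ~ keeps_forest e A tA S) <= th / 8 ->
  uniform_pr R (fun S => ~ keeps_forest e (~: A) tB S) <= th / 8 ->
  (forall s, lo <= s <= hi -> 0 <= n%:R - #|A|%:R + s -> n%:R - #|A|%:R + s <= tB) ->
  (forall s, lo <= s <= hi -> n%:R - #|A|%:R + s <= 0 -> - (n%:R - #|A|%:R + s) <= tA) ->
  1 / 2 - th / 2 <= uniform_pr R (fun S : {set T} => lo <= surplus R n S <= hi) ->
  1 / 2 - th <= uniform_pr R (ham e).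
Proof.
move=> es ei cT n1000 core adm p1 p2 p3 hB hA hs.
have th0 : 0 <= th by have := pr_ge0 R (fun S => ~ keeps_forest e A tA S); move: p2; clear; lra.
rewrite -(pr_inj R (fun S => lo <= surplus R n S <= hi) (inv_inj (@symdiffK _ A))) in hs.
pose bad S := atypical (bip_probe e A A0 B0) ((1 / 1000 : R) * n%:R) S \/
  (~ keeps_forest e A tA S \/ ~ keeps_forest e (~: A) tB S).
have pbad : uniform_pr R bad <= th / 8 + (th / 8 + th / 8).
  apply: le_trans (pr_or R _ _) (lerD p1 _).
  exact: le_trans (pr_or R _ _) (lerD p2 p3).
have : uniform_pr R (fun S => lo <= surplus R n (symdiff A S) <= hi) - uniform_pr R bad <=
    uniform_pr R (ham e).
  apply: pr_diff => S sS; have [b|nb] := pselect (bad S); [by right|left].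
  have kA : keeps_forest e A tA S by apply: contrapT => h; apply: nb; right; left.
  have kB : keeps_forest e (~: A) tB S by apply: contrapT => h; apply: nb; right; right.
  have ty : ~ atypical (bip_probe e A A0 B0) ((1 / 1000 : R) * n%:R) S.
    by move=> h; apply: nb; left.
  exact: (bip_ham_surplus es ei cT n1000 core adm ty kA kB (hB _ sS) (hA _ sS)).
by move: hs pbad th0; clear; lra.
Qed.

(** Negative surpluses suffice if [A] carries a large flow or is much smaller than its complement,
    positive ones if the complement carries a large flow. Otherwise both flows are small and
    [cover_inequality] supplies a two-sided window. *)
Lemma bip_case (eta theta : R) : 0 < eta -> 100 * eta <= (1 / 1000) ^+ 2 -> 0 < theta ->
  exists n0 : nat, forall (n : nat) (T : finType) (e : rel T),
  (n0 <= n)%N -> #|T| = (2 * n)%N -> symmetric e -> irreflexive e ->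
  (forall x, #|nbh e x| = n.+1) ->
  (exists x, (1 - eta) * n%:R <= #|bip_like e n eta x|%:R) ->
  1 / 2 - theta <= uniform_pr R (ham e).
Proof.
move=> eta0 etarho th0.
have th2 : 0 < theta / 2 by rewrite divr_gt0.
have th8 : 0 < theta / 8 by rewrite divr_gt0.
have [gam [/andP[gam0 gam16] [n1 hn1]]] := interval_prob th2.
have r1000 : 0 < 1 / 1000 :> R by rewrite divr_gt0 ?ltr0n.
have [n2 hn2] := pr_atypical r1000 th8.
have [n3 hn3] := eventually_ge (1 / eta).
(* Beyond [C * sqrt n] a one-sided tail of the surplus has probability at most [theta / 16]. *)
pose C := 4 / theta + 1.
have C1 : 1 <= C by rewrite lerDr divr_ge0 // ltW.
have C0 : 0 < C by apply: lt_le_trans C1.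
have Cth : 1 / (4 * C ^+ 2) <= theta / 16.
  have h : 4 <= C * theta by rewrite mulrDl mul1r divfK ?gt_eqF // lerDl ltW.
  rewrite ler_pdivrMr ?mulr_gt0 ?exprn_gt0 //.
  have : C * theta <= C * (C * theta) by rewrite ler_peMl // mulr_ge0 ?ltW.
  have -> : theta / 16 * (4 * C ^+ 2) = C * (C * theta) / 4 by field.
  by move: h; clear; lra.
(* The last condition bounds the sampling loss for flows up to [8 * (C * w) * D] by [gam * w] arcs
   of the forest, the slack left by [interval_prob]. *)
have [g [g0 g4 gth gC]] : exists g : R, [/\ 0 < g, g <= 1 / 4, g <= theta / 8 & g * (4 * C) <= gam].
  exists (Num.min (1 / 4) (Num.min (theta / 8) (gam / (4 * C)))).
  have C40 : 0 < 4 * C by rewrite mulr_gt0.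
  split.
  - by rewrite !lt_min th8 !divr_gt0 ?mulr_gt0.
  - by rewrite ge_min lexx.
  - by rewrite !ge_min lexx orbT.
  - by rewrite -ler_pdivlMr // !ge_min lexx !orbT.
have g01 : 0 < g < 1 by rewrite g0 /=; move: g4; clear; lra.
have [c0 [c00 samp]] := forest_sampling g01.
have {}samp : forest_sampler g c0 := samp.
(* With [D] about [del * w], a flow of size [8 * (C * w) * D], and hence the uncovered arcs below
   it, number at most [gam * n]. *)
have [del [del0 del1 delC]] : exists del : R, [/\ 0 < del, del <= 1 & 8 * C * del <= gam].
  exists (gam / (8 * C)); have C80 : 0 < 8 * C by rewrite mulr_gt0.
  split; rewrite ?divr_gt0 //; last by rewrite mulrC divfK ?gt_eqF.
  by rewrite ler_pdivrMr //; move: gam16 C1; clear; lra.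
(* Surpluses between [- c w] and 0 are given up. For [k <= c w] the larger side then needs no
   forest, and for larger [k] its flow exceeds the threshold of the sampler. *)
pose c := theta / 16.
have cp : 0 < c by rewrite divr_gt0.
pose K := 1000 + (c0 + 1) / del + c0 / gam + c0 / c + 32 / theta.
have [n4 hn4] := eventually_sqrt_ge K.
exists (n1 + n2 + n3 + n4)%N => n T e nn cT es ei reg [x hx].
have [nn1 nn2 nn3 nn4] : [/\ n1 <= n, n2 <= n, n3 <= n & n4 <= n]%N.
  by move: nn; clear; split; lia.
pose w : R := Num.sqrt n%:R.
have wK : K <= w := hn4 n nn4.
have t1 : 0 <= (c0 + 1) / del by rewrite divr_ge0 ?addr_ge0 ?ltW.
have t2 : 0 <= c0 / gam by rewrite divr_ge0 ?ltW.
have t3 : 0 <= c0 / c by rewrite divr_ge0 ?ltW.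
have t4 : 0 <= 32 / theta by rewrite divr_ge0 ?ltW ?ltr0n.
have w1000 : 1000 <= w by move: wK t1 t2 t3 t4; rewrite /K; clear; lra.
have wdel : c0 + 1 <= del * w.
  by rewrite mulrC -ler_pdivrMr //; move: wK t1 t2 t3 t4; rewrite /K; clear; lra.
have wgam : c0 <= gam * w.
  by rewrite mulrC -ler_pdivrMr //; move: wK t1 t2 t3 t4; rewrite /K; clear; lra.
have wc : c0 <= c * w.
  by rewrite mulrC -ler_pdivrMr //; move: wK t1 t2 t3 t4; rewrite /K; clear; lra.
have w32 : 2 / w <= theta / 16.
  have : 32 <= theta * w.
    by rewrite mulrC -ler_pdivrMr //; move: wK t1 t2 t3 t4; rewrite /K; clear; lra.
  by rewrite ler_pdivrMr; move: w1000; clear; lra.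
clear wK t1 t2 t3 t4 hn4 nn.
have w0 : 0 < w by move: w1000; clear; lra.
have n0 : (0 < n)%N by move: w0; rewrite sqrtr_gt0 ltr0n.
have w2 : w * w = n%:R by rewrite -expr2 sqr_sqrtr ?ler0n.
have n1000 : 1000 <= n%:R :> R by rewrite -w2; move: w1000; clear; nra.
have etaN : 1 <= eta * n%:R by rewrite mulrC -ler_pdivrMr // hn3.
have rhoP : 0 < (1 / 1000 : R) <= 1 / 4 by rewrite r1000 /=; clear; lra.
have rhoP' : 0 < (1 / 1000 : R) <= 1 / 1000 by rewrite r1000 /=.
have rhoN : 1 <= (1 / 1000 : R) * n%:R by move: n1000; clear; lra.
have [A1 [B1 core1]] := bip_core_exists es cT reg rhoP eta0 etarho etaN hx.
have [A0 [B0 [A [core adm An small]]]] := bip_partition cT reg rhoP' rhoN core1.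
pose D := Num.truncn (del * w).
have Dle : D%:R <= del * w by rewrite truncn_le mulr_ge0 ?ltW.
have Dge : c0 <= D%:R.
  by have : del * w - 1 < D%:R; [rewrite ltrBlDr natr1; apply: truncnS_gt|move: wdel; clear; lra].
have D0 : 0 < D%:R :> R by apply: lt_le_trans Dge.
have Dn : 20 * D%:R <= n%:R :> R.
  by rewrite -w2; move: Dle del1 w1000 del0; clear; nra.
have [FA [PA [QA [FAA FAo FAi cutA]]]] := max_flow_min_cut D (inner_arcs e A).
have [FB [PB [QB [FBB FBo FBi cutB]]]] := max_flow_min_cut D (inner_arcs e (~: A)).
have p1 : uniform_pr R (atypical (bip_probe e A A0 B0) ((1 / 1000 : R) * n%:R)) <= theta / 8.
  apply: hn2 => //; rewrite card_prod card_ord cT; clear - n0; nia.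
pose k : R := n%:R - #|A|%:R.
have k0 : 0 <= k by rewrite subr_ge0 ler_nat.
pose fA : R := #|FA|%:R; pose fB : R := #|FB|%:R.
have fA0 : 0 <= fA by rewrite ler0n.
have fB0 : 0 <= fB by rewrite ler0n.
have kF : 0 < k -> D%:R * (10 * k) <= fB.
  rewrite subr_gt0 ltr_nat => lt; exact: (large_flow cT reg es lt Dn (small lt) cutB).
have okA t : t <= 0 \/ c0 * D%:R <= fA /\ t * D%:R <= (1 - g) * fA / 2 ->
    uniform_pr R (fun S => ~ keeps_forest e A t S) <= theta / 8.
  move=> h; apply: le_trans gth.
  exact: (pr_keeps_forest samp (ltW g0) ei FAA FAo FAi Dge D0 h).
have okB t : t <= 0 \/ c0 * D%:R <= fB /\ t * D%:R <= (1 - g) * fB / 2 ->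
    uniform_pr R (fun S => ~ keeps_forest e (~: A) t S) <= theta / 8.
  move=> h; apply: le_trans gth.
  exact: (pr_keeps_forest samp (ltW g0) ei FBB FBo FBi Dge D0 h).
have fin tA tB lo hi := bip_regime (th := theta) (tA := tA) (tB := tB) (lo := lo) (hi := hi)
  es ei cT n1000 core adm p1.
have Cw : w <= C * w by rewrite ler_peMl // ltW.
have Cw0 : 0 < C * w by rewrite mulr_gt0.
have cw_small : c0 <= 8 * (C * w).
  have : gam * w <= 1 * w by rewrite ler_pM2r //; move: gam16; clear; lra.
  by move: wgam Cw Cw0; clear; lra.
have big_ok f : 8 * (C * w) * D%:R < f ->
    c0 * D%:R <= f /\ 2 * (C * w) * D%:R <= (1 - g) * f / 2.
  move=> h; split.
    by apply: le_trans (ltW h); rewrite ler_pM2r.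
  have CD : 0 < C * w * D%:R by rewrite mulr_gt0.
  have : 3 / 4 * f <= (1 - g) * f.
    by rewrite ler_wpM2r; move: h g4 CD; clear; lra.
  by move: h CD; clear; lra.
(* In the window [[- C w, - c w]] a positive difference is at most [k], which [large_flow] provides;
   a negative one requires [k < C w], and then [A] carries the large flow. *)
have [R2|nR2] := boolP ((8 * (C * w) * D%:R < fA) || (C * w <= k)).
  pose tA := if 8 * (C * w) * D%:R < fA then 2 * (C * w) else 0.
  pose tB := if k <= c * w then 0 else k.
  apply: (fin tA tB (- (C * w)) (- (c * w))).
  - by apply: okA; rewrite /tA; case: ifP => [/big_ok|_]; [right|left].
  - apply: okB; rewrite /tB; case: (leP k (c * w)) => [_|kc]; [by left|right].
    have kp : 0 < k by apply: (lt_trans _ kc); rewrite mulr_gt0.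
    have h := kF kp; split.
      apply: le_trans h; rewrite mulrC ler_pM2l //; move: wc kc kp; clear; lra.
    have : 3 / 4 * fB <= (1 - g) * fB by rewrite ler_wpM2r //; move: g4; clear; lra.
    have : 0 < D%:R * k by rewrite mulr_gt0.
    by move: h; clear; lra.
  - move=> s /andP[s1 s2]; rewrite -/k /tB => _; case: (leP k (c * w)) => kc; move: s2 kc (ltW (mulr_gt0 cp w0)); clear; lra.
  - move=> s /andP[s1 s2]; rewrite -/k /tA => ks; move: R2; case: ifP => /= _.
      by move=> _; move: s1 k0 Cw0; clear; lra.
    by move: s1 ks; clear; lra.
  - apply: le_trans (pr_negative_regime n0 cT C0 (ltW cp)).
    by rewrite -/w; move: Cth w32 th0; rewrite /c; clear; lra.
move: nR2; rewrite negb_or -leNgt -ltNge => /andP[fAs ks].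
(* For surpluses in [[0, C w]] the difference is at most [2 C w], which a large flow outside [A]
   provides. *)
have [fBs|fBb] := leP fB (8 * (C * w) * D%:R); last first.
  apply: (fin 0 (2 * (C * w)) 0 (C * w)).
  - by apply: okA; left.
  - by apply: okB; right; apply: big_ok.
  - by move=> s /andP[s1 s2] _; rewrite -/k; move: s2 ks; clear; lra.
  - by move=> s /andP[s1 s2]; rewrite -/k; move: s1 k0; clear; lra.
  - by apply: le_trans (pr_positive_regime n0 cT C0); move: Cth th0; clear; lra.
pose a : R := #|PA :&: A|%:R + #|QA :&: A|%:R.
pose b : R := #|PB :&: ~: A|%:R + #|QB :&: ~: A|%:R.
have ineq := @cover_inequality R T e A n PA QA PB QB k a b es cT reg erefl erefl erefl.
have a0 : 0 <= a by rewrite addr_ge0 ?ler0n.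
have b0 : 0 <= b by rewrite addr_ge0 ?ler0n.
have restr (P Q X : {set T}) : #|P :&: X|%:R + #|Q :&: X|%:R <= (#|P| + #|Q|)%:R :> R.
  by rewrite -natrD ler_nat leq_add // subset_leq_card // subsetIl.
have aF : D%:R * a + #|uncovered (inner_arcs e A) PA QA|%:R <= fA.
  apply: le_trans (_ : (D * (#|PA| + #|QA|) + #|uncovered (inner_arcs e A) PA QA|)%N%:R <= _).
    by rewrite natrD natrM lerD2r ler_wpM2l ?(ltW D0) // restr.
  by rewrite ler_nat.
have bF : D%:R * b + #|uncovered (inner_arcs e (~: A)) PB QB|%:R <= fB.
  apply: le_trans (_ : (D * (#|PB| + #|QB|) + #|uncovered (inner_arcs e (~: A)) PB QB|)%N%:R <= _).
    by rewrite natrD natrM lerD2r ler_wpM2l ?(ltW D0) // restr.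
  by rewrite ler_nat.
move: ineq aF bF.
move: (#|uncovered (inner_arcs e A) PA QA|%:R : R) (ler0n R #|uncovered (inner_arcs e A) PA QA|) => eA eA0.
move: (#|uncovered (inner_arcs e (~: A)) PB QB|%:R : R) (ler0n R #|uncovered (inner_arcs e (~: A)) PB QB|) => eB eB0.
move=> ineq aF bF.
have fgam : 8 * (C * w) * D%:R <= gam * n%:R.
  have -> : 8 * (C * w) * D%:R = 8 * C * w * D%:R by ring.
  apply: le_trans (_ : 8 * C * w * (del * w) <= _).
    by rewrite ler_wpM2l // !mulr_ge0 // ltW.
  have -> : 8 * C * w * (del * w) = 8 * C * del * (w * w) by ring.
  by rewrite w2 ler_wpM2r // ler0n.
have small_ok (f y : R) : 0 <= y -> D%:R * y <= f -> f <= 8 * (C * w) * D%:R ->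
    y / 2 - gam * w <= 0 \/ c0 * D%:R <= f /\ (y / 2 - gam * w) * D%:R <= (1 - g) * f / 2.
  move=> y0 yf fs; have [cf|cf] := leP (c0 * D%:R) f; [right|left]; last first.
    have : y < c0 by rewrite -(ltr_pM2l D0) [D%:R * c0]mulrC; apply: le_lt_trans cf.
    by move: wgam c00; clear; lra.
  split=> //; have : g * f <= 2 * (gam * w) * D%:R.
    apply: le_trans (_ : g * (8 * (C * w) * D%:R) <= _); first by rewrite ler_pM2l.
    have -> : g * (8 * (C * w) * D%:R) = g * (4 * C) * (2 * w * D%:R) by ring.
    have -> : 2 * (gam * w) * D%:R = gam * (2 * w * D%:R) by ring.
    by rewrite ler_wpM2r // !mulr_ge0 // ltW.
  by move: yf; clear; lra.
have DA0 : 0 <= D%:R * a by rewrite mulr_ge0 // ltW.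
have DB0 : 0 <= D%:R * b by rewrite mulr_ge0 // ltW.
(* Forests of about [a / 2] and [b / 2] arcs survive, so [k + s] may range over [[- a / 2, b / 2]].
   In the product [(I + 1) * (J + 1)] the term [- k ^ 2] is compensated by [2 * k ^ 2] in
   [cover_inequality]. *)
pose I := a / 2 + k; pose J := b / 2 - k.
have IJ : (1 - gam) * n%:R <= (I + 1) * (J + 1).
  have -> : (I + 1) * (J + 1) = ((1 - k) * a + (1 + k) * b + a * b / 2) / 2 + 1 - k ^+ 2.
    by rewrite /I /J; field.
  by move: ineq aF bF fAs fBs fgam DA0 DB0; clear; lra.
have I1 : 0 < I + 1 by rewrite /I; move: a0 k0; clear; lra.
have J1 : 0 < J + 1.
  have : 0 < (I + 1) * (J + 1).
    apply: lt_le_trans IJ; rewrite mulr_gt0 //; move: gam16 n1000; clear; lra.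
  by rewrite pmulr_rgt0.
apply: (fin (a / 2 - gam * w) (b / 2 - gam * w) (- I + gam * w) (J - gam * w)).
- apply: okA; apply: small_ok => //; move: aF eA0; clear; lra.
- apply: okB; apply: small_ok => //; move: bF eB0; clear; lra.
- by move=> s /andP[s1 s2] _; rewrite -/k; move: s2; rewrite /J; clear; lra.
- by move=> s /andP[s1 s2] _; rewrite -/k; move: s1; rewrite /I; clear; lra.
- exact: hn1.
Qed.

End Regimes.

(** * Combination of the three cases *)

Theorem theorem4p1 (R : realType) (theta : R) (theta_gt0 : 0 < theta) :
  exists n0 : nat, forall n : nat, (n0 <= n)%N ->
  forall G : sgraph, #|G| = (2 * n)%N -> regular n.+1 G ->
    2^-1 - theta < uniform_pr R (fun S : {set G} => hamiltonian (induced S)).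
Proof.
have th2 : 0 < theta / 2 by rewrite divr_gt0.
have [eta [eta0 eta1 etaC etaB]] : exists eta : R,
    [/\ 0 < eta, eta <= 1, 1000 * (1000 * eta) <= 1 & 100 * eta <= (1 / 1000) ^+ 2].
  (* A single [eta] meeting the smallness conditions of both near-extremal cases. *)
  exists ((1 / 1000) ^+ 3); split; rewrite ?exprn_gt0 ?divr_gt0 ?ltr0n //; lra.
have [n1 hn1] := nonextremal_case eta0 eta1 th2.
have [n2 hn2] := clique_case eta0 etaC th2.
have [n3 hn3] := bip_case eta0 etaB th2.
exists (n1 + n2 + n3)%N => n nn G cG reg.
have [nn1 nn2 nn3] : [/\ n1 <= n, n2 <= n & n3 <= n]%N by split; lia.
have es : symmetric (@adj G) := @adj_sym G.
have ei : irreflexive (@adj G) := @adj_irr G.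
suff : 1 / 2 - theta / 2 <= uniform_pr R (ham (@adj G)).
  have : uniform_pr R (ham (@adj G)) <= uniform_pr R (fun S : {set G} => hamiltonian (induced S)).
    by apply: pr_mono => S; apply: hamiltonian_induced.
  by move: th2; clear; lra.
have [[x hC]|noC] := pselect (exists x : G, (1 - eta) * n%:R <= #|clique_like (@adj G) n eta x|%:R).
  have := hn2 n G (@adj G) nn2 cG es ei reg (ex_intro _ x hC).
  by move: th2; clear; lra.
have [hB|noB] := pselect (exists x : G, (1 - eta) * n%:R <= #|bip_like (@adj G) n eta x|%:R).
  exact: hn3 nn3 cG es ei reg hB.
apply: (hn1 n G _ nn1 cG es ei reg) => x; rewrite ltNge; apply/negP => h; [apply: noC|apply: noB]; by exists x.
Qed.
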